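(* Let $\Omega\in\mathrm{OR}$ be such that $V_\Omega\models\mathsf{ZF}+$ ''there is a Berkeley cardinal''. Then there is no $A\subseteq V_\Omega$ such that $(V_\Omega,A)\models\mathsf{ZF}(A)+$ ''$V=\mathrm{HOD}_A(X)$ for some set $X$''.
   Context: $\delta$ is Berkeley iff for every transitive set $M$ with $\delta\in M$ and every $\eta<\delta$ there is an elementary $j:M\to M$ with $\eta<\mathrm{cr}(j)<\delta$. $\mathsf{ZF}(A)$ is $\mathsf{ZF}$ in the language with $\in$ and a predicate $A$, with Separation and Collection for all formulas of that language. $\mathrm{OD}_A(X)$ is the class of sets definable (using the predicate $A$) from parameters in $\mathrm{OR}\cup X$, and $\mathrm{HOD}_A(X)$ is the class of $y$ such that the transitive closure of $\{y\}$ is contained in $\mathrm{OD}_A(X)$. *)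

(* Defs.v *)
(* Plain Rocq, no library beyond the prelude.

   The background theory is ZF, rendered semantically: a theorem of ZF is a
   statement true in every model of first-order ZF.  The Separation and
   Collection schemata of the background model range over a deeply embedded
   syntax.  It would not do to take Rocq-definable classes instead, since choice
   at the meta level would then make the model satisfy AC, and Berkeley cardinals
   contradict AC.

   Satisfaction for set-sized structures ("V_Omega satisfies ZF", "j is
   elementary", "definable over V_alpha") is the notion internal to the model:
   formulas are coded by sets, and natural numbers are those of the model, which
   may be nonstandard. *)

Set Implicit Arguments.
Unset Strict Implicit.
Unset Printing Implicit Defensive.

Record eps_struct : Type := EpsStruct {
  carrier :> Type;
  mem : carrier -> carrier -> Prop
}.

Declare Scope eps_scope.
Notation "x ∈ y" := (mem x y) (at level 70, no associativity) : eps_scope.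
Notation "x ⊆ y" := (forall z, mem z x -> mem z y)
  (at level 70, no associativity) : eps_scope.
Open Scope eps_scope.

Definition substruct (M : eps_struct) (u : M) : eps_struct :=
  {| carrier := {x : M | x ∈ u};
     mem := fun x y => proj1_sig x ∈ proj1_sig y |}.

Section Basics.
Context {S : eps_struct}.
Implicit Types x y z a b c d e f i j n s v w p : S.

Definition is_empty x := forall z, ~ z ∈ x.
Definition is_upair p a b := forall z, z ∈ p <-> z = a \/ z = b.
Definition is_succ y x := forall z, z ∈ y <-> z ∈ x \/ z = x.
Definition is_opair p a b :=
  forall z, z ∈ p <-> is_upair z a a \/ is_upair z a b.

(* The ordered pair (a, b) is an element of f. *)
Definition rel f a b := exists p, p ∈ f /\ is_opair p a b.

Definition is_function_on f a :=
  (forall p, p ∈ f -> exists x y, x ∈ a /\ is_opair p x y) /\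
  (forall x, x ∈ a -> exists y, rel f x y) /\
  (forall x y y', rel f x y -> rel f x y' -> y = y').
Definition is_function f a b :=
  is_function_on f a /\ (forall x y, rel f x y -> y ∈ b).
Definition is_bijection f a b :=
  is_function f a b /\
  (forall x x' y, rel f x y -> rel f x' y -> x = x') /\
  (forall y, y ∈ b -> exists x, rel f x y).

Definition is_transitive x := forall y, y ∈ x -> y ⊆ x.
(* Adequate in the presence of Foundation. *)
Definition is_ordinal x :=
  is_transitive x /\ (forall y, y ∈ x -> is_transitive y).
Definition is_cardinal x :=
  is_ordinal x /\ (forall y, y ∈ x -> ~ exists f, is_bijection f y x).

Definition is_inductive x :=
  (forall y, is_empty y -> y ∈ x) /\
  (forall y z, y ∈ x -> is_succ z y -> z ∈ x).
Definition is_omega w :=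
  is_inductive w /\ (forall y, is_inductive y -> w ⊆ y).
Definition is_nat n := exists w, is_omega w /\ n ∈ w.

Fixpoint is_numeral (k : nat) (x : S) : Prop :=
  match k with
  | O => is_empty x
  | Datatypes.S k => exists y, is_numeral k y /\ is_succ x y
  end.

(* v = V_alpha, via the recursion V_beta = the union of the power sets of the
   V_gamma for gamma < beta. *)
Definition is_V (alpha v : S) :=
  exists alpha1 f, is_succ alpha1 alpha /\ is_function_on f alpha1 /\
    (forall beta u, rel f beta u ->
       forall x, x ∈ u <-> exists gamma w, gamma ∈ beta /\ rel f gamma w /\ x ⊆ w) /\
    rel f alpha v.

Definition is_trcl (t x : S) :=
  x ⊆ t /\ is_transitive t /\
  (forall u : S, x ⊆ u -> is_transitive u -> t ⊆ u).

Definition tagged (k : nat) c b := exists n, is_numeral k n /\ is_opair c n b.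
Definition tagged2 (k : nat) c a b := exists p, is_opair p a b /\ tagged k c p.

(* Variables are v_i for i a natural number of the structure. *)
Definition code_mem c i j := is_nat i /\ is_nat j /\ tagged2 0 c i j.
Definition code_eq c i j := is_nat i /\ is_nat j /\ tagged2 1 c i j.
Definition code_pred c i := is_nat i /\ tagged 2 c i.
Definition code_neg c d := tagged 3 c d.
Definition code_and c d e := tagged2 4 c d e.
Definition code_ex c i d := is_nat i /\ tagged2 5 c i d.

(* [pred] tells whether the language has the unary predicate symbol besides
   membership and equality. *)
Definition formula_closed (pred : bool) (F : S) :=
  (forall c i j, code_mem c i j -> c ∈ F) /\
  (forall c i j, code_eq c i j -> c ∈ F) /\
  (pred = true -> forall c i, code_pred c i -> c ∈ F) /\
  (forall c d, code_neg c d -> d ∈ F -> c ∈ F) /\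
  (forall c d e, code_and c d e -> d ∈ F -> e ∈ F -> c ∈ F) /\
  (forall c i d, code_ex c i d -> d ∈ F -> c ∈ F).
Definition is_formula (pred : bool) (c : S) :=
  forall F, formula_closed pred F -> c ∈ F.

(* Assignments are total functions from omega to u; only finitely many of their
   values matter to any given formula. *)
Definition is_assign (u s : S) := exists w, is_omega w /\ is_function s w u.

(* s' = s[i := x] *)
Definition is_update (u s i x s' : S) :=
  is_assign u s' /\ rel s' i x /\
  (forall n y, n <> i -> (rel s' n y <-> rel s n y)).

Definition has_pred (A : option S) : bool :=
  match A with Some _ => true | None => false end.

(* T is a satisfaction relation, i.e. a set of pairs (formula, assignment) that
   obeys Tarski's clauses, for the structure (u, ∈) if A = None and for
   (u, ∈, a ∩ u) if A = Some a. *)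
Definition is_sat_rel (u : S) (A : option S) (T : S) :=
  forall s, is_assign u s ->
  (forall c i j, code_mem c i j ->
     (rel T c s <-> exists x y, rel s i x /\ rel s j y /\ x ∈ y)) /\
  (forall c i j, code_eq c i j ->
     (rel T c s <-> exists x, rel s i x /\ rel s j x)) /\
  (match A with
   | Some a => forall c i, code_pred c i ->
       (rel T c s <-> exists x, rel s i x /\ x ∈ a)
   | None => True
   end) /\
  (forall c d, is_formula (has_pred A) d -> code_neg c d ->
     (rel T c s <-> ~ rel T d s)) /\
  (forall c d e, is_formula (has_pred A) d -> is_formula (has_pred A) e ->
     code_and c d e -> (rel T c s <-> rel T d s /\ rel T e s)) /\
  (forall c i d, is_formula (has_pred A) d -> code_ex c i d ->
     (rel T c s <->
        exists x s', x ∈ u /\ is_update u s i x s' /\ rel T d s')).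

Definition Sat (u : S) (A : option S) (c s : S) :=
  exists T, is_sat_rel u A T /\ rel T c s.

(* Satisfaction of c under s[0 := x], resp. under s[0 := x, 1 := y]. *)
Definition Sat1 (u : S) (A : option S) (c s x : S) :=
  exists i s', is_numeral 0 i /\ is_update u s i x s' /\ Sat u A c s'.
Definition Sat2 (u : S) (A : option S) (c s x y : S) :=
  exists i j s' s'', is_numeral 0 i /\ is_numeral 1 j /\
    is_update u s i x s' /\ is_update u s' j y s'' /\ Sat u A c s''.

Definition is_elementary (j N : S) :=
  is_function j N N /\
  (forall c s s', is_formula false c -> is_assign N s -> is_assign N s' ->
     (forall n x y, rel s n x -> rel j x y -> rel s' n y) ->
     (Sat N None c s <-> Sat N None c s')).

Definition is_crit (j kappa : S) :=
  is_ordinal kappa /\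
  (exists x, rel j kappa x /\ x <> kappa) /\
  (forall beta, beta ∈ kappa -> rel j beta beta).

(* Nonemptiness rules out delta = 0, for which the last clause is vacuous. *)
Definition is_Berkeley_cardinal (delta : S) :=
  is_cardinal delta /\ ~ is_empty delta /\
  (forall N : S, is_transitive N -> delta ∈ N ->
   forall eta, eta ∈ delta ->
   exists j kappa, is_elementary j N /\ is_crit j kappa /\
     eta ∈ kappa /\ kappa ∈ delta).

(* As usual in ZF(A), definability over the universe is expressed (by the
   reflection theorem) as definability over some (V_alpha, ∈, A ∩ V_alpha).
   Variable 0 stands for the object defined, the other ones for parameters. *)
Definition OD (A : S -> Prop) (X x : S) :=
  exists alpha v a, is_ordinal alpha /\ is_V alpha v /\
    (forall y, y ∈ a <-> y ∈ v /\ A y) /\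
    x ∈ v /\
    exists c s, is_formula true c /\ is_assign v s /\
      (forall n y, ~ is_empty n -> rel s n y -> is_ordinal y \/ y ∈ X) /\
      (forall y, y ∈ v -> (Sat1 v (Some a) c s y <-> y = x)).

Definition HOD (A : S -> Prop) (X y : S) :=
  exists p t, is_upair p y y /\ is_trcl t p /\ (forall z, z ∈ t -> OD A X z).

Definition ZF_finite_part :=
  (forall x y, (forall z, z ∈ x <-> z ∈ y) -> x = y) /\
  (forall x, ~ is_empty x -> exists y, y ∈ x /\ forall z, ~ (z ∈ x /\ z ∈ y)) /\
  (forall a b, exists p, is_upair p a b) /\
  (forall x, exists y, forall z, z ∈ y <-> exists w, w ∈ x /\ z ∈ w) /\
  (forall x, exists y, forall z, z ∈ y <-> z ⊆ x) /\
  (exists x, (exists z, is_empty z /\ z ∈ x) /\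
     forall y, y ∈ x -> exists z, is_succ z y /\ z ∈ x).

Definition separation_for (P : S -> Prop) :=
  forall a, exists b, forall x, x ∈ b <-> x ∈ a /\ P x.
Definition collection_for (R : S -> S -> Prop) :=
  forall a, (forall x, x ∈ a -> exists y, R x y) ->
  exists b, forall x, x ∈ a -> exists y, y ∈ b /\ R x y.

End Basics.

Arguments ZF_finite_part : clear implicits.

(* First-order formulas of the language of set theory, with de Bruijn indices. *)
Inductive form : Type :=
| FMem (i j : nat)
| FEq (i j : nat)
| FNeg (phi : form)
| FAnd (phi psi : form)
| FEx (phi : form).

Definition scons {T : Type} (x : T) (rho : nat -> T) (n : nat) : T :=
  match n with O => x | Datatypes.S m => rho m end.

Fixpoint sat (M : eps_struct) (rho : nat -> M) (phi : form) : Prop :=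
  match phi with
  | FMem i j => rho i ∈ rho j
  | FEq i j => rho i = rho j
  | FNeg phi => ~ sat rho phi
  | FAnd phi psi => sat rho phi /\ sat rho psi
  | FEx phi => exists x : M, sat (scons x rho) phi
  end.

Definition models_ZF (M : eps_struct) : Prop :=
  ZF_finite_part M /\
  forall (phi : form) (rho : nat -> M),
    separation_for (fun x => sat (scons x rho) phi) /\
    collection_for (fun x y => sat (scons x (scons y rho)) phi).

(* (u, ∈) satisfies ZF if A = None, and (u, ∈, a) satisfies ZF(A) if A = Some a;
   the schemata range over the internal formulas of M, with parameters in u. *)
Definition set_models_ZF (M : eps_struct) (u : M) (A : option M) : Prop :=
  ZF_finite_part (substruct u) /\
  forall c s : M, is_formula (has_pred A) c -> is_assign u s ->
    separation_for (fun x : substruct u => Sat1 u A c s (proj1_sig x)) /\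
    collection_for (fun x y : substruct u =>
      Sat2 u A c s (proj1_sig x) (proj1_sig y)).

(* Main.v *)
Require Import Defs.
From Stdlib Require Import Classical ClassicalEpsilon Arith Lia.

Set Implicit Arguments.
Unset Strict Implicit.
Unset Printing Implicit Defensive.

(* Kunen's inconsistency argument in Woodin's form, with choice replaced by the
   choice modulo parameters that V = HOD_A(X) provides.

   Let delta be Berkeley in V_Omega and let Z be a set, large enough to code
   pairs of its own elements, formulas, finite sequences from X, and ordinals
   below delta.  If every set is definable from A, ordinals and elements of X,
   then minimizing the ordinals of a definition gives, for every definable family
   of nonempty sets E_i, a definable partial function e(i, z) in E_i, z in Z, that
   is defined for some z for each i.

   Let theta be the least ordinal that is not a surjective image of Z.  Choosing
   surjections from Z onto the ordinals alpha < theta in this way yields a single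
   map g with alpha = {g(alpha, z) : z in Z}, up to values outside alpha, whence no
   function from Z to theta is cofinal.  Hence any family, indexed by Z, of
   increasing omega-continuous functions theta -> theta has common fixed points
   above every ordinal < theta, and by Ulam's argument there is a z such that for
   unboundedly many xi the set {alpha : g(alpha, z) = xi} meets the fixed points of
   every such function.  Let b enumerate delta many of these xi.

   An elementary k of a suitable transitive set N with critical point kappa < delta
   fixes theta, b and G = g(., z) if N has these in a parameter-free definable
   tuple.  As k restricted to theta is increasing and omega-continuous, it fixes
   some alpha with G(alpha) = b(kappa); hence b(k(kappa)) = k(b(kappa)) =
   k(G(alpha)) = G(alpha) = b(kappa) and k(kappa) = kappa, a contradiction.

   Replacement in V_Omega is needed only for the existence of theta; separation
   in V_Omega holds for all properties first-order definable in M. *)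

(** * Abstract first-order definability of predicates on tuples *)

Fixpoint Ctx (T : Type) (n : nat) : Type :=
  match n with O => unit | Datatypes.S n => (Ctx T n * T)%type end.

(** Terms are Rocq functions of the context, certified to be constants from [K] or projections.
    Definability can then be certified for the propositions of the development themselves, without
    reifying them into syntax. *)
Inductive Tm (T : Type) (K : T -> Prop) : forall n, (Ctx T n -> T) -> Prop :=
| Tm_c n a : K a -> @Tm T K n (fun _ => a)
| Tm_0 n : @Tm T K (Datatypes.S n) (fun g => snd g)
| Tm_s n t : @Tm T K n t -> @Tm T K (Datatypes.S n) (fun g => t (fst g)).

(* [Kc] tells which elements definitions may mention as parameters. *)
Record defsys (S : eps_struct) := {
  Kc : S -> Prop;
  Df : forall n, (Ctx S n -> Prop) -> Prop;
  Df_iff : forall n (P Q : Ctx S n -> Prop),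
    (forall g, P g <-> Q g) -> Df P -> Df Q;
  Df_mem : forall n t u, @Tm S Kc n t -> Tm Kc u -> Df (fun g => t g ∈ u g);
  Df_eq : forall n t u, @Tm S Kc n t -> Tm Kc u -> Df (fun g => t g = u g);
  Df_not : forall n (P : Ctx S n -> Prop), Df P -> Df (fun g => ~ P g);
  Df_and : forall n (P Q : Ctx S n -> Prop), Df P -> Df Q -> Df (fun g => P g /\ Q g);
  Df_ex : forall n (P : Ctx S n -> S -> Prop),
    @Df (Datatypes.S n) (fun g => P (fst g) (snd g)) -> Df (fun g => exists x, P g x)
}.

Section DefsysTheory.
Context {S : eps_struct} (d : defsys S).

Lemma Df_or n (P Q : Ctx S n -> Prop) : Df d P -> Df d Q -> Df d (fun g => P g \/ Q g).
Proof.
  intros HP HQ.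
  apply (@Df_iff S d n (fun g => ~ (~ P g /\ ~ Q g))).
  - intros g; split; [intros H; apply NNPP; tauto | tauto].
  - apply Df_not, Df_and; apply Df_not; assumption.
Qed.

Lemma Df_imp n (P Q : Ctx S n -> Prop) : Df d P -> Df d Q -> Df d (fun g => P g -> Q g).
Proof.
  intros HP HQ.
  apply (@Df_iff S d n (fun g => ~ (P g /\ ~ Q g))).
  - intros g; split; [intros H p; apply NNPP; tauto | tauto].
  - apply Df_not, Df_and; [|apply Df_not]; assumption.
Qed.

Lemma Df_bi n (P Q : Ctx S n -> Prop) : Df d P -> Df d Q -> Df d (fun g => P g <-> Q g).
Proof.
  intros HP HQ. unfold iff. apply Df_and; apply Df_imp; assumption.
Qed.

Lemma Df_all n (P : Ctx S n -> S -> Prop) :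
  @Df S d (Datatypes.S n) (fun g => P (fst g) (snd g)) ->
  Df d (fun g => forall x, P g x).
Proof.
  intros HP.
  apply (@Df_iff S d n (fun g => ~ exists x, ~ P g x)).
  - intros g; split.
    + intros H x. apply NNPP. intros H'. apply H. exists x. exact H'.
    + intros H [x Hx]. auto.
  - apply Df_not, Df_ex, Df_not. exact HP.
Qed.

(** Excluded middle makes [p] equivalent to truth or falsity, and truth is expressed as a variable
    being equal to itself; hence the context with at least one entry. Side conditions such as
    [pred = true] are handled this way. *)
Lemma Df_const n (p : Prop) : Df d (fun _ : Ctx S (Datatypes.S n) => p).
Proof.
  assert (H : Df d (fun g : Ctx S (Datatypes.S n) => snd g = snd g))
    by (apply Df_eq; apply Tm_0).
  destruct (classic p) as [Hp | Hp].
  - apply (Df_iff (P := fun g : Ctx S (Datatypes.S n) => snd g = snd g)); tauto.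
  - apply (Df_iff (P := fun g : Ctx S (Datatypes.S n) => ~ snd g = snd g)); [tauto|].
    apply Df_not; exact H.
Qed.
End DefsysTheory.

Ltac df_unf := cbv beta iota delta
  [is_empty is_upair is_succ is_opair rel is_function_on is_function
   is_bijection is_transitive is_ordinal is_cardinal is_inductive is_omega
   is_nat is_numeral is_V is_trcl tagged tagged2 code_mem code_eq code_pred
   code_neg code_and code_ex formula_closed is_formula is_assign is_update
   has_pred is_sat_rel Sat Sat1 Sat2 is_elementary].

Create HintDb df.

Ltac df_tm :=
  cbv beta;
  lazymatch goal with
  | |- Tm _ (fun _ => ?a) =>
    refine (@Tm_c _ _ _ a _); solve [exact I | auto with df nocore]
  | |- @Tm ?T ?K (Datatypes.S ?n) ?f =>
    first
    [ assumption
    | let h := eval cbn [fst snd] in (fun (g : Ctx T n) (x : T) => f (g, x)) in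
      lazymatch h with
      | fun _ x => x => exact (@Tm_0 T K n)
      | fun g x => @?t g => refine (@Tm_s T K n t _); df_tm
      end ]
  | |- _ => assumption
  end.

(* Hooks for predicates that have their own definability lemma. *)
Ltac df_user := fail.
Ltac df_more := fail.

(** Implications and universal quantifiers are both products, so both lemmas are tried in turn.
    Definitions are unfolded only as a last resort, after the lemmas registered in the hooks. *)
Ltac df :=
  cbv beta;
  lazymatch goal with
  | |- @Df _ _ _ (fun g => _ /\ _) => apply Df_and; df
  | |- @Df _ _ _ (fun g => _ \/ _) => apply Df_or; df
  | |- @Df _ _ _ (fun g => ~ _) => apply Df_not; df
  | |- @Df _ _ _ (fun g => _ <-> _) => apply Df_bi; df
  | |- @Df _ _ _ (fun g => exists x, _) => apply Df_ex; df
  | |- @Df _ _ _ (fun g => mem _ _) => apply Df_mem; df_tm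
  | |- @Df _ _ _ (fun g => @eq bool _ _) => apply Df_const
  | |- @Df _ _ _ (fun g => _ = _) => apply Df_eq; df_tm
  | |- @Df _ _ _ (fun g => True) => apply Df_const
  | |- _ =>
    first [ df_user; df | df_more; df | apply Df_imp; df | apply Df_all; df
          | progress df_unf; df ]
  end.

Lemma Df_is_formula {S : eps_struct} (d : defsys S) n b (t : Ctx S n -> S) :
  Tm (Kc d) t -> Df d (fun g => is_formula b (t g)).
Proof. intros. df. Qed.

(** Certified once and then used as a lemma, which spares later calls of [df] the unfolding of this
    large formula. *)
Lemma Df_sat_rel {S : eps_struct} (d : defsys S) n (t0 t1 t2 : Ctx S n -> S) :
  Tm (Kc d) t0 -> Tm (Kc d) t1 -> Tm (Kc d) t2 ->
  Df d (fun g => is_sat_rel (t0 g) (Some (t1 g)) (t2 g)).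
Proof. intros. df. Qed.

Ltac df_user ::=
  lazymatch goal with
  | |- @Df _ _ _ (fun g => is_formula _ _) => apply Df_is_formula; df_tm
  | |- @Df _ _ _ (fun g => is_sat_rel _ (Some _) _) => apply Df_sat_rel; df_tm
  end.

(** * Definability in a model by formulas of [form] with parameters *)

Fixpoint ren (r : nat -> nat) (phi : form) : form :=
  match phi with
  | FMem i j => FMem (r i) (r j)
  | FEq i j => FEq (r i) (r j)
  | FNeg phi => FNeg (ren r phi)
  | FAnd phi psi => FAnd (ren r phi) (ren r psi)
  | FEx phi => FEx (ren (fun n => match n with O => O | Datatypes.S m => Datatypes.S (r m) end) phi)
  end.

Lemma sat_ren (M : eps_struct) (phi : form) : forall (r : nat -> nat) (rho rho' : nat -> M),
  (forall i, rho' i = rho (r i)) -> (sat rho' phi <-> sat rho (ren r phi)).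
Proof.
  induction phi; intros r rho rho' H; simpl.
  - rewrite !H; tauto.
  - rewrite !H; tauto.
  - rewrite (IHphi _ _ _ H); tauto.
  - rewrite (IHphi1 _ _ _ H), (IHphi2 _ _ _ H); tauto.
  - split; intros [x Hx]; exists x; revert Hx; apply IHphi; intros [|i]; simpl; auto.
Qed.

Fixpoint ext (T : Type) (n : nat) : Ctx T n -> (nat -> T) -> nat -> T :=
  match n with
  | O => fun _ rho => rho
  | Datatypes.S n => fun g rho => scons (snd g) (ext (fst g) rho)
  end.

Lemma ext_lt (T : Type) n : forall (g : Ctx T n) rho rho' i, i < n -> ext g rho i = ext g rho' i.
Proof.
  induction n; intros g rho rho' i Hi; [lia|].
  destruct i; simpl; auto. apply IHn. lia.
Qed.

Lemma ext_ge (T : Type) n : forall (g : Ctx T n) rho i, ext g rho (n + i) = rho i.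
Proof. induction n; intros; simpl; auto. Qed.

Lemma Tm_index (T : Type) (K : T -> Prop) n (t : Ctx T n -> T) : Tm K t ->
  (exists a, K a /\ forall g, t g = a) \/
  (exists i, i < n /\ forall g rho, t g = ext g rho i).
Proof.
  induction 1 as [n a Ha | n | n t Ht IH].
  - left; exists a; auto.
  - right; exists 0; split; [lia | auto].
  - destruct IH as [[a [Ha E]] | [i [Hi E]]].
    + left; exists a; auto.
    + right; exists (Datatypes.S i); split; [lia | intros; apply E].
Qed.

(** The context occupies the first [n] de Bruijn indices; the tail [rho] of the assignment holds the
    parameters. *)
Definition form_def (M : eps_struct) n (P : Ctx M n -> Prop) : Prop :=
  exists phi rho, forall g, P g <-> sat (ext g rho) phi.

Lemma form_def_atom (M : eps_struct) (m0 : M) n (t u : Ctx M n -> M)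
    (At : M -> M -> Prop) (F : nat -> nat -> form) :
  (forall rho i j, sat rho (F i j) <-> At (rho i) (rho j)) ->
  Tm (fun _ => True) t -> Tm (fun _ => True) u -> form_def (fun g => At (t g) (u g)).
Proof.
  intros HF Ht Hu.
  destruct (Tm_index Ht) as [[a [_ Ea]] | [i [_ Ei]]],
           (Tm_index Hu) as [[b [_ Eb]] | [j [_ Ej]]].
  - exists (F (n + 0) (n + 1)), (scons a (fun _ => b)). intros g.
    rewrite HF, !ext_ge, Ea, Eb. simpl. tauto.
  - exists (F (n + 0) j), (fun _ => a). intros g.
    rewrite HF, !ext_ge, Ea, (Ej g (fun _ => a)). tauto.
  - exists (F i (n + 0)), (fun _ => b). intros g.
    rewrite HF, !ext_ge, Eb, (Ei g (fun _ => b)). tauto.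
  - exists (F i j), (fun _ => m0). intros g.
    rewrite HF, (Ei g (fun _ => m0)), (Ej g (fun _ => m0)). tauto.
Qed.

(** The conjuncts come with different parameter assignments. These are interleaved into one, the
    first on even and the second on odd positions, and the formulas are renamed accordingly. *)
Lemma form_def_and (M : eps_struct) n (P Q : Ctx M n -> Prop) :
  form_def P -> form_def Q -> form_def (fun g => P g /\ Q g).
Proof.
  intros [phi [rho Hp]] [psi [sigma Hq]].
  set (r1 := fun i => if i <? n then i else n + 2 * (i - n)).
  set (r2 := fun i => if i <? n then i else n + (1 + 2 * (i - n))).
  set (tau := fun k => if Nat.even k then rho (Nat.div2 k) else sigma (Nat.div2 k)).
  exists (FAnd (ren r1 phi) (ren r2 psi)), tau.
  intros g. simpl. rewrite Hp, Hq.
  assert (H1 : forall i, ext g rho i = ext g tau (r1 i)).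
  { intros i. unfold r1. destruct (Nat.ltb_spec i n) as [Hi | Hi].
    - apply ext_lt; auto.
    - replace i with (n + (i - n)) at 1 by lia. rewrite !ext_ge. unfold tau.
      rewrite Nat.even_mul, Nat.div2_double. reflexivity. }
  assert (H2 : forall i, ext g sigma i = ext g tau (r2 i)).
  { intros i. unfold r2. destruct (Nat.ltb_spec i n) as [Hi | Hi].
    - apply ext_lt; auto.
    - replace i with (n + (i - n)) at 1 by lia. rewrite !ext_ge. unfold tau.
      rewrite Nat.even_add, Nat.even_mul.
      change (Nat.even 1) with false. change (Nat.even 2) with true. cbn [orb Bool.eqb].
      replace (1 + 2 * (i - n)) with (Datatypes.S (2 * (i - n))) by lia.
      rewrite Nat.div2_succ_double. reflexivity. }
  rewrite (sat_ren phi H1), (sat_ren psi H2). tauto.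
Qed.

Definition form_defsys (M : eps_struct) (m0 : M) : defsys M.
Proof.
  refine {| Kc := fun _ => True; Df := @form_def M |}.
  - intros n P Q H [phi [rho Hp]]. exists phi, rho. intros g. rewrite <- H. apply Hp.
  - intros n t u Ht Hu. apply (form_def_atom m0 (At := fun x y => x ∈ y) (F := FMem)); auto.
    simpl; tauto.
  - intros n t u Ht Hu. apply (form_def_atom m0 (At := fun x y => x = y) (F := FEq)); auto.
    simpl; tauto.
  - intros n P [phi [rho Hp]]. exists (FNeg phi), rho. intros g. simpl. rewrite Hp. tauto.
  - intros n P Q. apply form_def_and.
  - intros n P [phi [rho Hp]]. exists (FEx phi), rho. intros g. simpl. split.
    + intros [x Hx]. exists x. apply (Hp (g, x)). exact Hx.
    + intros [x Hx]. exists x. apply (Hp (g, x)). exact Hx.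
Defined.

(** * Zermelo set theory with separation for definable properties *)

(** Both the ambient model and its $V_\Omega$ become instances, so the theory below is developed
    once for the two. Every element may be a parameter, by [z_K]. *)
Class zermelo (S : eps_struct) := {
  zd : defsys S;
  z_K : forall x : S, Kc zd x;
  z_ext : forall x y : S, (forall z, z ∈ x <-> z ∈ y) -> x = y;
  z_found : forall x : S, ~ is_empty x -> exists y, y ∈ x /\ forall z, ~ (z ∈ x /\ z ∈ y);
  z_pair : forall a b : S, exists p, is_upair p a b;
  z_union : forall x : S, exists y, forall z, z ∈ y <-> exists w, w ∈ x /\ z ∈ w;
  z_pow : forall x : S, exists y : S, forall z, z ∈ y <-> z ⊆ x;
  z_sep : forall P : S -> Prop, @Df S zd 1 (fun g => P (snd g)) -> separation_for P;
  z_inf : exists x : S, (exists z, is_empty z /\ z ∈ x) /\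
    forall y, y ∈ x -> exists z, is_succ z y /\ z ∈ x
}.

(* [H] contains all codes of formulas. *)
Class hf (S : eps_struct) := {
  z_hf : exists H : S, (forall x, is_empty x -> x ∈ H) /\
    (forall x y z, x ∈ H -> y ∈ H -> is_upair z x y -> z ∈ H) /\
    (forall x z, x ∈ H -> is_succ z x -> z ∈ H)
}.
#[export] Hint Resolve z_K : df.

(** * Sets, ordinals and natural numbers *)

Tactic Notation "sep" uconstr(P) constr(a) "as" ident(b) ident(H) :=
  destruct (z_sep (P := P) ltac:(df) a) as [b H]; cbv beta in H.

(** Choice at the meta level, used to name individual sets. It yields no choice functions inside the
    model, because separation still requires a definable property. *)
Definition pick {T : Type} {P : T -> Prop} (h : exists x, P x) : T :=
  proj1_sig (constructive_indefinite_description P h).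

Lemma pickP {T : Type} {P : T -> Prop} (h : exists x, P x) : P (pick h).
Proof. exact (proj2_sig (constructive_indefinite_description P h)). Qed.

Section Sets.
Context {S : eps_struct} {ZS : zermelo S}.
Implicit Types a b x y z p q f w : S.

Definition upair a b : S := pick (z_pair a b).
Definition opair a b : S := upair (upair a a) (upair a b).
Definition Un a : S := pick (z_union a).
Definition pow a : S := pick (z_pow a).
Definition cup a b : S := Un (upair a b).
Definition succ a : S := cup a (upair a a).

Lemma upairE a b z : z ∈ upair a b <-> z = a \/ z = b.
Proof. exact (pickP (z_pair a b) z). Qed.
Lemma UnE a z : z ∈ Un a <-> exists w, w ∈ a /\ z ∈ w.
Proof. exact (pickP (z_union a) z). Qed.
Lemma powE a z : z ∈ pow a <-> z ⊆ a.
Proof. exact (pickP (z_pow a) z). Qed.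
Lemma cupE a b z : z ∈ cup a b <-> z ∈ a \/ z ∈ b.
Proof.
  unfold cup. rewrite UnE. split.
  - intros [w [Hw Hz]]. apply upairE in Hw. destruct Hw; subst; auto.
  - intros [H | H]; [exists a | exists b]; rewrite upairE; auto.
Qed.
Lemma succE a z : z ∈ succ a <-> z ∈ a \/ z = a.
Proof. unfold succ. rewrite cupE, upairE. tauto. Qed.

Lemma upair_iff p a b : is_upair p a b <-> p = upair a b.
Proof.
  split.
  - intros H. apply z_ext. intros z. rewrite upairE. apply H.
  - intros ->. intros z. apply upairE.
Qed.
Lemma opair_iff p a b : is_opair p a b <-> p = opair a b.
Proof.
  unfold is_opair, opair. split.
  - intros H. apply z_ext. intros z. rewrite upairE, H, !upair_iff. tauto.
  - intros ->. intros z. rewrite upairE, !upair_iff. tauto.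
Qed.
Lemma succ_iff y x : is_succ y x <-> y = succ x.
Proof.
  split.
  - intros H. apply z_ext. intros z. rewrite succE. apply H.
  - intros ->. intros z. apply succE.
Qed.
Lemma rel_iff f a b : rel f a b <-> opair a b ∈ f.
Proof.
  unfold rel. split.
  - intros [p [Hp E]]. apply opair_iff in E. subst; auto.
  - intros H. exists (opair a b). rewrite opair_iff. auto.
Qed.

Lemma opair_def a b : opair a b = upair (upair a a) (upair a b).
Proof. reflexivity. Qed.

Lemma upair_inj a b c d : upair a b = upair c d -> (a = c /\ b = d) \/ (a = d /\ b = c).
Proof.
  intros H.
  assert (Ha : a ∈ upair c d) by (rewrite <- H; apply upairE; auto).
  assert (Hb : b ∈ upair c d) by (rewrite <- H; apply upairE; auto).
  assert (Hc : c ∈ upair a b) by (rewrite H; apply upairE; auto).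
  assert (Hd : d ∈ upair a b) by (rewrite H; apply upairE; auto).
  rewrite upairE in *. intuition congruence.
Qed.
Lemma opair_inj a b c d : opair a b = opair c d -> a = c /\ b = d.
Proof.
  intros H. apply upair_inj in H. destruct H as [[H1 H2] | [H1 H2]].
  - apply upair_inj in H1. assert (a = c) by tauto. subst c.
    apply upair_inj in H2. destruct H2 as [[_ H2] | [H2 H3]]; split; congruence.
  - apply upair_inj in H1. assert (a = c) by (destruct H1; tauto). subst c.
    apply upair_inj in H2. destruct H1, H2; split; intuition congruence.
Qed.

Lemma emp_ex : exists e : S, is_empty e.
Proof.
  destruct z_inf as [H _]. sep (fun x : S => ~ x = x) H as e He.
  exists e. intros z Hz. apply He in Hz. tauto.
Qed.
Definition emp : S := pick emp_ex.
Lemma empE z : ~ z ∈ emp.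
Proof. exact (pickP emp_ex z). Qed.
Lemma emp_iff x : is_empty x <-> x = emp.
Proof.
  split.
  - intros H. apply z_ext. intros z. split; intros Hz; [destruct (H z Hz) | destruct (empE Hz)].
  - intros ->. exact empE.
Qed.
Lemma nonempty x : ~ x = emp -> exists y, y ∈ x.
Proof.
  intros H. apply NNPP. intros N. apply H. apply emp_iff. intros z Hz. apply N. eauto.
Qed.

Lemma sub_ext x y : x ⊆ y -> y ⊆ x -> x = y.
Proof. intros H1 H2. apply z_ext. split; auto. Qed.

Lemma mem_irrefl x : ~ x ∈ x.
Proof.
  intros H. destruct (@z_found S _ (upair x x)) as [y [Hy Hd]].
  - intros E. apply (E x). apply upairE; auto.
  - apply upairE in Hy. assert (y = x) by tauto. subst. apply (Hd x). rewrite upairE; auto.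
Qed.
Lemma mem_asym x y : x ∈ y -> ~ y ∈ x.
Proof.
  intros H1 H2. destruct (@z_found S _ (upair x y)) as [z [Hz Hd]].
  - intros E. apply (E x). apply upairE; auto.
  - apply upairE in Hz. destruct Hz; subst.
    + apply (Hd y). rewrite upairE; auto.
    + apply (Hd x). rewrite upairE; auto.
Qed.

Lemma prod_ex a b : exists c, forall p, p ∈ c <-> exists x y, x ∈ a /\ y ∈ b /\ p = opair x y.
Proof.
  sep (fun p : S => exists x y, x ∈ a /\ y ∈ b /\ is_opair p x y) (pow (pow (cup a b))) as c Hc.
  exists c. intros p. rewrite Hc. split.
  - intros [_ [x [y [Hx [Hy E]]]]]. apply opair_iff in E. eauto.
  - intros [x [y [Hx [Hy E]]]]. split.
    + subst p. apply powE. intros z Hz. apply powE. intros w Hw. apply cupE.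
      apply upairE in Hz. destruct Hz; subst z; apply upairE in Hw; destruct Hw; subst; auto.
    + exists x, y. rewrite opair_iff. auto.
Qed.
Definition prod a b : S := pick (prod_ex a b).
Lemma prodE a b p : p ∈ prod a b <-> exists x y, x ∈ a /\ y ∈ b /\ p = opair x y.
Proof. exact (pickP (prod_ex a b) p). Qed.
Lemma opair_prod a b x y : opair x y ∈ prod a b <-> x ∈ a /\ y ∈ b.
Proof.
  rewrite prodE. split.
  - intros [x' [y' [Hx [Hy E]]]]. apply opair_inj in E. destruct E; subst; auto.
  - intros [Hx Hy]; eauto 6.
Qed.

(** Foundation applied to the subset of [a] that [P] separates. *)
Lemma set_minimal (P : S -> Prop) (HP : @Df S zd 1 (fun g => P (snd g))) a :
  (exists x, x ∈ a /\ P x) -> exists x, x ∈ a /\ P x /\ forall y, y ∈ a -> y ∈ x -> ~ P y.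
Proof.
  intros [x0 [H0 P0]]. destruct (z_sep HP a) as [b Hb].
  destruct (@z_found S _ b) as [x [Hx Hd]].
  - intros E. apply (E x0). apply Hb. auto.
  - apply Hb in Hx. exists x. split; [tauto|]. split; [tauto|].
    intros y Hy Hyx Py. apply (Hd y). split; auto. apply Hb. auto.
Qed.

Lemma ord_elem x y : is_ordinal x -> y ∈ x -> is_ordinal y.
Proof.
  intros [H1 H2] Hy. split; [auto|]. intros z Hz. apply H2. apply (H1 y); auto.
Qed.
Lemma ord_trans x y z : is_ordinal x -> y ∈ x -> z ∈ y -> z ∈ x.
Proof. intros [H _] Hy Hz. exact (H y Hy z Hz). Qed.

Lemma ord_minimal (P : S -> Prop) (HP : @Df S zd 1 (fun g => P (snd g))) a :
  is_ordinal a -> P a ->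
  exists b, is_ordinal b /\ P b /\ forall c, c ∈ b -> ~ P c.
Proof.
  (* Below the given witness the search takes place inside a set, and transitivity makes the minimum
     there a global one. *)
  intros Ha Pa. destruct (set_minimal HP (a := succ a)) as [b [Hb [Pb Hm]]].
  { exists a. rewrite succE. auto. }
  apply succE in Hb. exists b.
  assert (Ob : is_ordinal b) by (destruct Hb; [eapply ord_elem; eauto | subst; auto]).
  split; [auto|]. split; [auto|]. intros c Hc. apply Hm; auto. apply succE.
  left. destruct Hb as [Hb | ->]; auto. eapply ord_trans; eauto.
Qed.

Lemma ord_ind (P : S -> Prop) (HP : @Df S zd 1 (fun g => P (snd g))) :
  (forall a, is_ordinal a -> (forall b, b ∈ a -> P b) -> P a) ->
  forall a, is_ordinal a -> P a.
Proof.
  intros IH a Ha. apply NNPP. intros N.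
  destruct (ord_minimal (P := fun x => ~ P x) (Df_not HP) Ha N) as [b [Hb [Nb Hm]]].
  apply Nb, IH; auto. intros c Hc. apply NNPP. apply Hm; auto.
Qed.

(** Double induction: if neither ordinal is a member of the other, the induction hypotheses give
    both inclusions. *)
Lemma ord_tri a b : is_ordinal a -> is_ordinal b -> a ∈ b \/ a = b \/ b ∈ a.
Proof.
  intros Ha. revert a Ha b.
  refine (ord_ind (P := fun u : S => forall v, is_ordinal v -> u ∈ v \/ u = v \/ v ∈ u) _ _).
  { df. }
  intros u Hu IHu.
  refine (ord_ind (P := fun v : S => u ∈ v \/ u = v \/ v ∈ u) _ _); [df|].
  intros v Hv IHv. apply NNPP. intros N.
  apply N. right; left. apply sub_ext; intros w Hw.
  - destruct (IHu w Hw v Hv) as [H | [-> | H]]; auto.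
    + exfalso. apply N. auto.
    + exfalso. apply N. right; right. eapply ord_trans; eauto.
  - destruct (IHv w Hw) as [H | [H | H]]; auto.
    + exfalso. apply N. left. eapply ord_trans; eauto.
    + subst w. exfalso; auto.
Qed.

Lemma ord_sub a b : is_ordinal a -> is_ordinal b -> (a ⊆ b <-> a = b \/ a ∈ b).
Proof.
  intros Ha Hb. split.
  - intros H. destruct (ord_tri Ha Hb) as [? | [? | H']]; auto.
    destruct (mem_irrefl (H _ H')).
  - intros [-> | H]; auto. intros z Hz. eapply ord_trans; eauto.
Qed.

Lemma ord_nsub a b : is_ordinal a -> is_ordinal b -> (~ a ⊆ b <-> b ∈ a).
Proof.
  intros Ha Hb. split.
  - intros H. destruct (ord_tri Ha Hb) as [H' | [H' | H']]; auto;
      exfalso; apply H; apply ord_sub; auto.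
  - intros H H'. destruct (mem_irrefl (H' _ H)).
Qed.

Lemma ord_intro x : is_transitive x -> (forall y, y ∈ x -> is_ordinal y) -> is_ordinal x.
Proof. intros H1 H2. split; auto. intros y Hy. exact (proj1 (H2 y Hy)). Qed.

Lemma ord_succ a : is_ordinal a -> is_ordinal (succ a).
Proof.
  intros Ha. apply ord_intro.
  - intros y Hy z Hz. rewrite succE in *. left. destruct Hy as [Hy | ->]; auto.
    eapply ord_trans; eauto.
  - intros y Hy. apply succE in Hy. destruct Hy as [Hy | ->]; auto. eapply ord_elem; eauto.
Qed.

Lemma ord_Un x : (forall y, y ∈ x -> is_ordinal y) -> is_ordinal (Un x).
Proof.
  intros H. apply ord_intro.
  - intros y Hy z Hz. rewrite UnE in *. destruct Hy as [w [Hw Hy]]. exists w. split; auto.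
    eapply ord_trans; eauto.
  - intros y Hy. apply UnE in Hy. destruct Hy as [w [Hw Hy]]. eapply ord_elem; eauto.
Qed.

Lemma succ_inj x y : succ x = succ y -> x = y.
Proof.
  intros H. assert (H1 : x ∈ succ y) by (rewrite <- H; apply succE; auto).
  assert (H2 : y ∈ succ x) by (rewrite H; apply succE; auto).
  rewrite succE in *. destruct H1 as [H1 | H1], H2 as [H2 | H2]; auto.
  destruct (mem_asym H1 H2).
Qed.
Lemma succ_neq_emp x : ~ succ x = emp.
Proof. intros H. apply (@empE x). rewrite <- H. apply succE; auto. Qed.

Lemma omega_ex : exists w : S, is_omega w.
Proof.
  destruct (z_inf (S := S)) as [H [[e [He H0]] H2]].
  sep (fun x : S => forall y, is_inductive y -> x ∈ y) H as w Hw.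
  assert (I : is_inductive H).
  { split.
    - intros y Hy. apply emp_iff in He, Hy. congruence.
    - intros y z Hy Hz. destruct (H2 y Hy) as [z' [Hz' H3]].
      apply succ_iff in Hz, Hz'. congruence. }
  exists w. split.
  - split.
    + intros y Hy. apply Hw. split; [apply I; auto|]. intros u [Hu _]. auto.
    + intros y z Hy Hz. apply Hw in Hy. apply Hw. split.
      * apply (proj2 I y); tauto.
      * intros u Hu. apply (proj2 Hu y z); auto. apply Hy; auto.
  - intros y Hy z Hz. apply Hw in Hz. apply Hz; auto.
Qed.
Definition omega : S := pick omega_ex.
Lemma omega_iff w : is_omega w <-> w = omega.
Proof.
  pose proof (pickP omega_ex) as Ho. fold omega in Ho. split.
  - intros [H1 H2]. destruct Ho as [H3 H4]. apply sub_ext; auto.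
  - intros ->. exact Ho.
Qed.
Lemma is_nat_iff n : is_nat n <-> n ∈ omega.
Proof.
  unfold is_nat. split.
  - intros [w [Hw Hn]]. apply omega_iff in Hw. subst; auto.
  - intros H. exists omega. rewrite omega_iff. auto.
Qed.
Lemma omega0 : emp ∈ omega.
Proof. destruct (proj2 (omega_iff omega) eq_refl) as [[H _] _]. apply H, emp_iff; auto. Qed.
Lemma omegaS n : n ∈ omega -> succ n ∈ omega.
Proof.
  destruct (proj2 (omega_iff omega) eq_refl) as [[_ H] _]. intros Hn.
  apply (H n); auto. apply succ_iff; auto.
Qed.
Lemma omega_sub I : is_inductive I -> omega ⊆ I.
Proof. destruct (proj2 (omega_iff omega) eq_refl) as [_ H]. apply H. Qed.

(** Induction over the possibly nonstandard naturals of the model holds for definable properties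
    only: the set separated from [omega] is inductive. *)
Lemma omega_ind (P : S -> Prop) (HP : @Df S zd 1 (fun g => P (snd g))) :
  P emp -> (forall n, n ∈ omega -> P n -> P (succ n)) -> forall n, n ∈ omega -> P n.
Proof.
  intros H0 HS n Hn. destruct (z_sep HP omega) as [b Hb].
  assert (omega ⊆ b) as Hs.
  { apply omega_sub. split.
    - intros y Hy. apply emp_iff in Hy. subst. apply Hb. split; auto. apply omega0.
    - intros y z Hy Hz. apply succ_iff in Hz. subst. apply Hb in Hy. apply Hb.
      split; [apply omegaS; tauto | apply HS; tauto]. }
  apply Hs in Hn. apply Hb in Hn. tauto.
Qed.

Lemma nat_ord n : n ∈ omega -> is_ordinal n.
Proof.
  revert n. apply (omega_ind (P := fun n : S => is_ordinal n)); [df | |].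
  - split; intros y Hy; destruct (empE Hy).
  - intros n _. apply ord_succ.
Qed.

Lemma omega_ord : is_ordinal omega.
Proof.
  apply ord_intro; [|apply nat_ord].
  intros n Hn. revert n Hn.
  apply (omega_ind (P := fun n : S => forall z, z ∈ n -> z ∈ omega)); [df | |].
  - intros z Hz; destruct (empE Hz).
  - intros n Hn IH z Hz. apply succE in Hz. destruct Hz as [Hz | ->]; auto.
Qed.

Lemma nat_elem n m : n ∈ omega -> m ∈ n -> m ∈ omega.
Proof. intros Hn Hm. eapply ord_trans; eauto. apply omega_ord. Qed.

Lemma nat_max n m : n ∈ omega -> m ∈ omega -> exists k, k ∈ omega /\ n ⊆ k /\ m ⊆ k.
Proof.
  intros Hn Hm. pose proof (nat_ord Hn) as On. pose proof (nat_ord Hm) as Om.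
  destruct (classic (n ⊆ m)) as [H | H].
  - exists m; auto.
  - exists n. split; auto. split; auto. apply ord_nsub in H; auto. apply ord_sub; auto.
Qed.

(** Standard numerals, which serve as tags of codes and as indices of variables. *)
Fixpoint num (k : nat) : S := match k with O => emp | Datatypes.S k => succ (num k) end.

Lemma num_iff k x : is_numeral k x <-> x = num k.
Proof.
  revert x. induction k; intros x; simpl.
  - apply emp_iff.
  - split.
    + intros [y [Hy Hx]]. apply IHk in Hy. apply succ_iff in Hx. subst; auto.
    + intros ->. exists (num k). rewrite IHk, succ_iff. auto.
Qed.
Lemma num_omega k : num k ∈ omega.
Proof. induction k; simpl; [apply omega0 | apply omegaS; auto]. Qed.
Lemma num_inj k l : num k = num l -> k = l.
Proof.
  revert l. induction k; intros [|l]; simpl; intros H; auto.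
  - destruct (@succ_neq_emp (num l)); auto.
  - destruct (@succ_neq_emp (num k)); auto.
  - f_equal. apply IHk. apply succ_inj; auto.
Qed.
End Sets.
(* Without this, unification unfolds sets down to the axioms they are chosen from. *)
#[global] Opaque pick upair opair Un pow cup succ emp prod omega.

(** * Coded formulas and satisfaction *)

Section Formulas.
Context {S : eps_struct} {ZS : zermelo S} {HS : hf S}.
Implicit Types a c d e i j n s u v w x y z p q f F : S.

Definition cmem i j : S := opair (num 0) (opair i j).
Definition ceq i j : S := opair (num 1) (opair i j).
Definition cpred i : S := opair (num 2) i.
Definition cneg d : S := opair (num 3) d.
Definition cand d e : S := opair (num 4) (opair d e).
Definition cex i d : S := opair (num 5) (opair i d).

Lemma tagged_iff k c b : tagged k c b <-> c = opair (num k) b.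
Proof.
  unfold tagged. split.
  - intros [n [Hn Hc]]. apply num_iff in Hn. apply opair_iff in Hc. subst; auto.
  - intros ->. exists (num k). rewrite num_iff, opair_iff. auto.
Qed.
Lemma tagged2_iff k c a b : tagged2 k c a b <-> c = opair (num k) (opair a b).
Proof.
  unfold tagged2. split.
  - intros [p [Hp Hc]]. apply opair_iff in Hp. apply tagged_iff in Hc. subst; auto.
  - intros ->. exists (opair a b). rewrite tagged_iff, opair_iff. auto.
Qed.
Lemma code_mem_iff c i j : code_mem c i j <-> i ∈ omega /\ j ∈ omega /\ c = cmem i j.
Proof. unfold code_mem. rewrite !is_nat_iff, tagged2_iff. tauto. Qed.
Lemma code_eq_iff c i j : code_eq c i j <-> i ∈ omega /\ j ∈ omega /\ c = ceq i j.
Proof. unfold code_eq. rewrite !is_nat_iff, tagged2_iff. tauto. Qed.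
Lemma code_pred_iff c i : code_pred c i <-> i ∈ omega /\ c = cpred i.
Proof. unfold code_pred. rewrite !is_nat_iff, tagged_iff. tauto. Qed.
Lemma code_neg_iff c d : code_neg c d <-> c = cneg d.
Proof. unfold code_neg. rewrite tagged_iff. tauto. Qed.
Lemma code_and_iff c d e : code_and c d e <-> c = cand d e.
Proof. unfold code_and. rewrite tagged2_iff. tauto. Qed.
Lemma code_ex_iff c i d : code_ex c i d <-> i ∈ omega /\ c = cex i d.
Proof. unfold code_ex. rewrite is_nat_iff, tagged2_iff. tauto. Qed.

(** Some fixed set with the closure properties of the hereditarily finite sets, possibly larger than
    their set. It bounds the codes of formulas, so that separation applies to them. *)
Definition HF : S := pick z_hf.
Lemma HF_emp : emp ∈ HF.
Proof. apply (proj1 (pickP z_hf)), emp_iff; auto. Qed.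
Lemma HF_upair x y : x ∈ HF -> y ∈ HF -> upair x y ∈ HF.
Proof. intros Hx Hy. apply (proj1 (proj2 (pickP z_hf)) x y); auto. apply upair_iff; auto. Qed.
Lemma HF_opair x y : x ∈ HF -> y ∈ HF -> opair x y ∈ HF.
Proof. intros Hx Hy. rewrite opair_def. auto using HF_upair. Qed.
Lemma HF_succ x : x ∈ HF -> succ x ∈ HF.
Proof. intros Hx. apply (proj2 (proj2 (pickP z_hf)) x); auto. apply succ_iff; auto. Qed.
Lemma HF_omega n : n ∈ omega -> n ∈ HF.
Proof.
  revert n. apply omega_sub. split.
  - intros y Hy. apply emp_iff in Hy. subst. apply HF_emp.
  - intros y z Hy Hz. apply succ_iff in Hz. subst. apply HF_succ; auto.
Qed.

#[local] Opaque HF.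
Lemma form_mem b i j : i ∈ omega -> j ∈ omega -> is_formula b (cmem i j).
Proof. intros Hi Hj F HF. apply (proj1 HF (cmem i j) i j), code_mem_iff. auto. Qed.
Lemma form_eq b i j : i ∈ omega -> j ∈ omega -> is_formula b (ceq i j).
Proof. intros Hi Hj F HF. apply (proj1 (proj2 HF) (ceq i j) i j), code_eq_iff. auto. Qed.
Lemma form_pred b i : b = true -> i ∈ omega -> is_formula b (cpred i).
Proof. intros Hb Hi F HF. apply (proj1 (proj2 (proj2 HF)) Hb (cpred i) i), code_pred_iff. auto. Qed.
Lemma form_neg b d : is_formula b d -> is_formula b (cneg d).
Proof.
  intros Hd F HF. apply (proj1 (proj2 (proj2 (proj2 HF))) (cneg d) d); auto. apply code_neg_iff. auto.
Qed.
Lemma form_and b d e : is_formula b d -> is_formula b e -> is_formula b (cand d e).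
Proof.
  intros Hd He F HF. apply (proj1 (proj2 (proj2 (proj2 (proj2 HF)))) (cand d e) d e); auto.
  apply code_and_iff. auto.
Qed.
Lemma form_ex b i d : i ∈ omega -> is_formula b d -> is_formula b (cex i d).
Proof.
  intros Hi Hd F HF. apply (proj2 (proj2 (proj2 (proj2 (proj2 HF)))) (cex i d) i d); auto.
  apply code_ex_iff. auto.
Qed.

Lemma HF_formula_closed b : formula_closed b HF.
Proof.
  repeat split.
  - intros c i j H. apply code_mem_iff in H. destruct H as [Hi [Hj ->]].
    repeat apply HF_opair; auto using HF_omega, num_omega.
  - intros c i j H. apply code_eq_iff in H. destruct H as [Hi [Hj ->]].
    repeat apply HF_opair; auto using HF_omega, num_omega.
  - intros _ c i H. apply code_pred_iff in H. destruct H as [Hi ->].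
    repeat apply HF_opair; auto using HF_omega, num_omega.
  - intros c d H Hd. apply code_neg_iff in H. subst.
    repeat apply HF_opair; auto using HF_omega, num_omega.
  - intros c d e H Hd He. apply code_and_iff in H. subst.
    repeat apply HF_opair; auto using HF_omega, num_omega.
  - intros c i d H Hd. apply code_ex_iff in H. destruct H as [Hi ->].
    repeat apply HF_opair; auto using HF_omega, num_omega.
Qed.

Lemma form_HF b c : is_formula b c -> c ∈ HF.
Proof. intros H. apply H, HF_formula_closed. Qed.

(** A formula lies in every set closed under the formation rules; the formulas in [HF] with property
    [P] form such a set. *)
Lemma form_ind b (P : S -> Prop) (HP : @Df S zd 1 (fun g => P (snd g))) :
  (forall i j, i ∈ omega -> j ∈ omega -> P (cmem i j)) ->
  (forall i j, i ∈ omega -> j ∈ omega -> P (ceq i j)) ->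
  (b = true -> forall i, i ∈ omega -> P (cpred i)) ->
  (forall d, is_formula b d -> P d -> P (cneg d)) ->
  (forall d e, is_formula b d -> P d -> is_formula b e -> P e -> P (cand d e)) ->
  (forall i d, i ∈ omega -> is_formula b d -> P d -> P (cex i d)) ->
  forall c, is_formula b c -> P c.
Proof.
  intros H1 H2 H3 H4 H5 H6 c Hc.
  assert (HQ : @Df S zd 1 (fun g => is_formula b (snd g) /\ P (snd g)))
    by (apply Df_and; [df | exact HP]).
  destruct (z_sep (P := fun c : S => is_formula b c /\ P c) HQ HF) as [F HF'].
  cbv beta in HF'.
  assert (Cl : formula_closed b F).
  { pose proof (HF_formula_closed b) as [K1 [K2 [K3 [K4 [K5 K6]]]]].
    repeat split.
    - intros k i j H. apply HF'. split; [eauto|]. apply code_mem_iff in H.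
      destruct H as [Hi [Hj ->]]. split; [apply form_mem|]; auto.
    - intros k i j H. apply HF'. split; [eauto|]. apply code_eq_iff in H.
      destruct H as [Hi [Hj ->]]. split; [apply form_eq|]; auto.
    - intros Hb k i H. apply HF'. split; [eauto|]. apply code_pred_iff in H.
      destruct H as [Hi ->]. split; [apply form_pred|]; auto.
    - intros k d H Hd. apply HF' in Hd. apply HF'. split; [apply (K4 k d); tauto|].
      apply code_neg_iff in H. subst. split; [apply form_neg; tauto | apply H4; tauto].
    - intros k d e H Hd He. apply HF' in Hd, He. apply HF'. split; [apply (K5 k d e); tauto|].
      apply code_and_iff in H. subst. split; [apply form_and; tauto | apply H5; tauto].
    - intros k i d H Hd. apply HF' in Hd. apply HF'. split; [apply (K6 k i d); tauto|].
      apply code_ex_iff in H. destruct H as [Hi ->].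
      split; [apply form_ex; tauto | apply H6; tauto]. }
  apply (Hc F) in Cl. apply HF' in Cl. tauto.
Qed.

Lemma fun_dom f a b x y : is_function f a b -> rel f x y -> x ∈ a.
Proof.
  intros [[H _] _] [p [Hp E]]. destruct (H p Hp) as [x' [y' [Hx E']]].
  apply opair_iff in E, E'. subst. apply opair_inj in E'. destruct E'; subst; auto.
Qed.
Lemma fun_ran f a b x y : is_function f a b -> rel f x y -> y ∈ b.
Proof. intros [_ H] Hr. eauto. Qed.
Lemma fun_tot f a b x : is_function f a b -> x ∈ a -> exists y, y ∈ b /\ rel f x y.
Proof. intros [[_ [H _]] H'] Hx. destruct (H x Hx) as [y Hy]. eauto. Qed.
Lemma fun_fun f a b x y y' : is_function f a b -> rel f x y -> rel f x y' -> y = y'.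
Proof. intros [[_ [_ H]] _]. apply H. Qed.
Lemma fun_prod f a b : is_function f a b -> f ∈ pow (prod a b).
Proof.
  intros H. apply powE. intros p Hp. pose proof H as [[H1 _] _].
  destruct (H1 p Hp) as [x [y [Hx E]]]. apply prodE. exists x, y.
  split; auto. split; [|apply opair_iff; auto]. apply (@fun_ran f a b x y H). exists p; auto.
Qed.
Lemma assign_iff u s : is_assign u s <-> is_function s omega u.
Proof.
  unfold is_assign. split.
  - intros [w [Hw Hs]]. apply omega_iff in Hw. subst; auto.
  - intros H. exists omega. rewrite omega_iff. auto.
Qed.

Lemma update_ex u s i x : is_assign u s -> i ∈ omega -> x ∈ u ->
  exists s', is_update u s i x s'.
Proof.
  intros Hs Hi Hx. apply assign_iff in Hs.
  sep (fun p : S => exists n y, is_opair p n y /\ ((n = i /\ y = x) \/ (~ n = i /\ rel s n y)))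
    (prod omega u) as s' Hs'.
  assert (R : forall n y, rel s' n y <-> (n = i /\ y = x) \/ (~ n = i /\ rel s n y)).
  { intros n y. rewrite rel_iff, Hs', opair_prod. split.
    - intros [_ [n' [y' [E H]]]]. apply opair_iff, opair_inj in E. destruct E; subst; auto.
    - intros H. split.
      + destruct H as [[-> ->] | [_ H]]; auto.
        split; [apply (fun_dom Hs H) | apply (fun_ran Hs H)].
      + exists n, y. rewrite opair_iff. auto. }
  exists s'. split; [|split].
  - apply assign_iff. split.
    + split; [|split].
      * intros p Hp. apply Hs' in Hp. destruct Hp as [Hp _]. apply prodE in Hp.
        destruct Hp as [n [y [Hn [_ E]]]]. exists n, y. rewrite opair_iff. auto.
      * intros n Hn. destruct (classic (n = i)) as [-> | N].
        -- exists x. apply R. auto.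
        -- destruct (fun_tot Hs Hn) as [y [_ Hy]]. exists y. apply R. auto.
      * intros n y y' H1 H2. apply R in H1, H2.
        destruct H1 as [[? ?] | [? ?]], H2 as [[? ?] | [? ?]]; try congruence.
        apply (fun_fun Hs (x := n)); auto.
    + intros n y H. apply R in H. destruct H as [[_ ->] | [_ H]]; auto. apply (fun_ran Hs H).
  - apply R; auto.
  - intros n y N. rewrite R. tauto.
Qed.

End Formulas.

(** Inverts equations between codes; distinct tags refute a mismatch of shapes. *)
Ltac codes :=
  repeat match goal with
  | H : code_mem _ _ _ |- _ => apply code_mem_iff in H; destruct H as [? [? ?]]
  | H : code_eq _ _ _ |- _ => apply code_eq_iff in H; destruct H as [? [? ?]]
  | H : code_pred _ _ |- _ => apply code_pred_iff in H; destruct H as [? ?]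
  | H : code_neg _ _ |- _ => apply code_neg_iff in H
  | H : code_and _ _ _ |- _ => apply code_and_iff in H
  | H : code_ex _ _ _ |- _ => apply code_ex_iff in H; destruct H as [? ?]
  end;
  subst; unfold cmem, ceq, cpred, cneg, cand, cex in *;
  repeat match goal with
  | H : opair _ _ = opair _ _ |- _ => apply opair_inj in H; destruct H
  | H : num _ = num _ |- _ => apply num_inj in H; first [discriminate H | clear H]
  end; subst.

(** * Existence of satisfaction relations *)

Section SatExists.
Context {S : eps_struct} {ZS : zermelo S} {HS : hf S} (u : S).
Implicit Types a b c d e i j n s v w x y z p q f F G R : S.

Lemma asg_ex : exists a, forall s, s ∈ a <-> is_assign u s.
Proof.
  sep (fun s : S => is_assign u s) (pow (prod omega u)) as a Ha.
  exists a. intros s. rewrite Ha. split; [tauto|]. intros H. split; auto.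
  apply assign_iff in H. apply (fun_prod H).
Qed.
Definition Asg : S := pick asg_ex.
Lemma AsgE s : s ∈ Asg <-> is_assign u s.
Proof. exact (pickP asg_ex s). Qed.

(* [R] is the set of assignments satisfying [c], given by one of Tarski's
   clauses from truth sets already in [G]. *)
Definition tarski G c R : Prop :=
  (exists i j, code_mem c i j /\
     forall s, s ∈ R <-> s ∈ Asg /\ exists x y, rel s i x /\ rel s j y /\ x ∈ y) \/
  (exists i j, code_eq c i j /\
     forall s, s ∈ R <-> s ∈ Asg /\ exists x, rel s i x /\ rel s j x) \/
  (exists d R1, code_neg c d /\ rel G d R1 /\
     forall s, s ∈ R <-> s ∈ Asg /\ ~ s ∈ R1) \/
  (exists d e R1 R2, code_and c d e /\ rel G d R1 /\ rel G e R2 /\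
     forall s, s ∈ R <-> s ∈ R1 /\ s ∈ R2) \/
  (exists i d R1, code_ex c i d /\ rel G d R1 /\
     forall s, s ∈ R <-> s ∈ Asg /\ exists x s', x ∈ u /\ is_update u s i x s' /\ s' ∈ R1).

(** [G] stores whole truth sets rather than single truths, so even the clause for negation is
    positive in [G]. This is what makes a least fixed point available. *)
Lemma tarski_mono G G' c R : G ⊆ G' -> tarski G c R -> tarski G' c R.
Proof.
  intros Hs. assert (Hr : forall a b, rel G a b -> rel G' a b).
  { intros a b H. apply rel_iff in H. apply rel_iff. auto. }
  intros [H | [H | [[d [R1 [H1 [H2 H3]]]] | [[d [e [R1 [R2 [H1 [H2 [H3 H4]]]]]]] |
    [i [d [R1 [H1 [H2 H3]]]]]]]]].
  - left; auto.
  - right; left; auto.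
  - right; right; left. exists d, R1. auto.
  - right; right; right; left. exists d, e, R1, R2. auto.
  - right; right; right; right. exists i, d, R1. auto.
Qed.

Definition tarski_closed G : Prop :=
  forall c R, c ∈ HF -> R ∈ pow Asg -> tarski G c R -> rel G c R.

Ltac df_more ::= progress unfold tarski_closed, tarski.

(** [G] is the intersection of all closed sets. Its members that are justified by a clause over [G]
    already form a closed set, so by minimality all members are justified. *)
Lemma truth_ex : exists G, tarski_closed G /\
  (forall c R, rel G c R -> c ∈ HF /\ R ∈ pow Asg /\ tarski G c R).
Proof.
  sep (fun q : S => forall G, tarski_closed G -> q ∈ G) (prod HF (pow Asg)) as G HG.
  assert (C : tarski_closed G).
  { intros c R Hc HR HT. apply rel_iff. apply HG. split; [apply opair_prod; auto|].
    intros G' HG'. apply rel_iff. apply HG'; auto.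
    apply (tarski_mono (G := G)); auto. intros q Hq. apply HG in Hq. apply Hq; auto. }
  exists G. split; auto.
  sep (fun q : S => exists c R, is_opair q c R /\ tarski G c R) G as G' HG'.
  assert (Sb : G' ⊆ G) by (intros q Hq; apply HG' in Hq; tauto).
  assert (C' : tarski_closed G').
  { intros c R Hc HR HT. apply (tarski_mono Sb) in HT. apply rel_iff, HG'. split.
    - apply rel_iff. apply C; auto.
    - exists c, R. rewrite opair_iff. auto. }
  intros c R H. apply rel_iff in H. pose proof (proj1 (HG _) H) as [H1 H2].
  apply opair_prod in H1. split; [tauto|]. split; [tauto|].
  pose proof (H2 G' C') as H3. apply HG' in H3. destruct H3 as [_ [c' [R' [E HT]]]].
  apply opair_iff, opair_inj in E. destruct E; subst; auto.
Qed.

Lemma asg_set (P : S -> Prop) (HP : @Df S zd 1 (fun g => P (snd g))) :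
  exists R, R ∈ pow Asg /\ forall s, s ∈ R <-> s ∈ Asg /\ P s.
Proof.
  destruct (z_sep HP Asg) as [R HR]. exists R. split; auto.
  apply powE. intros s Hs. apply HR in Hs. tauto.
Qed.

(** By induction every formula has exactly one truth set in [G]: the tag of the code determines the
    clause, and the immediate subformulas have unique truth sets. [T] then pairs a formula with the
    members of its truth set. *)
Lemma sat_rel_ex : exists T, is_sat_rel u None T.
Proof.
  destruct truth_ex as [G [C I]].
  assert (U : forall c, is_formula false c ->
    exists R, rel G c R /\ forall R', rel G c R' -> R' = R).
  { apply (form_ind (P := fun c : S => exists R, rel G c R /\ forall R', rel G c R' -> R' = R));
      [df | | | discriminate | | | ].
    - intros i j Hi Hj.
      destruct (@asg_set (fun s : S => exists x y, rel s i x /\ rel s j y /\ x ∈ y)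
        ltac:(df)) as [R [HR ER]]. exists R. split.
      + apply C; auto. { apply (form_HF (b := false)), form_mem; auto. }
        left. exists i, j. rewrite code_mem_iff. auto.
      + intros R' H. apply I in H. destruct H as [_ [_ H]].
        destruct H as [[i' [j' [Hc H]]] | [[i' [j' [Hc H]]] | [[d' [R1 [Hc [_ _]]]] |
          [[d' [e' [R1 [R2 [Hc _]]]]] | [i' [d' [R1 [Hc _]]]]]]]]; codes.
        apply z_ext. intros s. rewrite ER, H. tauto.
    - intros i j Hi Hj.
      destruct (@asg_set (fun s : S => exists x, rel s i x /\ rel s j x)
        ltac:(df)) as [R [HR ER]]. exists R. split.
      + apply C; auto. { apply (form_HF (b := false)), form_eq; auto. }
        right; left. exists i, j. rewrite code_eq_iff. auto.
      + intros R' H. apply I in H. destruct H as [_ [_ H]].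
        destruct H as [[i' [j' [Hc H]]] | [[i' [j' [Hc H]]] | [[d' [R1 [Hc [_ _]]]] |
          [[d' [e' [R1 [R2 [Hc _]]]]] | [i' [d' [R1 [Hc _]]]]]]]]; codes.
        apply z_ext. intros s. rewrite ER, H. tauto.
    - intros d Hd [Rd [Gd Ud]].
      destruct (@asg_set (fun s : S => ~ s ∈ Rd) ltac:(df)) as [R [HR ER]]. exists R. split.
      + apply C; auto. { apply (form_HF (b := false)), form_neg; auto. }
        right; right; left. exists d, Rd. rewrite code_neg_iff. auto.
      + intros R' H. apply I in H. destruct H as [_ [_ H]].
        destruct H as [[i' [j' [Hc H]]] | [[i' [j' [Hc H]]] | [[d' [R1 [Hc [H0 H]]]] |
          [[d' [e' [R1 [R2 [Hc _]]]]] | [i' [d' [R1 [Hc _]]]]]]]]; codes.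
        apply Ud in H0. subst. apply z_ext. intros s. rewrite ER, H. tauto.
    - intros d e Hd [Rd [Gd Ud]] He [Re [Ge Ue]].
      destruct (@asg_set (fun s : S => s ∈ Rd /\ s ∈ Re) ltac:(df)) as [R [HR ER]].
      (* The clause for conjunction does not mention [Asg], but truth sets are subsets of it. *)
      assert (ER' : forall s, s ∈ R <-> s ∈ Rd /\ s ∈ Re).
      { intros s. rewrite ER. split; [tauto|]. intros H. split; auto.
        apply I in Gd. destruct Gd as [_ [Gd _]]. apply (proj1 (powE _ _) Gd). tauto. }
      exists R. split.
      + apply C; auto. { apply (form_HF (b := false)), form_and; auto. }
        right; right; right; left. exists d, e, Rd, Re. rewrite code_and_iff. auto.
      + intros R' H. apply I in H. destruct H as [_ [_ H]].
        destruct H as [[i' [j' [Hc H]]] | [[i' [j' [Hc H]]] | [[d' [R1 [Hc [H0 H]]]] |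
          [[d' [e' [R1 [R2 [Hc [H0 [H1 H]]]]]]] | [i' [d' [R1 [Hc _]]]]]]]]; codes.
        apply Ud in H0. apply Ue in H1. subst. apply z_ext. intros s. rewrite ER', H. tauto.
    - intros i d Hi Hd [Rd [Gd Ud]].
      destruct (@asg_set (fun s : S => exists x s', x ∈ u /\ is_update u s i x s' /\ s' ∈ Rd)
        ltac:(df)) as [R [HR ER]]. exists R. split.
      + apply C; auto. { apply (form_HF (b := false)), form_ex; auto. }
        right; right; right; right. exists i, d, Rd. rewrite code_ex_iff. auto.
      + intros R' H. apply I in H. destruct H as [_ [_ H]].
        destruct H as [[i' [j' [Hc H]]] | [[i' [j' [Hc H]]] | [[d' [R1 [Hc [H0 H]]]] |
          [[d' [e' [R1 [R2 [Hc _]]]]] | [i' [d' [R1 [Hc [H0 H]]]]]]]]]; codes.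
        apply Ud in H0. subst. apply z_ext. intros s. rewrite ER, H. tauto. }
  sep (fun p : S => exists c s R, is_opair p c s /\ rel G c R /\ s ∈ R) (prod HF Asg) as T HT.
  assert (TG : forall c R s, is_formula false c -> rel G c R -> (rel T c s <-> s ∈ R)).
  { intros c R s Hc HR. rewrite rel_iff, HT, opair_prod.
    destruct (U c Hc) as [R0 [_ U0]]. split.
    - intros [_ [c' [s' [R' [E [H1 H2]]]]]]. apply opair_iff, opair_inj in E.
      destruct E; subst c' s'. rewrite (U0 _ HR), <- (U0 _ H1). auto.
    - intros Hs. pose proof (I _ _ HR) as [H1 [H2 _]].
      split; [split; auto; apply (proj1 (powE _ _) H2); auto|].
      exists c, s, R. rewrite opair_iff. auto. }
  exists T. intros s Hs. apply AsgE in Hs.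
  assert (U' : forall c, is_formula false c -> exists R, rel G c R).
  { intros c Hc. destruct (U c Hc) as [R [HR _]]. eauto. }
  assert (Fm : forall c i j, code_mem c i j -> is_formula false c).
  { intros c i j H. codes. apply form_mem; auto. }
  assert (Fe : forall c i j, code_eq c i j -> is_formula false c).
  { intros c i j H. codes. apply form_eq; auto. }
  split; [|split; [|split; [exact Logic.I | split; [|split]]]].
  - intros c i j Hc. destruct (U' c (Fm _ _ _ Hc)) as [R HR].
    rewrite (TG c R s (Fm _ _ _ Hc) HR). apply I in HR. destruct HR as [_ [_ HR]].
    destruct HR as [[i' [j' [Hc' H]]] | [[i' [j' [Hc' H]]] | [[d' [R1 [Hc' [H0 H]]]] |
          [[d' [e' [R1 [R2 [Hc' _]]]]] | [i' [d' [R1 [Hc' [H0 H]]]]]]]]]; codes.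
    rewrite H. tauto.
  - intros c i j Hc. destruct (U' c (Fe _ _ _ Hc)) as [R HR].
    rewrite (TG c R s (Fe _ _ _ Hc) HR). apply I in HR. destruct HR as [_ [_ HR]].
    destruct HR as [[i' [j' [Hc' H]]] | [[i' [j' [Hc' H]]] | [[d' [R1 [Hc' [H0 H]]]] |
          [[d' [e' [R1 [R2 [Hc' _]]]]] | [i' [d' [R1 [Hc' [H0 H]]]]]]]]]; codes.
    rewrite H. tauto.
  - simpl. intros c d Hd Hc.
    assert (Fc : is_formula false c) by (codes; apply form_neg; auto).
    destruct (U' c Fc) as [R HR].
    rewrite (TG c R s Fc HR). apply I in HR. destruct HR as [_ [_ HR]].
    destruct HR as [[i' [j' [Hc' H]]] | [[i' [j' [Hc' H]]] | [[d' [R1 [Hc' [H0 H]]]] |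
          [[d' [e' [R1 [R2 [Hc' _]]]]] | [i' [d' [R1 [Hc' [H0 H]]]]]]]]]; codes.
    rewrite (TG _ R1 s Hd H0), H. tauto.
  - simpl. intros c d e Hd He Hc.
    assert (Fc : is_formula false c) by (codes; apply form_and; auto).
    destruct (U' c Fc) as [R HR].
    rewrite (TG c R s Fc HR). apply I in HR. destruct HR as [_ [_ HR]].
    destruct HR as [[i' [j' [Hc' H]]] | [[i' [j' [Hc' H]]] | [[d' [R1 [Hc' [H0 H]]]] |
          [[d' [e' [R1 [R2 [Hc' [H0 [H1 H]]]]]]] | [i' [d' [R1 [Hc' [H0 H]]]]]]]]]; codes.
    rewrite (TG _ R1 s Hd H0), (TG _ R2 s He H1), H. tauto.
  - simpl. intros c i d Hd Hc.
    assert (Fc : is_formula false c) by (codes; apply form_ex; auto).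
    destruct (U' c Fc) as [R HR].
    rewrite (TG c R s Fc HR). apply I in HR. destruct HR as [_ [_ HR]].
    destruct HR as [[i' [j' [Hc' H]]] | [[i' [j' [Hc' H]]] | [[d' [R1 [Hc' [H0 H]]]] |
          [[d' [e' [R1 [R2 [Hc' [H0 [H1 H]]]]]]] | [i' [d' [R1 [Hc' [H0 H]]]]]]]]]; codes.
    rewrite H. split.
    + intros [_ [x [s' [Hx [Hs' H']]]]]. exists x, s'. rewrite (TG _ R1 s' Hd H0). auto.
    + intros [x [s' [Hx [Hs' H']]]]. split; auto. exists x, s'.
      rewrite <- (TG _ R1 s' Hd H0). auto.
Qed.
End SatExists.

(* Entries of a context are numbered from the outermost one; the entry at level
   [l] is the value of the coded variable [v_l]. *)
Fixpoint lvl (T : Type) (n : nat) : Ctx T n -> nat -> T -> Prop :=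
  match n with
  | O => fun _ _ _ => False
  | Datatypes.S n => fun g l x => (l = n /\ snd g = x) \/ lvl (fst g) l x
  end.

Lemma lvl_lt (T : Type) n : forall (g : Ctx T n) l x, lvl g l x -> l < n.
Proof.
  induction n; intros g l x; simpl; [tauto|]. intros [[-> _] | H]; [lia|].
  apply IHn in H. lia.
Qed.

(** Without constants every term is a variable, and its level, unlike a de Bruijn index, stays the
    same when the context grows. *)
Lemma Tm_lvl (T : Type) (K : T -> Prop) n (t : Ctx T n -> T) :
  (forall x, ~ K x) -> Tm K t -> exists l, forall g, lvl g l (t g).
Proof.
  intros N. induction 1 as [n a Ha | n | n t Ht [l IH]].
  - destruct (N _ Ha).
  - exists n. intros g. simpl. auto.
  - exists l. intros g. simpl. auto.
Qed.

Lemma substruct_eq (S : eps_struct) (u : S) (x y : substruct u) :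
  proj1_sig x = proj1_sig y -> x = y.
Proof.
  destruct x as [x Hx], y as [y Hy]. simpl. intros <-. f_equal. apply proof_irrelevance.
Qed.

(** * Definability by internal formulas over a set *)

Section Internal.
Context {S : eps_struct} {ZS : zermelo S} {HS : hf S} (u : S).
Let U : eps_struct := substruct u.

Definition fits (s : S) n (g : Ctx U n) : Prop :=
  forall l x, lvl g l x -> rel s (num l) (proj1_sig x).

(** The code must work for every satisfaction relation and every assignment that agrees with the
    context on its levels; the remaining variables are unconstrained. *)
Definition int_def n (P : Ctx U n -> Prop) : Prop :=
  exists c, is_formula false c /\
    forall T s g, is_sat_rel u None T -> is_assign u s -> fits s g ->
      (rel T c s <-> P g).

Lemma assign_fun s n x y : is_assign u s -> rel s n x -> rel s n y -> x = y.
Proof. intros H. apply assign_iff in H. apply (fun_fun H). Qed.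

Lemma fits_update s s' n (g : Ctx U n) (x : U) :
  fits s g -> is_update u s (num n) (proj1_sig x) s' ->
  @fits s' (Datatypes.S n) (g, x).
Proof.
  intros Hf [_ [H1 H2]] l y [[-> <-] | H]; simpl; auto.
  simpl in H. apply H2; [|apply Hf; auto].
  intros E. apply num_inj in E. apply lvl_lt in H. lia.
Qed.

Definition int_defsys : defsys U.
Proof.
  refine {| Kc := fun _ => False; Df := int_def |}.
  - intros n P Q H [c [Hc E]]. exists c. split; auto. intros. rewrite <- H. auto.
  - intros n t v Ht Hv. destruct (Tm_lvl (fun _ h => h) Ht) as [l Hl].
    destruct (Tm_lvl (fun _ h => h) Hv) as [m Hm].
    exists (cmem (num l) (num m)). split; [apply form_mem; apply num_omega|].
    intros T s g HT Hs Hf.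
    rewrite (proj1 (HT s Hs) (cmem (num l) (num m)) (num l) (num m))
      by (apply code_mem_iff; auto using num_omega).
    simpl. split.
    + intros [x [y [Hx [Hy H]]]].
      rewrite (assign_fun Hs (Hf _ _ (Hl g)) Hx), (assign_fun Hs (Hf _ _ (Hm g)) Hy). auto.
    + intros H. exists (proj1_sig (t g)), (proj1_sig (v g)). auto.
  - intros n t v Ht Hv. destruct (Tm_lvl (fun _ h => h) Ht) as [l Hl].
    destruct (Tm_lvl (fun _ h => h) Hv) as [m Hm].
    exists (ceq (num l) (num m)). split; [apply form_eq; apply num_omega|].
    intros T s g HT Hs Hf.
    rewrite (proj1 (proj2 (HT s Hs)) (ceq (num l) (num m)) (num l) (num m))
      by (apply code_eq_iff; auto using num_omega).
    split.
    + intros [x [Hx Hy]]. apply substruct_eq.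
      rewrite (assign_fun Hs (Hf _ _ (Hl g)) Hx), (assign_fun Hs (Hf _ _ (Hm g)) Hy). auto.
    + intros H. exists (proj1_sig (t g)). split; auto. rewrite H. auto.
  - intros n P [c [Hc E]]. exists (cneg c). split; [apply form_neg; auto|].
    intros T s g HT Hs Hf. rewrite <- (E T s g HT Hs Hf).
    apply (proj2 (proj2 (proj2 (HT s Hs)))); auto. apply code_neg_iff; auto.
  - intros n P Q [c [Hc E]] [c' [Hc' E']]. exists (cand c c'). split; [apply form_and; auto|].
    intros T s g HT Hs Hf. rewrite <- (E T s g HT Hs Hf), <- (E' T s g HT Hs Hf).
    apply (proj2 (proj2 (proj2 (HT s Hs)))); auto. apply code_and_iff; auto.
  - intros n P [c [Hc E]]. exists (cex (num n) c).
    split; [apply form_ex; auto; apply num_omega|].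
    intros T s g HT Hs Hf.
    rewrite (proj2 (proj2 (proj2 (proj2 (proj2 (HT s Hs))))) (cex (num n) c) (num n) c)
      by (auto; apply code_ex_iff; auto using num_omega).
    split.
    + intros [x [s' [Hx [Hs' H]]]]. exists (exist _ x Hx).
      apply (E T s' (g, exist _ x Hx) HT); auto.
      * apply Hs'.
      * apply (fits_update (x := exist _ x Hx) Hf Hs').
    + intros [x Hx].
      destruct (update_ex Hs (num_omega n) (proj2_sig x)) as [s' Hs'].
      exists (proj1_sig x), s'. split; [apply (proj2_sig x)|]. split; auto.
      apply (E T s' (g, x) HT); auto.
      * apply Hs'.
      * apply (fits_update Hf Hs').
Defined.

Lemma fits_ex n (g : Ctx U n) : (exists x, x ∈ u) -> exists s, is_assign u s /\ fits s g.
Proof.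
  intros [x0 H0]. revert g. induction n; intros g.
  - sep (fun p : S => exists n, is_opair p n x0) (prod omega u) as s Hs.
    assert (R : forall n y, rel s n y <-> n ∈ omega /\ y = x0).
    { intros n y. rewrite rel_iff, Hs, opair_prod. split.
      - intros [H [n' E]]. apply opair_iff, opair_inj in E. tauto.
      - intros [H ->]. split; auto. exists n. apply opair_iff; auto. }
    exists s. split; [|intros l x []]. apply assign_iff. split; [split; [|split]|].
    + intros p Hp. apply Hs in Hp. destruct Hp as [Hp _]. apply prodE in Hp.
      destruct Hp as [n [y [Hn [_ E]]]]. exists n, y. rewrite opair_iff. auto.
    + intros n Hn. exists x0. apply R. auto.
    + intros n y y' H1 H2. apply R in H1, H2. intuition congruence.
    + intros n y H. apply R in H. destruct H; subst; auto.
  - destruct (IHn (fst g)) as [s [Hs Hf]].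
    destruct (update_ex Hs (num_omega n) (proj2_sig (snd g))) as [s' Hs'].
    exists s'. split; [apply Hs'|]. destruct g as [g x]. apply (fits_update Hf Hs').
Qed.

Lemma int_Sat n (P : Ctx U n -> Prop) : int_def P ->
  exists c, is_formula false c /\
    forall s g, is_assign u s -> fits s g -> (Sat u None c s <-> P g).
Proof.
  intros [c [Hc E]]. exists c. split; auto. intros s g Hs Hf. split.
  - intros [T [HT H]]. apply (E T s g HT Hs Hf). auto.
  - intros H. destruct (sat_rel_ex u) as [T HT]. exists T. split; auto.
    apply (E T s g HT Hs Hf). auto.
Qed.

Fixpoint crel (j : S) n : Ctx U n -> Ctx U n -> Prop :=
  match n with
  | O => fun _ _ => True
  | Datatypes.S n => fun g g' =>
      crel j (fst g) (fst g') /\ rel j (proj1_sig (snd g)) (proj1_sig (snd g'))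
  end.

Lemma crel_lvl j n : forall (g g' : Ctx U n) l x', crel j g g' -> lvl g' l x' ->
  exists x, lvl g l x /\ rel j (proj1_sig x) (proj1_sig x').
Proof.
  induction n; simpl; intros g g' l x'; [tauto|].
  intros [H1 H2] [[-> <-] | H].
  - exists (snd g). auto.
  - destruct (IHn _ _ _ _ H1 H) as [x [Hx Hr]]. eauto.
Qed.

(** An assignment that fits [g] is composed with [j]; the result fits [g'], and elementarity
    compares the two. *)
Lemma elementary_int j n (P : Ctx U n -> Prop) (g g' : Ctx U n) :
  is_elementary j u -> int_def P -> (exists x, x ∈ u) -> crel j g g' -> (P g <-> P g').
Proof.
  intros [Hj He] HP Hu Hg. destruct (int_Sat HP) as [c [Hc E]].
  destruct (fits_ex g Hu) as [s [Hs Hf]].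
  pose proof (proj1 (assign_iff _ _) Hs) as Fs.
  sep (fun p : S => exists n x y, is_opair p n y /\ rel s n x /\ rel j x y) (prod omega u) as s' Hs'.
  assert (R : forall n y, rel s' n y <-> exists x, rel s n x /\ rel j x y).
  { intros m y. rewrite rel_iff, Hs', opair_prod. split.
    - intros [_ [m' [x [y' [E' H]]]]]. apply opair_iff, opair_inj in E'. destruct E'; subst; eauto.
    - intros [x [H1 H2]]. split.
      + split; [apply (fun_dom Fs H1) | apply (fun_ran Hj H2)].
      + exists m, x, y. rewrite opair_iff. auto. }
  assert (As : is_assign u s').
  { apply assign_iff. split; [split; [|split]|].
    - intros p Hp. apply Hs' in Hp. destruct Hp as [Hp _]. apply prodE in Hp.
      destruct Hp as [m [y [Hn [_ E']]]]. exists m, y. rewrite opair_iff. auto.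
    - intros m Hm. destruct (fun_tot Fs Hm) as [x [Hx Hr]].
      destruct (fun_tot Hj Hx) as [y [_ Hy]]. exists y. apply R. eauto.
    - intros m y y' H1 H2. apply R in H1, H2. destruct H1 as [x [H1 H1']], H2 as [x' [H2 H2']].
      rewrite (fun_fun Fs H2 H1) in H2'. apply (fun_fun Hj H1' H2').
    - intros m y H. apply R in H. destruct H as [x [_ H]]. apply (fun_ran Hj H). }
  rewrite <- (E s g Hs Hf), <- (E s' g' As).
  - apply He; auto. intros m x y H1 H2. apply R. eauto.
  - intros l x' Hx'. destruct (crel_lvl Hg Hx') as [x [Hx Hr]]. apply R. exists (proj1_sig x).
    split; auto.
Qed.

Lemma int_collection (P : Ctx U 3 -> Prop) (p : U) :
  (forall c s, is_formula false c -> is_assign u s ->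
     collection_for (fun x y : U => Sat2 u None c s (proj1_sig x) (proj1_sig y))) ->
  int_def P -> collection_for (fun x y : U => P (tt, x, y, p)).
Proof.
  intros HC HP a Ha. destruct (int_Sat HP) as [c [Hc E]].
  (* Levels 0 and 1 hold placeholders that the updates in [Sat2] overwrite; level 2 keeps the
     parameter. *)
  destruct (@fits_ex 3 (tt, p, p, p)) as [s [Hs Hf]].
  { exists (proj1_sig p). apply proj2_sig. }
  assert (Q : forall x y : U, Sat2 u None c s (proj1_sig x) (proj1_sig y) <-> P (tt, x, y, p)).
  { intros x y.
    assert (F : forall s' s'', is_update u s (num 0) (proj1_sig x) s' ->
      is_update u s' (num 1) (proj1_sig y) s'' -> @fits s'' 3 (tt, x, y, p)).
    { intros s' s'' [_ [H1 H2]] [_ [H3 H4]] l v Hl. simpl in Hl.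
      destruct Hl as [[-> <-] | [[-> <-] | [[-> <-] | []]]].
      - apply H4; [intros h; apply num_inj in h; discriminate|].
        apply H2; [intros h; apply num_inj in h; discriminate|].
        apply Hf. simpl. auto.
      - auto.
      - apply H4; [intros h; apply num_inj in h; discriminate|]. auto. }
    split.
    - intros [i [k [s' [s'' [Hi [Hk [U1 [U2 H]]]]]]]].
      apply num_iff in Hi, Hk. subst i k. apply (E s''); auto.
      + apply U2.
      + eapply F; eauto.
    - intros H. destruct (update_ex Hs (num_omega 0) (proj2_sig x)) as [s' U1].
      destruct (update_ex (proj1 U1) (num_omega 1) (proj2_sig y)) as [s'' U2].
      exists (num 0), (num 1), s', s''. rewrite !num_iff. repeat (split; auto).
      apply (E s'' (tt, x, y, p)); auto.
      + apply U2.
      + eapply F; eauto. }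
  destruct (HC c s Hc Hs a) as [b Hb].
  - intros x Hx. destruct (Ha x Hx) as [y Hy]. exists y. apply Q; auto.
  - exists b. intros x Hx. destruct (Hb x Hx) as [y [Hy H]]. exists y. split; auto. apply Q; auto.
Qed.
End Internal.

(** * Choice modulo parameters *)

Section Choice.
Context {S : eps_struct} {ZS : zermelo S} {HS : hf S}.
Implicit Types a c d i j k m s u v w x y z p q h f T : S.

(** A bound for the variables on which the truth of [c] depends. Assignments are infinite, and
    lexicographic minimization is to run over the variables below [n] only. *)
Definition fin_supp c n : Prop :=
  n ∈ omega /\ forall u a T s s', is_sat_rel u (Some a) T -> is_assign u s -> is_assign u s' ->
    (forall m x, m ∈ n -> (rel s m x <-> rel s' m x)) -> rel T c s -> rel T c s'.

Ltac df_more ::= progress unfold fin_supp.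

Lemma fin_supp_ex c : is_formula true c -> exists n, fin_supp c n.
Proof.
  revert c. apply (form_ind (P := fun c : S => exists n, fin_supp c n)).
  { df. }
  - intros i j Hi Hj.
    destruct (nat_max (omegaS Hi) (omegaS Hj)) as [k [Hk [Ki Kj]]]. exists k. split; auto.
    intros u a T s s' HT Hs Hs' Hag H.
    apply (proj1 (HT s Hs) (cmem i j) i j) in H; [|apply code_mem_iff; auto].
    apply (proj1 (HT s' Hs') (cmem i j) i j); [apply code_mem_iff; auto|].
    destruct H as [x [y [H1 [H2 H3]]]]. exists x, y.
    split; [apply Hag; auto; apply Ki, succE; auto|].
    split; [apply Hag; auto; apply Kj, succE; auto|]. auto.
  - intros i j Hi Hj.
    destruct (nat_max (omegaS Hi) (omegaS Hj)) as [k [Hk [Ki Kj]]]. exists k. split; auto.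
    intros u a T s s' HT Hs Hs' Hag H.
    apply (proj1 (proj2 (HT s Hs)) (ceq i j) i j) in H; [|apply code_eq_iff; auto].
    apply (proj1 (proj2 (HT s' Hs')) (ceq i j) i j); [apply code_eq_iff; auto|].
    destruct H as [x [H1 H2]]. exists x.
    split; [apply Hag; auto; apply Ki, succE; auto|apply Hag; auto; apply Kj, succE; auto].
  - intros _ i Hi. exists (succ i). split; [apply omegaS; auto|].
    intros u a T s s' HT Hs Hs' Hag H.
    apply (proj1 (proj2 (proj2 (HT s Hs))) (cpred i) i) in H; [|apply code_pred_iff; auto].
    apply (proj1 (proj2 (proj2 (HT s' Hs'))) (cpred i) i); [apply code_pred_iff; auto|].
    destruct H as [x [H1 H2]]. exists x. split; auto. apply Hag; auto. apply succE; auto.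
  - intros d Hd [n [Hn Hb]]. exists n. split; auto.
    intros u a T s s' HT Hs Hs' Hag H.
    apply (proj1 (proj2 (proj2 (proj2 (HT s Hs)))) (cneg d) d Hd) in H; [|apply code_neg_iff; auto].
    apply (proj1 (proj2 (proj2 (proj2 (HT s' Hs')))) (cneg d) d Hd); [apply code_neg_iff; auto|].
    (* Negation exchanges the roles of the two assignments. *)
    intros H'. apply H. apply (Hb u a T s' s); auto. intros m x Hm. symmetry. auto.
  - intros d e Hd [n [Hn Hb]] He [n' [Hn' Hb']].
    destruct (nat_max Hn Hn') as [k [Hk [Ki Kj]]]. exists k. split; auto.
    intros u a T s s' HT Hs Hs' Hag H.
    apply (proj1 (proj2 (proj2 (proj2 (proj2 (HT s Hs))))) (cand d e) d e Hd He) in H;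
      [|apply code_and_iff; auto].
    apply (proj1 (proj2 (proj2 (proj2 (proj2 (HT s' Hs'))))) (cand d e) d e Hd He);
      [apply code_and_iff; auto|].
    destruct H as [H1 H2]. split.
    + apply (Hb u a T s s'); auto.
    + apply (Hb' u a T s s'); auto.
  - intros i d Hi Hd [n [Hn Hb]]. exists n. split; auto.
    intros u a T s s' HT Hs Hs' Hag H.
    apply (proj2 (proj2 (proj2 (proj2 (proj2 (HT s Hs))))) (cex i d) i d Hd) in H;
      [|apply code_ex_iff; auto].
    apply (proj2 (proj2 (proj2 (proj2 (proj2 (HT s' Hs'))))) (cex i d) i d Hd);
      [apply code_ex_iff; auto|].
    destruct H as [x [w [Hx [Hw H]]]]. destruct (update_ex Hs' Hi Hx) as [w' Hw'].
    exists x, w'. split; auto. split; auto.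
    destruct Hw as [W1 [W2 W3]], Hw' as [W1' [W2' W3']].
    apply (Hb u a T w w'); auto.
    intros m y Hm. destruct (classic (m = i)) as [-> | N].
    + split; intros Hy.
      * rewrite <- (assign_fun W1 W2 Hy). auto.
      * rewrite <- (assign_fun W1' W2' Hy). auto.
    + rewrite W3, W3'; auto.
Qed.

(** The two recursions witnessing [is_V] agree at every stage up to [alpha], by induction. *)
Lemma V_unique alpha v v' : is_ordinal alpha -> is_V alpha v -> is_V alpha v' -> v = v'.
Proof.
  intros Ha [a1 [f [E1 [[_ [T1 _]] [H1 V1]]]]] [a1' [f' [E1' [[_ [T1' _]] [H1' V1']]]]].
  apply succ_iff in E1, E1'. subst a1 a1'.
  assert (Q : forall b, is_ordinal b -> b ∈ succ alpha ->
    forall w w', rel f b w -> rel f' b w' -> w = w').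
  { refine (ord_ind (P := fun b : S => b ∈ succ alpha ->
      forall w w', rel f b w -> rel f' b w' -> w = w') _ _); [df|].
    intros b Hb IH Hba w w' Hw Hw'. apply z_ext. intros x.
    rewrite (H1 b w Hw x), (H1' b w' Hw' x).
    assert (Hs : forall c, c ∈ b -> c ∈ succ alpha)
      by (intros; apply (ord_trans (ord_succ Ha) Hba); auto).
    split; intros [c [r [Hc [Hr Hx]]]].
    - destruct (T1' c (Hs c Hc)) as [r' Hr']. exists c, r'.
      rewrite <- (IH c Hc (Hs c Hc) r r' Hr Hr'). auto.
      split; auto. split; auto. rewrite (IH c Hc (Hs c Hc) r r' Hr Hr'). auto.
    - destruct (T1 c (Hs c Hc)) as [r' Hr']. exists c, r'.
      split; auto. split; auto. rewrite (IH c Hc (Hs c Hc) r' r Hr' Hr). auto. }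
  apply (Q alpha Ha); auto. apply succE; auto.
Qed.

Variables (A : S -> Prop) (X Y : S) (y0 : S).
Hypothesis HA : forall n (t : Ctx S n -> S), Tm (Kc zd) t -> Df zd (fun g => A (t g)).
Hypothesis HX : X ⊆ Y.
Hypothesis Hy0 : y0 ∈ Y.
Hypothesis HOD : forall y, OD A X y.

Definition denotes alpha v c s y : Prop :=
  is_ordinal alpha /\ is_V alpha v /\ y ∈ v /\ is_formula true c /\ is_assign v s /\
  exists a, (forall x, x ∈ a <-> x ∈ v /\ A x) /\
    forall x, x ∈ v -> (Sat1 v (Some a) c s x <-> x = y).

(** Variable 0 is exempt, since it stands for the defined object. *)
Definition agree s s' (n : S) : Prop :=
  forall m x, m ∈ n -> ~ is_empty m -> (rel s m x <-> rel s' m x).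

Lemma denotes_unique alpha v v' c n s s' y y' :
  denotes alpha v c s y -> denotes alpha v' c s' y' -> fin_supp c n -> agree s s' n -> y = y'.
Proof.
  intros [Ha [Hv [Hy [Hc [Hs [a [Ea E]]]]]]] [_ [Hv' [_ [_ [Hs' [a' [Ea' E']]]]]]] [_ Hb] Hag.
  pose proof (V_unique Ha Hv Hv') as <-.
  assert (a = a') as <- by (apply z_ext; intros x; rewrite Ea, Ea'; tauto).
  apply E'; auto. pose proof (proj2 (E y Hy) eq_refl) as [i [w [Hi [Hw [T [HT Hr]]]]]].
  apply num_iff in Hi. subst i.
  destruct (update_ex Hs' (num_omega 0) Hy) as [w' Hw'].
  exists (num 0), w'. split; [apply num_iff; auto|]. split; auto. exists T. split; auto.
  destruct Hw as [W1 [W2 W3]], Hw' as [W1' [W2' W3']].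
  apply (Hb v a T w w'); auto. intros m x Hm.
  destruct (classic (m = num 0)) as [-> | N].
  - split; intros H.
    + rewrite <- (assign_fun W1 W2 H). auto.
    + rewrite <- (assign_fun W1' W2' H). auto.
  - rewrite W3, W3'; auto. apply Hag; auto. intros He. apply N. apply emp_iff; auto.
Qed.

(* Elements of [pow (prod HF Y)] code a formula, a bound for its variables, and
   the part of an assignment that takes values in [X]. *)
Definition at_tag l z m x : Prop := exists h, tagged l h m /\ rel z h x.
Definition codes_of : S := pow (prod HF Y).

Lemma at_tag_iff l z m x : at_tag l z m x <-> opair (opair (num l) m) x ∈ z.
Proof.
  unfold at_tag. split.
  - intros [h [H1 H2]]. apply tagged_iff in H1. apply rel_iff in H2. subst; auto.
  - intros H. exists (opair (num l) m). rewrite tagged_iff, rel_iff. auto.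
Qed.

(** Tag 0 carries the pair of formula and bound, with [y0] as a dummy second coordinate; tag 1
    carries the part of the assignment with values in $X$. *)
Definition code_of z c n : Prop :=
  (exists q, is_opair q c n /\ at_tag 0 z q y0) /\
  (forall q c' n', is_opair q c' n' -> at_tag 0 z q y0 -> c' = c /\ n' = n) /\
  (forall m x x', at_tag 1 z m x -> at_tag 1 z m x' -> x = x').

(** Parameters recorded in [z] are prescribed; all others must be ordinals and can thus be
    minimized. *)
Definition compatible z s : Prop :=
  forall m x, ~ is_empty m -> rel s m x ->
    at_tag 1 z m x \/ (is_ordinal x /\ forall x', ~ at_tag 1 z m x').

Variable E : S -> S -> Prop.
Hypothesis HE : forall n (t u : Ctx S n -> S), Tm (Kc zd) t -> Tm (Kc zd) u ->
  Df zd (fun g => E (t g) (u g)).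

Definition cand_at i z c alpha v s y : Prop :=
  denotes alpha v c s y /\ compatible z s /\ E i y.

(** Minimality in the lexicographic order below [n]: where another candidate first differs from [s],
    the value of [s] is the smaller one. *)
Definition lexmin i z c alpha s n : Prop :=
  forall v' s' y', cand_at i z c alpha v' s' y' ->
  forall k x x', k ∈ n -> ~ is_empty k -> agree s s' k -> rel s k x -> rel s' k x' ->
    x = x' \/ x ∈ x'.

(** The canonical element of the family at [i] for the code [z]: first the rank [alpha] is
    minimized, then the ordinal parameters. *)
Definition chosen i z y : Prop :=
  exists c n alpha v s, code_of z c n /\ fin_supp c n /\ cand_at i z c alpha v s y /\
    (forall alpha' v' s' y', alpha' ∈ alpha -> ~ cand_at i z c alpha' v' s' y') /\
    lexmin i z c alpha s n.

Ltac df_more ::= first [apply HA; df_tm | progress unfold denotes].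

Lemma Df_denotes n (t0 t1 t2 t3 t4 : Ctx S n -> S) :
  Tm (Kc zd) t0 -> Tm (Kc zd) t1 -> Tm (Kc zd) t2 -> Tm (Kc zd) t3 -> Tm (Kc zd) t4 ->
  Df zd (fun g => denotes (t0 g) (t1 g) (t2 g) (t3 g) (t4 g)).
Proof.
  intros. df.
Qed.

Ltac df_more ::= first [apply HA; df_tm | apply HE; df_tm
  | apply Df_denotes; df_tm
  | progress unfold chosen, lexmin, cand_at, compatible, code_of, at_tag, agree, fin_supp].

Lemma Df_cand_at n (t0 t1 t2 t3 t4 t5 t6 : Ctx S n -> S) :
  Tm (Kc zd) t0 -> Tm (Kc zd) t1 -> Tm (Kc zd) t2 -> Tm (Kc zd) t3 -> Tm (Kc zd) t4 ->
  Tm (Kc zd) t5 -> Tm (Kc zd) t6 ->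
  Df zd (fun g => cand_at (t0 g) (t1 g) (t2 g) (t3 g) (t4 g) (t5 g) (t6 g)).
Proof. intros. df. Qed.

Ltac df_more ::= first [apply HA; df_tm | apply HE; df_tm
  | apply Df_denotes; df_tm | apply Df_cand_at; df_tm
  | progress unfold chosen, lexmin, compatible, code_of, at_tag, agree, fin_supp].

Lemma Df_chosen n (t0 t1 t2 : Ctx S n -> S) :
  Tm (Kc zd) t0 -> Tm (Kc zd) t1 -> Tm (Kc zd) t2 ->
  Df zd (fun g => chosen (t0 g) (t1 g) (t2 g)).
Proof. intros. df. Qed.

Lemma chosen_E i z y : chosen i z y -> E i y.
Proof. intros [c [n [al [v [s [_ [_ [[_ [_ H]] _]]]]]]]]. exact H. Qed.

(** At a first difference each of the two values would be a member of the other. *)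
Lemma lexmin_agree i z c alpha v v' s s' y y' (n : S) : n ∈ omega ->
  cand_at i z c alpha v s y -> cand_at i z c alpha v' s' y' ->
  lexmin i z c alpha s n -> lexmin i z c alpha s' n -> agree s s' n.
Proof.
  intros Hn C C' L L'.
  pose proof (V_unique (proj1 (proj1 C)) (proj1 (proj2 (proj1 C))) (proj1 (proj2 (proj1 C')))) as <-.
  assert (Hs : is_assign v s) by apply C. assert (Hs' : is_assign v s') by apply C'.
  enough (Q : forall k, is_ordinal k -> k ∈ n -> ~ is_empty k ->
    forall x, rel s k x <-> rel s' k x).
  { intros m x Hm Nm. apply Q; auto. apply (ord_elem (nat_ord Hn) Hm). }
  refine (ord_ind (P := fun k : S => k ∈ n -> ~ is_empty k ->
    forall x, rel s k x <-> rel s' k x) _ _); [df|].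
  intros k Hk IH Hkn Nk.
  assert (Ag : agree s s' k).
  { intros m x Hm Nm. apply IH; auto. apply (ord_trans (nat_ord Hn) Hkn Hm). }
  assert (Ag' : agree s' s k) by (intros m x Hm Nm; symmetry; auto).
  pose proof (nat_elem Hn Hkn) as Ho.
  destruct (fun_tot (proj1 (assign_iff _ _) Hs) Ho) as [x [_ Hx]].
  destruct (fun_tot (proj1 (assign_iff _ _) Hs') Ho) as [x' [_ Hx']].
  assert (x = x') as <-.
  { destruct (L _ _ _ C' k x x' Hkn Nk Ag Hx Hx') as [H | H]; auto.
    destruct (L' _ _ _ C k x' x Hkn Nk Ag' Hx' Hx) as [H' | H']; auto.
    destruct (mem_asym H H'). }
  intros w. split; intros Hw.
  - rewrite <- (assign_fun Hs Hx Hw). auto.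
  - rewrite <- (assign_fun Hs' Hx' Hw). auto.
Qed.

Lemma chosen_fun i z y y' : chosen i z y -> chosen i z y' -> y = y'.
Proof.
  intros [c [n [al [v [s [W [B [C [M L]]]]]]]]] [c' [n' [al' [v' [s' [W' [B' [C' [M' L']]]]]]]]].
  destruct W' as [[q [Hq Hz]] _].
  destruct (proj1 (proj2 W) q c' n' Hq Hz) as [-> ->].
  assert (al = al') as <-.
  { destruct (ord_tri (proj1 (proj1 C)) (proj1 (proj1 C'))) as [H | [H | H]]; auto.
    - destruct (M' al v s y); auto.
    - destruct (M al' v' s' y'); auto. }
  apply (denotes_unique (proj1 C) (proj1 C') B).
  apply (lexmin_agree (proj1 B) C C'); auto.
Qed.

(** One coordinate is minimized at a time, by induction on [n] inside the model, among the
    candidates that agree with the current one on the earlier coordinates. *)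
Lemma lexmin_ex i z c alpha v s y (n : S) : n ∈ omega ->
  (forall m x x', at_tag 1 z m x -> at_tag 1 z m x' -> x = x') ->
  cand_at i z c alpha v s y ->
  exists v' s' y', cand_at i z c alpha v' s' y' /\ lexmin i z c alpha s' n.
Proof.
  intros Hn Hz C. revert n Hn.
  refine (omega_ind (P := fun n : S => exists v' s' y', cand_at i z c alpha v' s' y' /\
    lexmin i z c alpha s' n) _ _ _); [df | |].
  { exists v, s, y. split; auto. intros v' s' y' C' k x x' Hk. destruct (empE Hk). }
  clear v s y C. intros n Hn [v [s [y [C L]]]].
  assert (Ext : forall v' s' y', cand_at i z c alpha v' s' y' -> agree s s' n ->
    (forall v'' s'' y'', cand_at i z c alpha v'' s'' y'' -> ~ is_empty n -> agree s s'' n ->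
      forall x x', rel s' n x -> rel s'' n x' -> x = x' \/ x ∈ x') ->
    lexmin i z c alpha s' (succ n)).
  { intros v' s' y' C' Ag' H v'' s'' y'' C'' k x x' Hk Nk Ag Hx Hx'.
    apply succE in Hk. destruct Hk as [Hk | ->].
    - apply Ag' in Hx; auto. apply (L v'' s'' y'' C'' k); auto.
      intros m w Hm Nm. rewrite <- (Ag m w Hm Nm). apply Ag'; auto.
      apply (ord_trans (nat_ord Hn) Hk Hm).
    - apply (H v'' s'' y''); auto.
      intros m w Hm Nm. rewrite <- (Ag m w Hm Nm). apply Ag'; auto. }
  assert (Refl : agree s s n) by (intros m w _ _; tauto).
  destruct (classic (is_empty n)) as [En | Nn].
  { exists v, s, y. split; auto. apply (Ext v s y); auto. tauto. }
  (* Either [z] prescribes the value at [n] for all candidates, or all their values there are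
     ordinals and a least one exists. *)
  destruct (classic (exists x, at_tag 1 z n x)) as [[x0 H0] | Np].
  - assert (Val : forall v' s' y' x, cand_at i z c alpha v' s' y' -> rel s' n x -> x = x0).
    { intros v' s' y' x [_ [C' _]] Hx. destruct (C' n x Nn Hx) as [H | [_ H]].
      - apply (Hz n); auto.
      - destruct (H x0 H0). }
    exists v, s, y. split; auto. apply (Ext v s y); auto.
    intros v'' s'' y'' C'' _ _ x x' Hx Hx'. left.
    rewrite (Val _ _ _ _ C Hx), (Val _ _ _ _ C'' Hx'). auto.
  - assert (Val : forall v' s' y' x, cand_at i z c alpha v' s' y' -> rel s' n x -> is_ordinal x).
    { intros v' s' y' x [_ [C' _]] Hx. destruct (C' n x Nn Hx) as [H | [H _]]; auto.
      destruct Np; eauto. }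
    destruct (fun_tot (proj1 (assign_iff _ _) (proj1 (proj2 (proj2 (proj2 (proj2 (proj1 C))))))) Hn)
      as [x1 [_ H1]].
    destruct (@ord_minimal S _ (fun x : S => exists v' s' y', cand_at i z c alpha v' s' y' /\
      agree s s' n /\ rel s' n x) ltac:(df) x1) as [b [Hb [[v' [s' [y' [C' [Ag' H']]]]] Hm]]].
    { apply (Val v s y); auto. }
    { exists v, s, y. auto. }
    exists v', s', y'. split; auto. apply (Ext v' s' y'); auto.
    intros v'' s'' y'' C'' _ Ag x x' Hx Hx'.
    rewrite <- (assign_fun (proj1 (proj2 (proj2 (proj2 (proj2 (proj1 C')))))) H' Hx).
    destruct (ord_tri Hb (Val _ _ _ _ C'' Hx')) as [H | [H | H]]; auto.
    exfalso. apply (Hm x' H). exists v'', s'', y''. auto.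
Qed.

(** A definition of [y] is recorded in a code [z], so candidates for [z] exist. The minimal one may
    define another element [y'] of the same family. *)
Lemma chosen_ex i y : E i y -> exists z y', z ∈ codes_of /\ chosen i z y'.
Proof.
  intros Hi. destruct (HOD y) as [al [v [a [Hal [Hv [Ha [Hy [c [s [Hc [Hs [Hp He]]]]]]]]]]]].
  destruct (fin_supp_ex Hc) as [n Hn].
  sep (fun p : S => (exists q h, is_opair q c n /\ tagged 0 h q /\ is_opair p h y0) \/
    (exists m h x, ~ is_empty m /\ rel s m x /\ x ∈ X /\ tagged 1 h m /\ is_opair p h x))
    (prod HF Y) as z Hz.
  assert (Tg0 : forall q x, at_tag 0 z q x <-> q = opair c n /\ x = y0).
  { intros q x. rewrite at_tag_iff, Hz. split.
    - intros [_ [[q' [h [H1 [H2 H3]]]] | [m [h [x' [_ [_ [_ [H2 H3]]]]]]]]].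
      + apply opair_iff in H1, H3. apply tagged_iff in H2. subst.
        apply opair_inj in H3. destruct H3 as [H3 ->]. apply opair_inj in H3. tauto.
      + apply opair_iff in H3. apply tagged_iff in H2. subst.
        apply opair_inj in H3. destruct H3 as [H3 ->]. apply opair_inj in H3.
        destruct H3 as [H3 _]. apply num_inj in H3. discriminate.
    - intros [-> ->]. split.
      + apply opair_prod. split; auto. apply HF_opair; [apply HF_omega, num_omega|].
        apply HF_opair; [apply (form_HF Hc) | apply HF_omega, Hn].
      + left. exists (opair c n), (opair (num 0) (opair c n)).
        rewrite !opair_iff, tagged_iff. auto. }
  assert (Tg1 : forall m x, at_tag 1 z m x <-> ~ is_empty m /\ rel s m x /\ x ∈ X).
  { intros m x. rewrite at_tag_iff, Hz. split.
    - intros [_ [[q' [h [H1 [H2 H3]]]] | [m' [h [x' [H0 [H1 [Hx [H2 H3]]]]]]]]].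
      + apply opair_iff in H1, H3. apply tagged_iff in H2. subst.
        apply opair_inj in H3. destruct H3 as [H3 ->]. apply opair_inj in H3.
        destruct H3 as [H3 _]. apply num_inj in H3. discriminate.
      + apply opair_iff in H3. apply tagged_iff in H2. subst.
        apply opair_inj in H3. destruct H3 as [H3 ->]. apply opair_inj in H3.
        destruct H3 as [_ ->]. auto.
    - intros [H0 [H1 Hx]]. split.
      + apply opair_prod. split; auto. apply HF_opair; [apply HF_omega, num_omega|].
        apply HF_omega. apply (fun_dom (proj1 (assign_iff _ _) Hs) H1).
      + right. exists m, (opair (num 1) m), x. rewrite !opair_iff, tagged_iff. auto. }
  assert (W : code_of z c n).
  { split; [|split].
    - exists (opair c n). rewrite opair_iff, Tg0. auto.
    - intros q c' n' Hq H. apply Tg0 in H. apply opair_iff in Hq. destruct H as [H _].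
      rewrite H in Hq. apply opair_inj in Hq. destruct Hq; auto.
    - intros m x x' H1 H2. apply Tg1 in H1, H2.
      apply (assign_fun Hs (n := m)); tauto. }
  assert (C : cand_at i z c al v s y).
  { split; [|split; auto].
    - split; auto. split; auto. split; auto. split; auto. split; auto.
      exists a. auto.
    - intros m x Nm Hx. destruct (classic (x ∈ X)) as [H | H].
      + left. apply Tg1. auto.
      + right. destruct (Hp m x Nm Hx) as [H' | H']; [|tauto]. split; auto.
        intros x' Hx'. apply Tg1 in Hx'. apply H.
        rewrite (assign_fun Hs Hx (proj1 (proj2 Hx'))). tauto. }
  destruct (@ord_minimal S _ (fun al' : S => exists v s y, cand_at i z c al' v s y) ltac:(df) al)
    as [b [Hb [[v1 [s1 [y1 C1]]] Hm]]]; [auto | eauto |].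
  destruct (lexmin_ex (proj1 Hn) (proj2 (proj2 W)) C1) as [v2 [s2 [y2 [C2 L2]]]].
  exists z, y2. split.
  - apply powE. intros p Hpz. apply Hz in Hpz. tauto.
  - exists c, n, b, v2, s2. split; auto. split; auto. split; auto. split; auto.
    intros al' v' s' y' Hal' C'. apply (Hm al' Hal'). eauto.
Qed.

End Choice.

(** * Splitting into positive sets *)

Definition Dfr2 {S : eps_struct} {ZS : zermelo S} (R : S -> S -> Prop) : Prop :=
  forall n (t u : Ctx S n -> S), Tm (Kc zd) t -> Tm (Kc zd) u -> Df zd (fun g => R (t g) (u g)).
Definition Dfr3 {S : eps_struct} {ZS : zermelo S} (R : S -> S -> S -> Prop) : Prop :=
  forall n (t u v : Ctx S n -> S), Tm (Kc zd) t -> Tm (Kc zd) u -> Tm (Kc zd) v ->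
    Df zd (fun g => R (t g) (u g) (v g)).

Ltac df_hyp := match goal with
  | H : Dfr2 ?R |- @Df _ _ _ (fun g => ?R _ _) => apply H; df_tm
  | H : Dfr3 ?R |- @Df _ _ _ (fun g => ?R _ _ _) => apply H; df_tm
  end.
Ltac df_more ::= df_hyp.

Section Recursion.
Context {S : eps_struct} {ZS : zermelo S}.
Implicit Types a n x y p : S.

(** The sequence is the least set containing the initial pair and closed under the step. As for
    truth sets, minimality yields the inversion [Inv], hence uniqueness of values. *)
Lemma omega_rec (D x0 : S) (F : S -> S -> Prop) (HF : Dfr2 F) :
  x0 ∈ D ->
  (forall x, x ∈ D -> exists y, y ∈ D /\ F x y) ->
  (forall x y y', F x y -> F x y' -> y = y') ->
  exists a, is_function a omega D /\ rel a emp x0 /\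
    forall n x y, rel a n x -> rel a (succ n) y -> F x y.
Proof.
  intros H0 Htot Hfun.
  set (cl := fun a : S => rel a emp x0 /\
    forall n m x y, n ∈ omega -> x ∈ D -> y ∈ D -> is_succ m n -> rel a n x -> F x y -> rel a m y).
  assert (Hcl : @Df S zd 1 (fun g => forall a, cl a -> snd g ∈ a)).
  { unfold cl. df. }
  destruct (z_sep (P := fun p : S => forall a, cl a -> p ∈ a) Hcl (prod omega D)) as [a Ha].
  assert (C : cl a).
  { split.
    - apply rel_iff, Ha. split; [apply opair_prod; auto using omega0|].
      intros a' [Ca _]. apply rel_iff; auto.
    - intros n m x y Hn Hx Hy Hm Hr HF'. apply rel_iff, Ha. split.
      + apply succ_iff in Hm. subst. apply opair_prod; auto using omegaS.
      + intros a' Ca. apply rel_iff. apply (proj2 Ca n m x y); auto.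
        apply rel_iff. apply rel_iff, Ha in Hr. apply Hr; auto. }
  assert (Dom : forall n x, rel a n x -> n ∈ omega /\ x ∈ D).
  { intros n x H. apply rel_iff, Ha in H. destruct H as [H _]. apply opair_prod in H. auto. }
  assert (Inv : forall n x, rel a n x -> (n = emp /\ x = x0) \/
    exists m x', is_succ n m /\ rel a m x' /\ F x' x).
  { sep (fun p : S => exists n x, is_opair p n x /\ ((n = emp /\ x = x0) \/
      exists m x', is_succ n m /\ rel a m x' /\ F x' x)) a as a' Ha'.
    assert (Ca' : cl a').
    { split.
      - apply rel_iff, Ha'. split; [apply rel_iff, C|]. exists emp, x0. rewrite opair_iff. auto.
      - intros n m x y Hn Hx Hy Hm Hr HFxy.
        assert (Hr' : rel a n x) by (apply rel_iff in Hr; apply rel_iff; apply Ha' in Hr; tauto).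
        apply rel_iff, Ha'. split; [apply rel_iff, (proj2 C n m x y); auto|].
        exists m, y. rewrite opair_iff. eauto 8. }
    intros n x H. apply rel_iff, Ha in H. destruct H as [_ H].
    specialize (H a' Ca'). apply Ha' in H. destruct H as [_ [n' [x' [E' H]]]].
    apply opair_iff, opair_inj in E'. destruct E'; subst; auto. }
  assert (U : forall n, n ∈ omega -> exists x, rel a n x /\ forall x', rel a n x' -> x' = x).
  { refine (omega_ind (P := fun n : S => exists x, rel a n x /\ forall x', rel a n x' -> x' = x)
      _ _ _); [df | |].
    - exists x0. split; [apply C|]. intros x' H. destruct (Inv _ _ H) as [[_ ->] | [m [x [Hm _]]]]; auto.
      apply succ_iff in Hm. symmetry in Hm. destruct (succ_neq_emp Hm).
    - intros n Hn [x [Hx Ux]]. destruct (Htot x (proj2 (Dom _ _ Hx))) as [y [Hy HFy]].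
      exists y. split.
      + apply (proj2 C n (succ n) x y); auto. { apply (Dom _ _ Hx). } apply succ_iff; auto.
      + intros y' H. destruct (Inv _ _ H) as [[E' _] | [m [x' [Hm [Hr HF']]]]].
        * destruct (succ_neq_emp E').
        * apply succ_iff, succ_inj in Hm. subst m. rewrite (Ux _ Hr) in HF'.
          apply (Hfun x); auto. }
  exists a. split; [|split; [apply C|]].
  - split; [split; [|split]|].
    + intros p Hp. apply Ha in Hp. destruct Hp as [Hp _]. apply prodE in Hp.
      destruct Hp as [n [x [Hn [_ E']]]]. exists n, x. rewrite opair_iff. auto.
    + intros n Hn. destruct (U n Hn) as [x [Hx _]]. eauto.
    + intros n x x' H1 H2. destruct (U n (proj1 (Dom _ _ H1))) as [w [_ Hw]].
      rewrite (Hw _ H1), (Hw _ H2). auto.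
    + intros n x H. apply (Dom _ _ H).
  - intros n x y Hx Hy. destruct (Inv _ _ Hy) as [[E' _] | [m [x' [Hm [Hr HF']]]]].
    + destruct (succ_neq_emp E').
    + apply succ_iff, succ_inj in Hm. subst m. destruct (U n (proj1 (Dom _ _ Hx))) as [w [_ Hw]].
      rewrite (Hw _ Hx), <- (Hw _ Hr). auto.
Qed.
End Recursion.

Section Splitting.
Context {S : eps_struct} {ZS : zermelo S} {HS : hf S}.
Variables (Y y0 theta delta : S).
Hypothesis Hy0 : y0 ∈ Y.
Hypothesis Hdelta : is_ordinal delta.
Hypothesis HdY : delta ⊆ Y.
Let Z : S := codes_of Y.

Lemma Z_iff z : z ∈ Z <-> z ⊆ prod HF Y.
Proof. apply powE. Qed.

(** Choice up to an auxiliary index in the fixed set [Z], in the manner of small violations of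
    choice. *)
Hypothesis svc : forall E : S -> S -> Prop, Dfr2 E -> exists e : S -> S -> S -> Prop,
  Dfr3 e /\ (forall i z y, e i z y -> E i y) /\
  (forall i z y y', e i z y -> e i z y' -> y = y') /\
  (forall i y, E i y -> exists z y', z ∈ Z /\ e i z y').

Definition psurj f alpha : Prop :=
  (forall z b b' : S, rel f z b -> rel f z b' -> b = b') /\
  (forall b, b ∈ alpha -> exists z, z ∈ Z /\ rel f z b).

Hypothesis Htheta : forall alpha, alpha ∈ theta <-> is_ordinal alpha /\ exists f, psurj f alpha.

(** Unpairing on [Z]: component [k] of [z] consists of its pairs whose first coordinate has tag [k].
    The factor [HF] leaves room for the tags. *)
Definition dec (k : nat) (z w : S) : Prop :=
  w ∈ Z /\ forall h y, h ∈ HF -> y ∈ Y -> (rel w h y <-> at_tag k z h y).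

Ltac df_more ::= first [df_hyp | progress unfold psurj, dec, at_tag, tagged].

Lemma Z_ext w w' : w ∈ Z -> w' ∈ Z ->
  (forall h y, h ∈ HF -> y ∈ Y -> (rel w h y <-> rel w' h y)) -> w = w'.
Proof.
  intros Hw Hw' H. rewrite Z_iff in Hw, Hw'. apply sub_ext; intros p Hp.
  - pose proof (Hw _ Hp) as K. apply prodE in K. destruct K as [h [y [Hh [Hy ->]]]].
    apply rel_iff, H; auto. apply rel_iff; auto.
  - pose proof (Hw' _ Hp) as K. apply prodE in K. destruct K as [h [y [Hh [Hy ->]]]].
    apply rel_iff, H; auto. apply rel_iff; auto.
Qed.

Lemma dec_fun k z w w' : dec k z w -> dec k z w' -> w = w'.
Proof.
  intros [H1 H2] [H1' H2']. apply Z_ext; auto. intros h y Hh Hy. rewrite H2, H2'; tauto.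
Qed.

Lemma dec_ex w0 w1 : w0 ∈ Z -> w1 ∈ Z -> exists z, z ∈ Z /\ dec 0 z w0 /\ dec 1 z w1.
Proof.
  intros H0 H1.
  sep (fun p : S => exists h h' y, is_opair p h' y /\
    ((tagged 0 h' h /\ rel w0 h y) \/ (tagged 1 h' h /\ rel w1 h y))) (prod HF Y) as z Hz.
  assert (Tg : forall k h y, h ∈ HF -> y ∈ Y -> (at_tag k z h y <->
    (k = 0 /\ rel w0 h y) \/ (k = 1 /\ rel w1 h y))).
  { intros k h y Hh Hy. rewrite at_tag_iff, Hz, opair_prod. split.
    - intros [_ [h1 [h' [y' [E H]]]]]. apply opair_iff, opair_inj in E. destruct E as [<- <-].
      destruct H as [[H2 H3] | [H2 H3]]; apply tagged_iff, opair_inj in H2;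
        destruct H2 as [H2 <-]; apply num_inj in H2; auto.
    - intros H. split; [split; auto; apply HF_opair; auto; apply HF_omega, num_omega|].
      exists h, (opair (num k) h), y. rewrite opair_iff, !tagged_iff. split; auto.
      destruct H as [[-> H] | [-> H]]; auto. }
  exists z. split; [apply Z_iff; intros p Hp; apply Hz in Hp; tauto|].
  split; split; auto; intros h y Hh Hy; rewrite Tg; auto;
    split; auto; intros [[? ?] | [? ?]]; auto; discriminate.
Qed.

Lemma sing_Z h y : h ∈ HF -> y ∈ Y -> upair (opair h y) (opair h y) ∈ Z.
Proof.
  intros Hh Hy. apply Z_iff. intros p Hp. apply upairE in Hp.
  assert (p = opair h y) as -> by tauto. apply opair_prod; auto.
Qed.

Lemma psurj_rel (R : S -> S -> Prop) alpha : Dfr2 R ->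
  (forall z b b', z ∈ Z -> b ∈ alpha -> b' ∈ alpha -> R z b -> R z b' -> b = b') ->
  (forall b, b ∈ alpha -> exists z, z ∈ Z /\ R z b) ->
  exists f, psurj f alpha.
Proof.
  intros HR Hf Ht.
  sep (fun p : S => exists z b, is_opair p z b /\ R z b) (prod Z alpha) as f Hp.
  assert (Rf : forall z b, rel f z b <-> z ∈ Z /\ b ∈ alpha /\ R z b).
  { intros z b. rewrite rel_iff, Hp, opair_prod. split.
    - intros [H [z' [b' [E H']]]]. apply opair_iff, opair_inj in E. destruct E; subst; tauto.
    - intros [Hz [Hb H]]. split; auto. exists z, b. rewrite opair_iff. auto. }
  exists f. split.
  - intros z b b' H1 H2. apply Rf in H1, H2. apply (Hf z); tauto.
  - intros b Hb. destruct (Ht b Hb) as [z [Hz H]]. exists z. rewrite Rf. auto.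
Qed.

Lemma theta_ord : is_ordinal theta.
Proof.
  apply ord_intro.
  - intros a Ha b Hb. apply Htheta in Ha. destruct Ha as [Oa [f [F1 F2]]]. apply Htheta.
    split; [eapply ord_elem; eauto|]. exists f. split; auto.
    intros c Hc. apply F2. eapply ord_trans; eauto.
  - intros a Ha. apply Htheta in Ha. tauto.
Qed.

Lemma theta_elem a : a ∈ theta -> is_ordinal a.
Proof. apply (ord_elem theta_ord). Qed.

(** The first component of [z] is a flag: if empty, the value is the new top element [a]; otherwise
    the given surjection is applied to the second component. *)
Lemma theta_succ a : a ∈ theta -> succ a ∈ theta.
Proof.
  intros Ha. apply Htheta in Ha. destruct Ha as [Oa [f [F1 F2]]]. apply Htheta.
  split; [apply ord_succ; auto|].
  apply (psurj_rel (R := fun z b => exists w w', dec 0 z w /\ dec 1 z w' /\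
    ((is_empty w /\ b = a) \/ (~ is_empty w /\ rel f w' b)))).
  - intros n t v Ht Hv. df.
  - intros z b b' _ _ _ [w [w' [D0 [D1 H]]]] [v [v' [D0' [D1' H']]]].
    pose proof (dec_fun D0 D0') as <-. pose proof (dec_fun D1 D1') as <-.
    destruct H as [[? ?] | [? ?]], H' as [[? ?] | [? ?]]; try tauto; try congruence.
    apply (F1 w'); auto.
  - assert (E : emp ∈ Z) by (apply Z_iff; intros x Hx; destruct (empE Hx)).
    intros b Hb. apply succE in Hb. destruct Hb as [Hb | ->].
    + destruct (F2 b Hb) as [w' [Hw' H]].
      destruct (dec_ex (sing_Z HF_emp Hy0) Hw') as [z [Hz [D0 D1]]].
      exists z. split; auto. exists (upair (opair emp y0) (opair emp y0)), w'. split; auto. split; auto.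
      right. split; auto. intros K. apply (K (opair emp y0)). apply upairE; auto.
    + destruct (dec_ex E E) as [z [Hz [D0 D1]]]. exists z. split; auto. exists emp, emp.
      split; auto. split; auto. left. rewrite emp_iff. auto.
Qed.

(** The first component of [z] selects a partial surjection onto [a] through [svc]; the second is
    the argument fed to it. *)
Lemma cover_ex : exists gg : S -> S -> S -> Prop, Dfr3 gg /\
  (forall a z x x', gg a z x -> gg a z x' -> x = x') /\
  (forall a x, a ∈ theta -> x ∈ a -> exists z, z ∈ Z /\ gg a z x).
Proof.
  destruct (svc (E := fun a f => psurj f a)) as [e [De [H1 [H2 H3]]]].
  { intros n t u Ht Hu. df. }
  exists (fun a z x => exists w w' f, dec 0 z w /\ dec 1 z w' /\ e a w f /\ rel f w' x).
  split; [|split].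
  - intros n t u v Ht Hu Hv. df.
  - intros a z x x' [w [w' [f [D0 [D1 [Hf Hx]]]]]] [v [v' [f' [D0' [D1' [Hf' Hx']]]]]].
    pose proof (dec_fun D0 D0') as <-. pose proof (dec_fun D1 D1') as <-.
    pose proof (H2 _ _ _ _ Hf Hf') as <-. apply (proj1 (H1 _ _ _ Hf) w'); auto.
  - intros a x Ha Hx. apply Htheta in Ha. destruct Ha as [_ [f0 Hf0]].
    destruct (H3 a f0 Hf0) as [w [f [Hw Hf]]].
    destruct (proj2 (H1 _ _ _ Hf) x Hx) as [w' [Hw' Hr]].
    destruct (dec_ex Hw Hw') as [z [Hz [D0 D1]]]. exists z. split; auto. exists w, w', f. auto.
Qed.

(** Otherwise each [x] below [theta] lies in a value of [R] at some [w], and the cover of that value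
    reaches [x] at some [w']. Coding both arguments in one [z] gives a partial surjection from [Z]
    onto [theta], that is, [theta] in [theta]. *)
Lemma theta_regular (R : S -> S -> Prop) : Dfr2 R ->
  (forall z b b', z ∈ Z -> R z b -> R z b' -> b = b') ->
  (forall z b, z ∈ Z -> R z b -> b ∈ theta) ->
  exists b, b ∈ theta /\ forall z c, z ∈ Z -> R z c -> c ⊆ b.
Proof.
  intros HR Hf Hr. apply NNPP. intros N.
  destruct cover_ex as [gg [Dg [G1 G2]]].
  apply (@mem_irrefl S _ theta). apply Htheta. split; [apply theta_ord|].
  apply (psurj_rel (R := fun z x => exists w w' c, dec 0 z w /\ dec 1 z w' /\ R w c /\ gg c w' x)).
  - intros n t u Ht Hu. df.
  - intros z x x' _ _ _ [w [w' [c [D0 [D1 [Hc Hx]]]]]] [v [v' [c' [D0' [D1' [Hc' Hx']]]]]].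
    pose proof (dec_fun D0 D0') as <-. pose proof (dec_fun D1 D1') as <-.
    pose proof (Hf w _ _ (proj1 D0) Hc Hc') as <-. apply (G1 c w'); auto.
  - intros x Hx. apply NNPP. intros N'. apply N. exists x. split; auto.
    intros w c Hw Hc. apply NNPP. intros Hs.
    pose proof (Hr _ _ Hw Hc) as Tc.
    apply ord_nsub in Hs; auto using theta_elem.
    destruct (G2 c x Tc Hs) as [w' [Hw' Hg]].
    destruct (dec_ex Hw Hw') as [z [Hz [D0 D1]]].
    apply N'. exists z. split; auto. exists w, w', c. auto.
Qed.

(** Pairs from [HF] and [Y] are identified with their singletons, which belong to [Z]. *)
Lemma theta_regular_pairs (R : S -> S -> Prop) : Dfr2 R ->
  (forall q b b', R q b -> R q b' -> b = b') ->
  (forall q b, R q b -> b ∈ theta) ->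
  exists b, b ∈ theta /\ forall h y c, h ∈ HF -> y ∈ Y -> R (opair h y) c -> c ⊆ b.
Proof.
  intros HR Hf Hr.
  destruct (theta_regular (R := fun z b => exists q, is_upair z q q /\ R q b)) as [b [Hb H]].
  - intros n t u Ht Hu. df.
  - intros z b b' _ [q [Hq H]] [q' [Hq' H']]. apply upair_iff in Hq, Hq'. subst.
    apply upair_inj in Hq'. assert (q = q') as <- by tauto. eauto.
  - intros z b _ [q [_ H]]. eauto.
  - exists b. split; auto. intros h y c Hh Hy Hc.
    apply (H (upair (opair h y) (opair h y)) c).
    + apply sing_Z; auto.
    + exists (opair h y). rewrite upair_iff. auto.
Qed.

Lemma theta_regular_HF (R : S -> S -> Prop) : Dfr2 R ->
  (forall q b b', R q b -> R q b' -> b = b') ->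
  (forall q b, R q b -> b ∈ theta) ->
  exists b, b ∈ theta /\ forall h c, h ∈ HF -> R h c -> c ⊆ b.
Proof.
  intros HR Hf Hr.
  destruct (theta_regular_pairs (R := fun q b => exists h y, is_opair q h y /\ R h b)) as [b [Hb H]].
  - intros n t u Ht Hu. df.
  - intros q b b' [h [y [Hq H]]] [h' [y' [Hq' H']]]. apply opair_iff in Hq, Hq'. subst.
    apply opair_inj in Hq'. destruct Hq' as [<- <-]. eauto.
  - intros z b [h [y [_ H]]]. eauto.
  - exists b. split; auto. intros h c Hh Hc.
    apply (H h y0 c); auto. exists h, y0. rewrite opair_iff. auto.
Qed.

Lemma theta_regular_Y (R : S -> S -> Prop) : Dfr2 R ->
  (forall q b b', R q b -> R q b' -> b = b') ->
  (forall q b, R q b -> b ∈ theta) ->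
  exists b, b ∈ theta /\ forall y c, y ∈ Y -> R y c -> c ⊆ b.
Proof.
  intros HR Hf Hr.
  destruct (theta_regular_pairs (R := fun q b => exists h y, is_opair q h y /\ R y b)) as [b [Hb H]].
  - intros n t u Ht Hu. df.
  - intros q b b' [h [y [Hq H]]] [h' [y' [Hq' H']]]. apply opair_iff in Hq, Hq'. subst.
    apply opair_inj in Hq'. destruct Hq' as [<- <-]. eauto.
  - intros z b [h [y [_ H]]]. eauto.
  - exists b. split; auto. intros y c Hh Hc.
    apply (H emp y c); auto using HF_emp. exists emp, y. rewrite opair_iff. auto.
Qed.

(* The last clause is continuity at suprema of omega-sequences. *)
Definition normal j : Prop :=
  is_function j theta theta /\
  (forall b c, rel j b c -> b ⊆ c) /\
  (forall a l l', is_function a omega theta ->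
     (forall b, b ∈ l -> exists n c, rel a n c /\ b ∈ c) -> rel j l l' ->
     forall b, b ∈ l' -> exists n c c', rel a n c /\ rel j c c' /\ b ∈ c').

Ltac df_more ::= first [df_hyp | progress unfold psurj, dec, at_tag, tagged, normal].

Lemma Df_normal n (t : Ctx S n -> S) : Tm (Kc zd) t -> Df zd (fun g => normal (t g)).
Proof. intros. df. Qed.

Ltac df_more ::= first [df_hyp | apply Df_normal; df_tm | progress unfold psurj, dec, at_tag, tagged].

(** By regularity, [theta] has a bound for the values of all the functions at a given ordinal.
    Passing to such bounds omega times from [a0] gives a sequence whose supremum every function
    fixes, by continuity. *)
Lemma common_fixed_point (J : S -> S -> Prop) a0 : Dfr2 J ->
  (forall w j j', w ∈ Z -> J w j -> J w j' -> j = j') ->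
  (forall w j, J w j -> normal j) -> a0 ∈ theta ->
  exists l, l ∈ theta /\ a0 ⊆ l /\ forall w j, w ∈ Z -> J w j -> rel j l l.
Proof.
  intros DJ Jf Jn H0.
  set (up := fun b c : S => c ∈ theta /\ b ⊆ c /\
    forall w j b', w ∈ Z -> J w j -> rel j b b' -> b' ⊆ c).
  assert (Dup : Dfr2 up) by (intros n t u Ht Hu; unfold up; df).
  assert (Hup : forall b, b ∈ theta -> exists c, up b c).
  { intros b Hb.
    destruct (theta_regular (R := fun w b' => exists j, J w j /\ rel j b b')) as [c [Hc H]].
    - intros n t u Ht Hu. df.
    - intros w x x' Hw [j [Hj Hr]] [j' [Hj' Hr']]. pose proof (Jf _ _ _ Hw Hj Hj') as <-.
      apply (fun_fun (proj1 (Jn _ _ Hj)) Hr Hr').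
    - intros w x _ [j [Hj Hr]]. apply (fun_ran (proj1 (Jn _ _ Hj)) Hr).
    - destruct (classic (b ⊆ c)) as [Hs | Hs].
      + exists c. split; auto. split; auto. intros w j b' Hw Hj Hr. apply (H w b'); eauto.
      + apply ord_nsub in Hs; auto using theta_elem.
        exists b. split; auto. split; auto. intros w j b' Hw Hj Hr x Hx.
        apply (ord_trans (theta_elem Hb) Hs). apply (H w b'); eauto. }
  (* Taking the least bound makes the recursion deterministic. *)
  set (F := fun b c : S => up b c /\ forall c', c' ∈ c -> ~ up b c').
  destruct (omega_rec (D := theta) (x0 := a0) (F := F)) as [a [Fa [Ha0 HaS]]]; auto.
  { intros n t u Ht Hu. unfold F. df. }
  { intros x Hx. destruct (Hup x Hx) as [c Hc].
    destruct (@ord_minimal S _ (fun c : S => up x c) ltac:(df) c) as [b [Hb [Ub Mb]]]; auto.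
    - apply theta_elem, Hc.
    - exists b. split; [apply Ub|]. split; auto. }
  { intros x y y' [H1 H2] [H3 H4].
    destruct (ord_tri (theta_elem (proj1 H1)) (theta_elem (proj1 H3))) as [H | [H | H]]; auto.
    - destruct (H4 _ H H1).
    - destruct (H2 _ H H3). }
  sep (fun c : S => exists n, rel a n c) theta as C HC.
  set (l := Un C).
  assert (Ol : is_ordinal l).
  { apply ord_Un. intros y Hy. apply HC in Hy. apply theta_elem; tauto. }
  assert (Hl : l ∈ theta).
  { destruct (theta_regular_HF (R := fun n c => rel a n c)) as [b [Hb H]].
    - intros n t u Ht Hu. df.
    - intros n c c'. apply (fun_fun Fa).
    - intros n c. apply (fun_ran Fa).
    - assert (Hs : l ⊆ b).
      { intros x Hx. apply UnE in Hx. destruct Hx as [c [Hc Hx]]. apply HC in Hc.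
        destruct Hc as [_ [n Hn]]. apply (H n c); auto. apply HF_omega, (fun_dom Fa Hn). }
      apply ord_sub in Hs; auto using theta_elem. destruct Hs as [-> | Hs]; auto.
      apply (ord_trans theta_ord Hb Hs). }
  assert (Cl : forall n c, rel a n c -> c ⊆ l).
  { intros n c Hc x Hx. apply UnE. exists c. split; auto. apply HC. split; eauto.
    apply (fun_ran Fa Hc). }
  exists l. split; auto. split; [apply (Cl emp); auto|].
  intros w j Hw Hj. pose proof (Jn _ _ Hj) as [Fj [Ij Cj]].
  destruct (fun_tot Fj Hl) as [l' [Hl' Hr]].
  enough (l = l') as <- by auto. apply sub_ext; [apply Ij; auto|].
  intros b Hb. destruct (Cj a l l' Fa) with (b := b) as [n [c [c' [H1 [H2 H3]]]]]; auto.
  - intros x Hx. apply UnE in Hx. destruct Hx as [c [Hc Hx]]. apply HC in Hc.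
    destruct Hc as [_ [n Hn]]. eauto.
  - destruct (fun_tot Fa (omegaS (fun_dom Fa H1))) as [y [_ Hy]].
    apply (Cl (succ n) y Hy). pose proof (HaS _ _ _ H1 Hy) as [[_ [_ H]] _].
    apply (H w j c'); auto.
Qed.

(* Ulam's argument: the fibres gg(., z) = xi over a suitable fixed z give delta
   many disjoint sets meeting the fixed points of every normal function. *)
Theorem splitting : exists G b : S,
  (forall a x x', rel G a x -> rel G a x' -> x = x') /\
  (forall v, v ∈ delta -> exists x, rel b v x) /\
  (forall v v' x, rel b v x -> rel b v' x -> v = v') /\
  (forall v x x', rel b v x -> rel b v x' -> x = x') /\
  (forall v x j, rel b v x -> normal j -> exists a, rel j a a /\ rel G a x).
Proof.
  destruct cover_ex as [gg [Dg [G1 G2]]].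
  (* Positivity of the fibre over [x], the analogue of stationarity. *)
  set (pos := fun x z : S => forall j, normal j -> exists a, a ∈ theta /\ rel j a a /\ gg a z x).
  assert (Dpos : Dfr2 pos) by (intros n t u Ht Hu; unfold pos; df).
  (* Otherwise [svc] provides, for every [z], normal functions without fixed points in the fibre. A
     common fixed point [l] above [x] lies in the fibre of some [z], a contradiction. *)
  assert (P1 : forall x, x ∈ theta -> exists z, z ∈ Z /\ pos x z).
  { intros x Hx. apply NNPP. intros N.
    destruct (svc (E := fun z j => normal j /\ forall a, a ∈ theta -> rel j a a -> ~ gg a z x))
      as [e [De [E1 [E2 E3]]]].
    { intros n t u Ht Hu. df. }
    destruct (common_fixed_point (J := fun w j => exists z x, dec 0 w z /\ dec 1 w x /\ e z x j)
      (a0 := succ x)) as [l [Hl [Hs Hfix]]].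
    - intros n t u Ht Hu. df.
    - intros w j j' _ [z [v [D0 [D1 Hj]]]] [z' [v' [D0' [D1' Hj']]]].
      pose proof (dec_fun D0 D0') as <-. pose proof (dec_fun D1 D1') as <-. eauto.
    - intros w j [z [v [_ [_ Hj]]]]. apply (E1 _ _ _ Hj).
    - apply theta_succ; auto.
    - destruct (G2 l x Hl) as [z [Hz Hg]]; [apply Hs, succE; auto|].
      assert (exists j, normal j /\ forall a, a ∈ theta -> rel j a a -> ~ gg a z x) as [j0 Hj0].
      { apply NNPP. intros N'. apply N. exists z. split; auto. intros j Hj.
        apply NNPP. intros N''. apply N'. exists j. split; auto.
        intros a Ha Hr Hga. apply N''. eauto. }
      destruct (E3 z j0 Hj0) as [v [j [Hv Hj]]].
      destruct (dec_ex Hz Hv) as [w [Hw [D0 D1]]].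
      apply (proj2 (E1 _ _ _ Hj) l Hl); auto. apply (Hfix w j Hw). eauto. }
  (* Otherwise every [z] has a least bound for its positive values. These bounds are bounded by some
     [b] below [theta], and [P1] fails at [succ b]. *)
  assert (P2 : exists z, z ∈ Z /\ forall b, b ∈ theta -> exists x, x ∈ theta /\ pos x z /\ b ∈ x).
  { apply NNPP. intros N.
    set (bd := fun z b : S => b ∈ theta /\ forall x, x ∈ theta -> pos x z -> x ⊆ b).
    assert (Dbd : Dfr2 bd) by (intros n t u Ht Hu; unfold bd; df).
    assert (B : forall z, z ∈ Z -> exists b, bd z b).
    { intros z Hz. apply NNPP. intros N'. apply N. exists z. split; auto. intros b Hb.
      apply NNPP. intros N''. apply N'. exists b. split; auto. intros x Hx Hp.
      apply NNPP. intros Hs. apply ord_nsub in Hs; auto using theta_elem. apply N''. eauto. }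
    destruct (theta_regular (R := fun z b => bd z b /\ forall b', b' ∈ b -> ~ bd z b')) as [b [Hb H]].
    - intros n t u Ht Hu. df.
    - intros z x x' _ [H1 H2] [H3 H4].
      destruct (ord_tri (theta_elem (proj1 H1)) (theta_elem (proj1 H3))) as [H | [H | H]]; auto.
      + destruct (H4 _ H H1).
      + destruct (H2 _ H H3).
    - intros z x _ [[H1 _] _]; auto.
    - destruct (P1 (succ b) (theta_succ Hb)) as [z [Hz Hp]]. destruct (B z Hz) as [c Hc].
      destruct (@ord_minimal S _ (fun c : S => bd z c) ltac:(df) c) as [d [Hd [Bd Md]]]; auto.
      { apply theta_elem, Hc. }
      apply (@mem_irrefl S _ b). apply (H z d); auto.
      apply (proj2 Bd (succ b) (theta_succ Hb) Hp). apply succE; auto. }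
  destruct P2 as [z [Hz Hunb]].
  sep (fun x : S => pos x z) theta as D HD.
  sep (fun p : S => exists a x, is_opair p a x /\ gg a z x) (prod theta theta) as G HG.
  assert (RG : forall a x, rel G a x <-> a ∈ theta /\ x ∈ theta /\ gg a z x).
  { intros a x. rewrite rel_iff, HG, opair_prod. split.
    - intros [H [a' [x' [E H']]]]. apply opair_iff, opair_inj in E. destruct E; subst; tauto.
    - intros [Ha [Hx H]]. split; auto. exists a, x. rewrite opair_iff. auto. }
  set (above := fun f v d : S => forall v' d', v' ∈ v -> rel f v' d' -> d' ∈ d).
  set (nxt := fun f v d : S => d ∈ D /\ above f v d /\
    forall d', d' ∈ D -> d' ∈ d -> ~ above f v d').
  assert (Dnxt : Dfr3 nxt) by (intros n t u r Ht Hu Hr; unfold nxt, above; df).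
  assert (DD : forall d, d ∈ D -> is_ordinal d)
    by (intros d Hd; apply HD in Hd; apply theta_elem; tauto).
  assert (nxt_fun : forall f v d d', nxt f v d -> nxt f v d' -> d = d').
  { intros f v d d' [H1 [H2 H3]] [H1' [H2' H3']].
    destruct (ord_tri (DD _ H1) (DD _ H1')) as [H | [H | H]]; auto.
    - destruct (H3' d H1 H H2).
    - destruct (H3 d' H1' H H2'). }
  assert (nxt_eq : forall f f' v d, (forall v' d', v' ∈ v -> (rel f v' d' <-> rel f' v' d')) ->
    nxt f v d -> nxt f' v d).
  { intros f f' v d H [H1 [H2 H3]].
    assert (K : forall d, above f v d <-> above f' v d).
    { intros e. split; intros A v' d' Hv' Hr; apply (A v'); auto; apply H; auto. }
    split; auto. split; [apply K; auto|]. intros d' Hd' Hdd. rewrite <- K. auto. }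
  (* Attempts of length [v] at the increasing enumeration of [D]. They may be partial; totality of
     the one of length [delta] is proved separately. *)
  set (att := fun f v : S => forall w d, rel f w d <-> w ∈ v /\ nxt f w d).
  assert (Datt : Dfr2 att) by (intros n t u Ht Hu; unfold att; df).
  assert (att_agree : forall f f' v v', is_ordinal v -> is_ordinal v' -> att f v -> att f' v' ->
    forall w, is_ordinal w -> w ∈ v -> w ∈ v' -> forall d, rel f w d <-> rel f' w d).
  { intros f f' v v' Ov Ov' Hf Hf'.
    refine (ord_ind (P := fun w : S => w ∈ v -> w ∈ v' -> forall d, rel f w d <-> rel f' w d) _ _).
    { df. }
    intros w Ow IH Hw Hw' d. rewrite (Hf w d), (Hf' w d).
    assert (K : forall x d, x ∈ w -> (rel f x d <-> rel f' x d)).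
    { intros x e Hx. apply IH; auto; eapply ord_trans; eauto. }
    split; intros [_ H]; split; auto; revert H; apply nxt_eq; auto.
    intros; symmetry; auto. }
  assert (att_ex : forall v, is_ordinal v -> v ⊆ delta -> exists f, att f v).
  { refine (ord_ind (P := fun v : S => v ⊆ delta -> exists f, att f v) _ _); [df|].
    intros v Ov IH Hv.
    sep (fun p : S => exists w d f', is_opair p w d /\ w ∈ v /\ att f' w /\ nxt f' w d)
      (prod delta D) as f Hf.
    assert (Rf : forall w d, rel f w d <-> w ∈ v /\ exists f', att f' w /\ nxt f' w d).
    { intros w d. rewrite rel_iff, Hf, opair_prod. split.
      - intros [_ [w' [d' [f' [E H]]]]]. apply opair_iff, opair_inj in E. destruct E; subst.
        split; [tauto|]. exists f'. tauto.
      - intros [Hw [f' [H1 H2]]]. split; [split; [auto | apply H2]|].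
        exists w, d, f'. rewrite opair_iff. auto. }
    assert (K : forall w f', w ∈ v -> att f' w -> forall x d, x ∈ w -> (rel f x d <-> rel f' x d)).
    { intros w f' Hw Hf' x d Hx. pose proof (ord_elem Ov Hw) as Ow.
      pose proof (ord_elem Ow Hx) as Ox.
      rewrite Rf, (Hf' x d). split.
      - intros [_ [f'' [H1 H2]]]. split; auto. revert H2. apply nxt_eq.
        intros y e Hy. apply (att_agree f'' f' x w); auto; [eapply ord_elem; eauto|].
        eapply ord_trans; eauto.
      - intros [_ H]. assert (Hxv : x ∈ v) by (eapply ord_trans; eauto). split; auto.
        destruct (IH x Hxv) as [f'' H'']. { intros y Hy. apply Hv. eapply ord_trans; eauto. }
        exists f''. split; auto. revert H. apply nxt_eq.
        intros y e Hy. apply (att_agree f' f'' w x); auto; [eapply ord_elem; eauto|].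
        eapply ord_trans; eauto. }
    exists f. intros w d. rewrite Rf. split.
    - intros [Hw [f' [H1 H2]]]. split; auto. revert H2. apply nxt_eq.
      intros x e Hx. symmetry. apply (K w); auto.
    - intros [Hw H]. split; auto. destruct (IH w Hw) as [f' Hf'].
      { intros y Hy. apply Hv. eapply ord_trans; eauto. }
      exists f'. split; auto. revert H. apply nxt_eq. intros x e Hx. apply (K w); auto. }
  destruct (att_ex delta Hdelta (fun _ h => h)) as [b Hb].
  exists G, b. split; [|split; [|split; [|split]]].
  - intros a x x' H1 H2. apply RG in H1, H2. apply (G1 a z); tauto.
  - intros v Hv.
    (* As [delta] is included in [Y], the earlier values are bounded below [theta], and [D] has an
       element above the bound. *)
    destruct (theta_regular_Y (R := fun v' d => v' ∈ v /\ rel b v' d)) as [c [Hc H]].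
    + intros n t u Ht Hu. df.
    + intros q d d' [_ H1] [_ H2]. apply Hb in H1, H2. apply (nxt_fun b q); tauto.
    + intros q d [_ H1]. apply Hb in H1. destruct H1 as [_ [H1 _]]. apply HD in H1. tauto.
    + destruct (Hunb c Hc) as [x [Hx [Hp Hcx]]].
      destruct (@set_minimal S _ (fun d : S => above b v d) ltac:(unfold above; df) D)
        as [d [Hd [Ad Md]]].
      { exists x. split; [apply HD; auto|]. intros v' d' Hv' Hr.
        assert (Hs : d' ⊆ c).
        { apply (H v' d'); auto. apply HdY. eapply ord_trans; eauto. }
        pose proof (proj1 (Hb _ _) Hr) as [_ [Dd' _]].
        apply ord_sub in Hs; auto using theta_elem. destruct Hs as [-> | Hs]; auto.
        apply (ord_trans (theta_elem Hx) Hcx Hs). }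
      exists d. apply Hb. split; auto. split; auto.
  - intros v v' x H1 H2. pose proof (proj1 (Hb _ _) H1) as [Hv [_ [A1 _]]].
    pose proof (proj1 (Hb _ _) H2) as [Hv' [_ [A2 _]]].
    destruct (ord_tri (ord_elem Hdelta Hv) (ord_elem Hdelta Hv')) as [H | [H | H]]; auto.
    + destruct (mem_irrefl (A2 _ _ H H1)).
    + destruct (mem_irrefl (A1 _ _ H H2)).
  - intros v x x' H1 H2. apply Hb in H1, H2. apply (nxt_fun b v); tauto.
  - intros v x j H Hj. apply Hb in H. destruct H as [_ [H _]]. apply HD in H.
    destruct H as [Hx Hp]. destruct (Hp j Hj) as [a [Ha [Hr Hg]]].
    exists a. split; auto. apply RG. auto.
Qed.
End Splitting.

(** * Elementary embeddings *)

Ltac df_more ::= df_hyp.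

Section Embedding.
Context {S : eps_struct} {ZS : zermelo S} {HS : hf S}.
Variables N j : S.
Hypothesis HN : is_transitive N.
Hypothesis Hj : is_elementary j N.
Let U : eps_struct := substruct N.

Local Notation el h := (exist (fun v => v ∈ N) _ h).

Lemma emb_tot x : x ∈ N -> exists y, y ∈ N /\ rel j x y.
Proof. apply (fun_tot (proj1 Hj)). Qed.
Lemma emb_dom x y : rel j x y -> x ∈ N.
Proof. apply (fun_dom (proj1 Hj)). Qed.
Lemma emb_ran x y : rel j x y -> y ∈ N.
Proof. apply (fun_ran (proj1 Hj)). Qed.
Lemma emb_fun x y y' : rel j x y -> rel j x y' -> y = y'.
Proof. apply (fun_fun (proj1 Hj)). Qed.

Lemma emb1 (P : U -> Prop) : @Df U (int_defsys N) 1 (fun g => P (snd g)) ->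
  forall x x', rel j x x' -> forall (Hx : x ∈ N) (Hx' : x' ∈ N),
  P (el Hx) <-> P (el Hx').
Proof.
  intros D x x' H Hx Hx'.
  apply (@elementary_int S ZS HS N j 1 (fun g => P (snd g)) (tt, el Hx) (tt, el Hx') Hj D); simpl; eauto.
Qed.

Lemma emb2 (P : U -> U -> Prop) : @Df U (int_defsys N) 2 (fun g => P (snd (fst g)) (snd g)) ->
  forall x x' y y', rel j x x' -> rel j y y' ->
  forall (Hx : x ∈ N) (Hx' : x' ∈ N) (Hy : y ∈ N) (Hy' : y' ∈ N),
  P (el Hx) (el Hy) <-> P (el Hx') (el Hy').
Proof.
  intros D x x' y y' H1 H2 Hx Hx' Hy Hy'.
  apply (@elementary_int S ZS HS N j 2 (fun g => P (snd (fst g)) (snd g))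
    (tt, el Hx, el Hy) (tt, el Hx', el Hy') Hj D); simpl; eauto.
Qed.

Lemma emb3 (P : U -> U -> U -> Prop) :
  @Df U (int_defsys N) 3 (fun g => P (snd (fst (fst g))) (snd (fst g)) (snd g)) ->
  forall x x' y y' z z', rel j x x' -> rel j y y' -> rel j z z' ->
  forall (Hx : x ∈ N) (Hx' : x' ∈ N) (Hy : y ∈ N) (Hy' : y' ∈ N) (Hz : z ∈ N) (Hz' : z' ∈ N),
  P (el Hx) (el Hy) (el Hz) <->
  P (el Hx') (el Hy') (el Hz').
Proof.
  intros D x x' y y' z z' H1 H2 H3 Hx Hx' Hy Hy' Hz Hz'.
  apply (@elementary_int S ZS HS N j 3 (fun g => P (snd (fst (fst g))) (snd (fst g)) (snd g))
    (tt, el Hx, el Hy, el Hz)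
    (tt, el Hx', el Hy', el Hz') Hj D); simpl; eauto 6.
Qed.

Lemma emb_mem x x' y y' : rel j x x' -> rel j y y' -> (x ∈ y <-> x' ∈ y').
Proof.
  intros H1 H2. apply (emb2 (P := fun x y => x ∈ y) ltac:(df) H1 H2
    (emb_dom H1) (emb_ran H1) (emb_dom H2) (emb_ran H2)).
Qed.

Lemma emb_inj x y x' : rel j x x' -> rel j y x' -> x = y.
Proof.
  intros H1 H2.
  pose proof (emb2 (P := fun x y => x = y) ltac:(df) H1 H2
    (emb_dom H1) (emb_ran H1) (emb_dom H2) (emb_ran H1)) as H.
  pose proof (proj2 H eq_refl) as E. apply (f_equal (@proj1_sig _ _)) in E. exact E.
Qed.

(** Unordered pairs are absolute, since [N] is transitive. *)
Lemma sub_upair (p a b : U) :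
  is_upair p a b <-> proj1_sig p = upair (proj1_sig a) (proj1_sig b).
Proof.
  split.
  - intros H. apply z_ext. intros z. rewrite upairE. split.
    + intros Hz. pose proof (HN (proj2_sig p) Hz) as HzN.
      destruct (proj1 (H (el HzN)) Hz) as [E | E];
        apply (f_equal (@proj1_sig _ _)) in E; auto.
    + intros [-> | ->]; apply H; auto.
  - intros E z. simpl. rewrite E, upairE. split; intros [H | H]; auto.
    + left. apply substruct_eq; auto.
    + right. apply substruct_eq; auto.
    + left. subst; auto.
    + right. subst; auto.
Qed.

(* Unlike [is_opair], this is absolute for every transitive set. *)
Definition opair_in (p a b : U) : Prop :=
  exists s d, is_upair s a a /\ is_upair d a b /\ is_upair p s d.

Lemma opair_in_iff (p a b : U) :
  opair_in p a b <-> proj1_sig p = opair (proj1_sig a) (proj1_sig b).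
Proof.
  unfold opair_in. rewrite opair_def. split.
  - intros [s [d [H1 [H2 H3]]]]. rewrite sub_upair in *. congruence.
  - intros E.
    assert (Hs : upair (proj1_sig a) (proj1_sig a) ∈ N)
      by (apply (HN (proj2_sig p)); rewrite E; apply upairE; auto).
    assert (Hd : upair (proj1_sig a) (proj1_sig b) ∈ N)
      by (apply (HN (proj2_sig p)); rewrite E; apply upairE; auto).
    exists (el Hs), (el Hd). rewrite !sub_upair. auto.
Qed.

Ltac df_more ::= first [df_hyp | progress unfold opair_in].

Lemma emb_opair a a' b b' p : opair a b ∈ N -> rel j a a' -> rel j b b' ->
  rel j (opair a b) p -> p = opair a' b'.
Proof.
  intros HpN Ha Hb Hp.
  pose proof (emb3 (P := opair_in) ltac:(df) Hp Ha Hb (emb_dom Hp) (emb_ran Hp)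
    (emb_dom Ha) (emb_ran Ha) (emb_dom Hb) (emb_ran Hb)) as H.
  rewrite !opair_in_iff in H. simpl in H. tauto.
Qed.

Lemma trans_opair t a b : is_transitive t -> opair a b ∈ t -> a ∈ t /\ b ∈ t.
Proof.
  intros Ht H.
  assert (H' : upair a b ∈ t) by (apply (Ht _ H); rewrite opair_def; apply upairE; auto).
  split; apply (Ht _ H'), upairE; auto.
Qed.

Lemma emb_rel f f' a a' b b' : rel j f f' -> rel j a a' -> rel j b b' -> rel f a b -> rel f' a' b'.
Proof.
  intros Hf Ha Hb H. apply rel_iff in H. apply rel_iff.
  assert (HpN : opair a b ∈ N) by (apply (HN (emb_dom Hf)); auto).
  destruct (emb_tot HpN) as [p [_ Hp]].
  rewrite <- (emb_opair HpN Ha Hb Hp). apply (emb_mem Hp Hf); auto.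
Qed.

Lemma emb_fix_opair a b : rel j (opair a b) (opair a b) -> rel j a a /\ rel j b b.
Proof.
  intros H. destruct (trans_opair HN (emb_dom H)) as [Ha Hb].
  destruct (emb_tot Ha) as [a' [_ Ha']]. destruct (emb_tot Hb) as [b' [_ Hb']].
  pose proof (emb_opair (emb_dom H) Ha' Hb' H) as E. apply opair_inj in E.
  destruct E; subst; auto.
Qed.

Lemma emb_emp : emp ∈ N -> rel j emp emp.
Proof.
  intros He. destruct (emb_tot He) as [e [_ H]].
  enough (e = emp) by congruence. apply emp_iff. intros z Hz.
  pose proof (emb1 (P := fun x => is_empty x) ltac:(df) H (emb_dom H) (emb_ran H)) as K.
  assert (K' : @is_empty U (el (emb_dom H))) by (intros w Hw; exact (empE Hw)).
  apply (proj1 K) in K'. apply (K' (el (HN (emb_ran H) Hz))). exact Hz.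
Qed.

Lemma emb_succ n : succ n ∈ N -> rel j n n -> rel j (succ n) (succ n).
Proof.
  intros Hs Hn. destruct (emb_tot Hs) as [m [_ H]].
  enough (m = succ n) by congruence.
  pose proof (emb2 (P := fun x y => is_succ x y) ltac:(df) H Hn
    (emb_dom H) (emb_ran H) (emb_dom Hn) (emb_dom Hn)) as K.
  assert (K' : @is_succ U (el (emb_dom H)) (el (emb_dom Hn))).
  { intros z. simpl. rewrite succE. split; intros [E | E]; auto.
    - right. apply substruct_eq; auto.
    - right. subst; auto. }
  apply (proj1 K) in K'. apply z_ext. intros z. rewrite succE. split.
  - intros Hz. destruct (proj1 (K' (el (HN (emb_ran H) Hz))) Hz) as [E | E]; auto.
    right. apply (f_equal (@proj1_sig _ _)) in E. exact E.
  - intros [Hz | ->].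
    + apply (proj2 (K' (el (HN (emb_dom Hn) Hz)))). left. exact Hz.
    + apply (proj2 (K' (el (emb_dom Hn)))). right. apply substruct_eq; auto.
Qed.

(** As [j] is a set, being fixed by it is a definable property and the induction of the model
    applies. *)
Lemma emb_nat n : omega ∈ N -> n ∈ omega -> rel j n n.
Proof.
  intros HwN. revert n. apply (omega_ind (P := fun n : S => rel j n n)); [df | |].
  - apply emb_emp. apply (HN HwN). apply omega0.
  - intros n Hn. apply emb_succ. apply (HN HwN). apply omegaS; auto.
Qed.

(** Functionality, expressed with [opair_in], is a statement inside [N] and transfers; transitivity
    puts the components of pairs into [N]. *)
Lemma emb_functional a a' x y y' : rel j a a' ->
  (forall x y y', rel a x y -> rel a x y' -> y = y') ->
  rel a' x y -> rel a' x y' -> y = y'.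
Proof.
  intros Ha Hf H1 H2. apply rel_iff in H1, H2.
  pose proof (emb1 (P := fun a => forall p p' x y y', p ∈ a -> p' ∈ a -> opair_in p x y ->
    opair_in p' x y' -> y = y') ltac:(df) Ha (emb_dom Ha) (emb_ran Ha)) as K.
  pose proof (HN (emb_ran Ha) H1) as P1. pose proof (HN (emb_ran Ha) H2) as P2.
  destruct (trans_opair HN P1) as [X1 Y1]. destruct (trans_opair HN P2) as [X2 Y2].
  assert (E : exist (fun x => x ∈ N) y Y1 = el Y2).
  { apply (proj1 K) with (p := el P1) (p' := el P2) (x := el X1); auto.
    - intros p p' u v v' Hp Hp' E E'. rewrite opair_in_iff in E, E'.
      apply substruct_eq. apply (Hf (proj1_sig u)); apply rel_iff.
      + rewrite <- E. exact Hp.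
      + rewrite <- E'. exact Hp'.
    - apply opair_in_iff; auto.
    - apply opair_in_iff; auto. }
  apply (f_equal (@proj1_sig _ _)) in E. exact E.
Qed.

Lemma emb_cofinal a a' l l' : rel j a a' -> rel j l l' ->
  (forall b, b ∈ l -> exists n c, rel a n c /\ b ∈ c) ->
  forall b, b ∈ l' -> exists n c, rel a' n c /\ b ∈ c.
Proof.
  intros Ha Hl H b Hb.
  pose proof (emb2 (P := fun a l => forall b, b ∈ l -> exists p n c, p ∈ a /\ opair_in p n c /\
    b ∈ c) ltac:(df) Ha Hl (emb_dom Ha) (emb_ran Ha) (emb_dom Hl) (emb_ran Hl)) as K.
  destruct (proj1 K) with (b := el (HN (emb_ran Hl) Hb))
    as [p [n [c [Hp [E Hc]]]]]; auto.
  - intros b0 Hb0. destruct (H (proj1_sig b0) Hb0) as [n [c [Hr Hc]]].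
    apply rel_iff in Hr. pose proof (HN (emb_dom Ha) Hr) as P.
    destruct (trans_opair HN P) as [X Y].
    exists (el P), (el X), (el Y). rewrite opair_in_iff. auto.
  - exists (proj1_sig n), (proj1_sig c). split; auto. apply rel_iff.
    apply opair_in_iff in E. rewrite <- E. exact Hp.
Qed.

(** The function is the restriction of [j] to [theta]. It is continuous because [j] fixes every
    natural number, so that the image of a sequence is the sequence of the images. *)
Lemma emb_normal theta : is_ordinal theta -> rel j theta theta -> omega ∈ N ->
  rel j (pow (prod omega theta)) (pow (prod omega theta)) ->
  exists f, normal theta f /\ forall x y, rel f x y -> rel j x y.
Proof.
  intros Ot Ht HwN HB.
  sep (fun p : S => exists x y, is_opair p x y /\ x ∈ theta) j as f Hf.
  assert (Rf : forall x y, rel f x y <-> x ∈ theta /\ rel j x y).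
  { intros x y. rewrite !rel_iff, Hf. split.
    - intros [H [x' [y' [E Hx]]]]. apply opair_iff, opair_inj in E. destruct E; subst; auto.
    - intros [H1 H2]. split; auto. exists x, y. rewrite opair_iff. auto. }
  assert (Ff : is_function f theta theta).
  { split; [split; [|split]|].
    - intros p Hp. apply Hf in Hp. destruct Hp as [_ [x [y [E Hx]]]]. eauto.
    - intros x Hx. destruct (emb_tot (HN (emb_dom Ht) Hx)) as [y [_ Hy]]. exists y. apply Rf; auto.
    - intros x y y' H1 H2. apply Rf in H1, H2. apply (emb_fun (proj2 H1) (proj2 H2)).
    - intros x y H. apply Rf in H. destruct H as [Hx H]. apply (emb_mem H Ht); auto. }
  exists f. split; [split; [exact Ff | split]|].
  - intros b c Hbc. apply NNPP. intros Nbc.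
    pose proof (ord_elem Ot (fun_dom Ff Hbc)) as Ob.
    (* If [b0] is least with its value [c0] below it, then the value at [c0] is below [c0],
       contradicting minimality. *)
    destruct (@ord_minimal S _ (fun b : S => exists c, rel f b c /\ ~ c ∈ theta \/
      rel f b c /\ c ∈ b) ltac:(df) b) as [b0 [Ob0 [[c0 H0] Hm]]]; auto.
    { exists c. right. split; auto. apply ord_nsub; auto.
      apply (ord_elem Ot (fun_ran Ff Hbc)). }
    destruct H0 as [[H0 H1] | [H0 H1]]; [destruct (H1 (fun_ran Ff H0))|].
    destruct (fun_tot Ff (fun_ran Ff H0)) as [c1 [_ Hc1]].
    apply (Hm c0 H1). exists c1. right. split; auto.
    apply Rf in H0, Hc1. apply (emb_mem (proj2 Hc1) (proj2 H0)); auto.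
  - intros a l l' Fa Hl Hr b Hb. apply Rf in Hr. destruct Hr as [_ Hr].
    (* That the set of subsets of the product is in [N] puts [a] into [N]; that it is fixed makes
       the indices of the image [a'] natural numbers. *)
    pose proof (fun_prod Fa) as HaB. destruct (emb_tot (HN (emb_dom HB) HaB)) as [a' [_ Ha']].
    destruct (emb_cofinal Ha' Hr Hl Hb) as [n [c' [Hn Hc']]].
    assert (Hn' : n ∈ omega).
    { pose proof (proj1 (emb_mem Ha' HB) HaB) as HaB'. rewrite powE in HaB'.
      apply rel_iff in Hn. apply HaB' in Hn. apply opair_prod in Hn. tauto. }
    destruct (fun_tot Fa Hn') as [c [Hc Hac]].
    destruct (fun_tot Ff Hc) as [c2 [_ Hc2]].
    exists n, c, c2. split; auto. split; auto.
    enough (c2 = c') by (subst; auto).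
    apply Rf in Hc2.
    apply (emb_functional Ha' (fun x y y' => fun_fun Fa (x := x) (y := y) (y' := y'))
      (x := n)); auto.
    apply (emb_rel Ha' (emb_nat HwN Hn') (proj2 Hc2)); auto.
  - intros x y H. apply Rf in H. tauto.
Qed.
End Embedding.

(* The transitive set [t ∪ {t, {t, q}}] defines [t] and [q] without parameters,
   so its elementary embeddings fix [q]. *)
Lemma tower_fix {S : eps_struct} {ZS : zermelo S} {HS : hf S} (t q : S) :
  is_transitive t -> q ∈ t ->
  exists N, is_transitive N /\ t ⊆ N /\ forall j, is_elementary j N -> rel j q q.
Proof.
  intros Ht Hq. set (r := upair t q).
  set (N := cup t (upair t r)).
  assert (EN : forall x, x ∈ N <-> x ∈ t \/ x = t \/ x = r).
  { intros x. unfold N. rewrite cupE, upairE. tauto. }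
  assert (HN : is_transitive N).
  { intros y Hy z Hz. rewrite EN in *. destruct Hy as [Hy | [-> | ->]].
    - left. apply (Ht y); auto.
    - auto.
    - apply upairE in Hz. destruct Hz; subst; auto. }
  exists N. split; [auto|]. split; [intros x Hx; apply EN; auto|].
  intros j Hj.
  assert (Htr : t ∈ r) by (apply upairE; auto).
  assert (Hqr : q ∈ r) by (apply upairE; auto).
  assert (Nrt : ~ r ∈ t) by (intros H; apply (mem_irrefl (Ht _ H _ Htr))).
  assert (Nrt' : ~ r = t) by (intros H; rewrite H in Htr; apply (mem_irrefl Htr)).
  assert (HtN : t ∈ N) by (apply EN; auto).
  assert (HrN : r ∈ N) by (apply EN; auto).
  destruct (emb_tot Hj HtN) as [t' [Ht'N Ht']]. destruct (emb_tot Hj HrN) as [r' [Hr'N Hr']].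
  (* This formula defines the pair of [t] and [r] in [N]; Foundation excludes other solutions. *)
  pose proof (emb2 Hj (P := fun w y => w ∈ y /\ forall v, v ∈ w \/ v = w \/ v = y) ltac:(df)
    Ht' Hr' HtN Ht'N HrN Hr'N) as K.
  destruct (proj1 K) as [K1 K2].
  { split; auto. intros v. simpl. destruct (proj1 (EN _) (proj2_sig v)) as [H | [H | H]]; auto.
    - right; left. apply substruct_eq; auto.
    - right; right. apply substruct_eq; auto. }
  simpl in K1.
  assert (K3 : forall v, v ∈ N -> v ∈ t' \/ v = t' \/ v = r').
  { intros v Hv. destruct (K2 (exist _ v Hv)) as [H | [H | H]]; auto;
      apply (f_equal (@proj1_sig _ _)) in H; auto. }
  assert (t' = t /\ r' = r) as [-> ->].
  { destruct (proj1 (EN _) Ht'N) as [H | [-> | ->]].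
    - exfalso. destruct (K3 t HtN) as [H1 | [H1 | H1]].
      + apply (mem_asym H H1).
      + subst. apply (mem_irrefl H).
      + subst r'. destruct (K3 r HrN) as [H2 | [H2 | H2]]; auto.
        * apply Nrt. apply (Ht _ H _ H2).
        * apply Nrt. rewrite H2. auto.
    - split; auto. destruct (K3 r HrN) as [H2 | [H2 | H2]]; [tauto | tauto | congruence].
    - exfalso. destruct (proj1 (EN _) Hr'N) as [H | [-> | ->]]; auto.
      + apply Nrt. apply (Ht _ H _ K1).
      + apply (mem_irrefl K1). }
  (* The image of [q] belongs to [r], hence is [t] or [q]; it is not [t], which is already the image
     of [t]. *)
  destruct (emb_tot Hj (proj2 (EN q) (or_introl Hq))) as [q' [_ Hq']].
  pose proof (proj1 (emb_mem Hj Hq' Hr') Hqr) as H. apply upairE in H.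
  destruct H as [-> | ->]; auto.
  exfalso. pose proof (emb_inj Hj Hq' Ht') as ->. apply (mem_irrefl Hq).
Qed.

(** The contradiction inside a Zermelo model. Transitive containers and [theta] are assumed; in
    $V_\Omega$ they come from the hierarchy and from collection. *)
Theorem no_Berkeley_HOD (S : eps_struct) (ZS : zermelo S) (HS : hf S) (A : S -> Prop) (X delta : S) :
  (forall n (t : Ctx S n -> S), Tm (Kc zd) t -> Df zd (fun g => A (t g))) ->
  (forall x : S, exists t, is_transitive t /\ x ∈ t) ->
  (forall Y : S, exists theta, forall alpha, alpha ∈ theta <->
     is_ordinal alpha /\ exists f, psurj Y f alpha) ->
  is_Berkeley_cardinal delta -> ~ forall y, OD A X y.
Proof.
  intros HA TC Hth [[Od _] [Nd HBer]] HOD.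
  assert (exists y0, y0 ∈ delta) as [y0 Hy0].
  { apply nonempty. intros E. apply Nd, emp_iff; auto. }
  set (Y := cup X delta).
  assert (HX : X ⊆ Y) by (intros x Hx; apply cupE; auto).
  assert (HdY : delta ⊆ Y) by (intros x Hx; apply cupE; auto).
  destruct (Hth Y) as [theta Htheta].
  assert (svc : forall E : S -> S -> Prop, Dfr2 E -> exists e : S -> S -> S -> Prop,
    Dfr3 e /\ (forall i z y, e i z y -> E i y) /\
    (forall i z y y', e i z y -> e i z y' -> y = y') /\
    (forall i y, E i y -> exists z y', z ∈ codes_of Y /\ e i z y')).
  { intros E HE. exists (chosen A y0 E). split; [|split; [|split]].
    - intros n t u v Ht Hu Hv. apply Df_chosen; auto.
    - intros i z y. apply chosen_E.
    - intros i z y y'. apply chosen_fun; auto.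
    - intros i y. apply (chosen_ex (X := X)); auto. }
  destruct (splitting (HdY _ Hy0) Od HdY svc Htheta) as [G [b [HG [B1 [B2 [B3 B4]]]]]].
  pose proof (theta_ord Htheta) as Ot.
  set (B := pow (prod omega theta)).
  (* One tuple for everything the embedding has to fix; a fixed pair has fixed components. *)
  destruct (TC (opair theta (opair omega (opair B (opair b (opair G delta)))))) as [t [Ht Hq]].
  destruct (tower_fix Ht Hq) as [N [HN [HtN Hfix]]].
  assert (HdN : delta ∈ N).
  { apply HtN. do 5 (apply (trans_opair Ht) in Hq; destruct Hq as [_ Hq]). auto. }
  destruct (HBer N HN HdN y0 Hy0) as [j [kappa [Hj [[_ [[x [Hx Nx]] _]] [_ Hk]]]]].
  pose proof (Hfix j Hj) as F.
  apply (emb_fix_opair HN Hj) in F. destruct F as [F1 F].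
  apply (emb_fix_opair HN Hj) in F. destruct F as [F2 F].
  apply (emb_fix_opair HN Hj) in F. destruct F as [F3 F].
  apply (emb_fix_opair HN Hj) in F. destruct F as [F4 F].
  apply (emb_fix_opair HN Hj) in F. destruct F as [F5 _].
  destruct (emb_normal HN Hj Ot F1 (emb_dom Hj F2) F3) as [f [Nf Hf]].
  destruct (B1 kappa Hk) as [xi Hxi].
  destruct (B4 kappa xi f Hxi Nf) as [a [Ha HGa]].
  assert (HxiN : xi ∈ N).
  { pose proof HGa as H. apply rel_iff in H. apply (HN _ (emb_dom Hj F5)) in H.
    apply (trans_opair HN H). }
  destruct (emb_tot Hj HxiN) as [xi' [_ Hxi']].
  (* As [G] and [a] are fixed, so is the value [xi]. Then [kappa] and its image [x] have the same
     value under the injective [b]. *)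
  pose proof (emb_rel HN Hj F5 (Hf _ _ Ha) Hxi' HGa) as HGa'.
  pose proof (HG _ _ _ HGa HGa') as <-.
  apply Nx. apply (B2 x kappa xi); auto.
  apply (emb_rel HN Hj F4 Hx Hxi' Hxi).
Qed.

(** * Initial segments of the cumulative hierarchy *)

Section Lengths.
Context {S : eps_struct} {ZS : zermelo S} {HS : hf S}.

(* [alpha] is the length of the (nonstrict) prewellordering [r] of a subset of [Z]. *)
Definition rank_fun (Z r f alpha : S) : Prop :=
  (forall z b b', rel f z b -> rel f z b' -> b = b') /\
  (forall b, b ∈ alpha -> exists z, z ∈ Z /\ rel f z b) /\
  (forall z b, rel f z b -> z ∈ Z /\ b ∈ alpha) /\
  (forall q, q ∈ r <-> exists z z' b b', is_opair q z z' /\ rel f z b /\ rel f z' b' /\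
     forall x, x ∈ b -> x ∈ b').
Definition len (Z r alpha : S) : Prop :=
  is_ordinal alpha /\ exists f, rank_fun Z r f alpha.

Lemma rank_fun_rel Z r f alpha z z' : rank_fun Z r f alpha ->
  (rel r z z' <-> exists b b', rel f z b /\ rel f z' b' /\ b ⊆ b').
Proof.
  intros [_ [_ [_ H]]]. rewrite rel_iff, H. split.
  - intros [w [w' [b [b' [E K]]]]]. apply opair_iff, opair_inj in E. destruct E; subst; eauto.
  - intros [b [b' K]]. exists z, z', b, b'. rewrite opair_iff. auto.
Qed.

(** Two rank functions of one prewellordering assign the same ranks, by induction on the rank.
    Applied in both directions, this makes lengths unique. *)
Lemma rank_fun_le Z r f f' alpha alpha' : is_ordinal alpha -> is_ordinal alpha' ->
  rank_fun Z r f alpha -> rank_fun Z r f' alpha' -> alpha ⊆ alpha'.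
Proof.
  intros Oa Oa' R R'.
  assert (Q : forall b, is_ordinal b -> forall z, rel f z b -> rel f' z b).
  { refine (ord_ind (P := fun b : S => forall z, rel f z b -> rel f' z b) _ _); [df|].
    intros b Ob IH z Hz.
    destruct (proj1 (proj2 (proj2 R)) z b Hz) as [HzZ Hba].
    assert (Hzz : rel r z z) by (apply (rank_fun_rel z z R); exists b, b; auto).
    destruct (proj1 (rank_fun_rel z z R') Hzz) as [c [_ [Hc _]]].
    enough (b = c) by (subst; auto).
    destruct (proj1 (proj2 (proj2 R')) z c Hc) as [_ Hca].
    pose proof (ord_elem Oa' Hca) as Oc.
    apply sub_ext; intros x Hx.
    - pose proof (ord_trans Oa Hba Hx) as Hxa. pose proof (ord_elem Oa Hxa) as Ox.
      destruct (proj1 (proj2 R) x Hxa) as [z' [_ Hz']].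
      pose proof (IH x Hx z' Hz') as Hx'.
      destruct (ord_tri Ox Oc) as [H | H]; auto. exfalso.
      assert (Hr : rel r z z').
      { apply (rank_fun_rel z z' R'). exists c, x. split; auto. split; auto.
        apply ord_sub; auto. destruct H; auto. }
      apply (rank_fun_rel z z' R) in Hr. destruct Hr as [b1 [x1 [H1 [H2 H3]]]].
      rewrite (proj1 R _ _ _ H1 Hz), (proj1 R _ _ _ H2 Hz') in H3.
      apply (mem_irrefl (H3 _ Hx)).
    - pose proof (ord_trans Oa' Hca Hx) as Hxa. pose proof (ord_elem Oa' Hxa) as Ox.
      destruct (proj1 (proj2 R') x Hxa) as [z' [_ Hz']].
      assert (Hr : rel r z' z).
      { apply (rank_fun_rel z' z R'). exists x, c. split; auto. split; auto.
        apply ord_sub; auto. }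
      apply (rank_fun_rel z' z R) in Hr. destruct Hr as [y [b1 [H1 [H2 H3]]]].
      rewrite (proj1 R _ _ _ H2 Hz) in H3. clear b1 H2.
      assert (Oy : is_ordinal y) by (apply (ord_elem Oa); apply (proj1 (proj2 (proj2 R)) z' y H1)).
      apply ord_sub in H3; auto. destruct H3 as [-> | H3].
      + exfalso. assert (Hr : rel r z z').
        { apply (rank_fun_rel z z' R). exists b, b. auto. }
        apply (rank_fun_rel z z' R') in Hr. destruct Hr as [c1 [x1 [K1 [K2 K3]]]].
        rewrite (proj1 R' _ _ _ K1 Hc), (proj1 R' _ _ _ K2 Hz') in K3.
        apply (mem_irrefl (K3 _ Hx)).
      + rewrite (proj1 R' _ _ _ Hz' (IH y H3 z' H1)). auto. }
  intros b Hb. destruct (proj1 (proj2 R) b Hb) as [z [_ Hz]].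
  apply (proj1 (proj2 (proj2 R')) z). apply Q; auto. apply (ord_elem Oa Hb).
Qed.

Ltac df_more ::= first [df_hyp | progress unfold psurj, len, rank_fun].

(** A partial surjection from [Z] onto [alpha] prewellorders a subset of [Z] with length [alpha].
    Such prewellorderings form a set, and collection bounds their lengths. *)
Lemma theta_ex (coll : forall Z : S, collection_for (fun r alpha => len Z r alpha)) (Y : S) :
  exists theta, forall alpha, alpha ∈ theta <-> is_ordinal alpha /\ exists f, psurj Y f alpha.
Proof.
  set (Z := codes_of Y).
  sep (fun r : S => exists alpha, len Z r alpha) (pow (prod Z Z)) as a Ha.
  destruct (coll Z a) as [b Hb].
  { intros r Hr. apply Ha in Hr. tauto. }
  sep (fun alpha : S => is_ordinal alpha /\ exists f, psurj Y f alpha) b as theta Ht.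
  exists theta. intros alpha. rewrite Ht. split; [tauto|]. intros H. split; auto.
  destruct H as [Oa [f [F1 F2]]].
  sep (fun p : S => p ∈ f) (prod Z alpha) as f0 Hf0.
  assert (R0 : forall z c, rel f0 z c <-> z ∈ Z /\ c ∈ alpha /\ rel f z c).
  { intros z c. rewrite !rel_iff, Hf0, opair_prod. tauto. }
  sep (fun q : S => exists z z' c c', is_opair q z z' /\ rel f0 z c /\ rel f0 z' c' /\
     forall x, x ∈ c -> x ∈ c') (prod Z Z) as r Hr.
  assert (Rk : rank_fun Z r f0 alpha).
  { split; [|split; [|split]].
    - intros z c c' H1 H2. apply R0 in H1, H2. apply (F1 z); tauto.
    - intros c Hc. destruct (F2 c Hc) as [z [Hz H]]. exists z. split; auto. apply R0. auto.
    - intros z c H. apply R0 in H. tauto.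
    - intros q. rewrite Hr. split; [tauto|]. intros H. split; auto.
      destruct H as [z [z' [c [c' [E [H1 [H2 _]]]]]]]. apply opair_iff in E. subst.
      apply R0 in H1, H2. apply opair_prod. tauto. }
  assert (Hra : r ∈ a).
  { apply Ha. split.
    - apply powE. intros q Hq. apply Hr in Hq. tauto.
    - exists alpha. split; eauto. }
  destruct (Hb r Hra) as [alpha' [Hb' [Oa' [f' Rk']]]].
  enough (alpha = alpha') by (subst; auto).
  apply sub_ext; [apply (rank_fun_le Oa Oa' Rk Rk') | apply (rank_fun_le Oa' Oa Rk' Rk)].
Qed.
End Lengths.

(** * Transfer of definability and set theory from the model to $V_\Omega$ *)

Fixpoint cmap (M : eps_struct) (V : M) n : Ctx (substruct V) n -> Ctx M n :=
  match n with
  | O => fun _ => tt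
  | Datatypes.S n => fun g => (cmap (fst g), proj1_sig (snd g))
  end.

Lemma Tm_cmap (M : eps_struct) (V : M) (K : M -> Prop) n (t : Ctx (substruct V) n -> substruct V) :
  (forall x, K x) -> Tm (fun _ => True) t ->
  exists t', Tm K t' /\ forall g, proj1_sig (t g) = t' (cmap g).
Proof.
  intros HK. induction 1 as [n a Ha | n | n t Ht [t' [IH1 IH2]]].
  - exists (fun _ => proj1_sig a). split; [apply Tm_c; auto | auto].
  - exists (fun g => snd g). split; [apply Tm_0 | auto].
  - exists (fun g => t' (fst g)). split; [apply Tm_s; auto|]. intros g. apply IH2.
Qed.

(** Definable on $V_\Omega$ means here: the trace of a property definable in [M]. This admits every
    set of [M], in particular the predicate [A], as a parameter. *)
Definition sub_defsys (M : eps_struct) (ZM : zermelo M) (V : M) : defsys (substruct V).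
Proof.
  refine {| Kc := fun _ => True; Df := fun n P => exists Q, Df zd Q /\ forall g, P g <-> Q (cmap g) |}.
  - intros n P Q H [R [HR E]]. exists R. split; auto. intros g. rewrite <- H. auto.
  - intros n t u Ht Hu. destruct (Tm_cmap z_K Ht) as [t' [Ht' Et]].
    destruct (Tm_cmap z_K Hu) as [u' [Hu' Eu]].
    exists (fun g => t' g ∈ u' g). split; [apply Df_mem; auto|].
    intros g. simpl. rewrite Et, Eu. tauto.
  - intros n t u Ht Hu. destruct (Tm_cmap z_K Ht) as [t' [Ht' Et]].
    destruct (Tm_cmap z_K Hu) as [u' [Hu' Eu]].
    exists (fun g => t' g = u' g). split; [apply Df_eq; auto|].
    intros g. rewrite <- Et, <- Eu. split; [intros ->; auto | apply substruct_eq].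
  - intros n P [Q [HQ E]]. exists (fun g => ~ Q g). split; [apply Df_not; auto|].
    intros g. rewrite E. tauto.
  - intros n P P' [Q [HQ E]] [Q' [HQ' E']]. exists (fun g => Q g /\ Q' g).
    split; [apply Df_and; auto|]. intros g. rewrite E, E'. tauto.
  - intros n P [Q [HQ E]]. exists (fun g => exists x, x ∈ V /\ Q (g, x)). split.
    + apply Df_ex, Df_and.
      * apply Df_mem; [apply Tm_0 | apply Tm_c, z_K].
      * revert HQ. apply Df_iff. intros [g x]. simpl. tauto.
    + intros g. split.
      * intros [x Hx]. exists (proj1_sig x). split; [apply proj2_sig|]. apply (E (g, x)). exact Hx.
      * intros [x [Hx H]]. exists (exist _ x Hx). apply (E (g, exist _ x Hx)). exact H.
Defined.

Definition zermelo_of_ZF (M : eps_struct) (hM : models_ZF M) (m0 : M) : zermelo M.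
Proof.
  destruct hM as [[H1 [H2 [H3 [H4 [H5 H6]]]]] H7].
  refine {| zd := form_defsys m0 |}; auto.
  - simpl. auto.
  - intros P [phi [rho H]] a. destruct (proj1 (H7 phi rho) a) as [b Hb].
    exists b. intros x. rewrite Hb. rewrite (H (tt, x)). simpl. tauto.
Defined.

Section Hierarchy.
Context {M : eps_struct} {ZM : zermelo M}.
Variables Omega V : M.
Hypothesis hOmega : is_ordinal Omega.
Hypothesis hV : is_V Omega V.
Hypothesis hfin : ZF_finite_part (substruct V).
Let SV : eps_struct := substruct V.

Lemma hierarchy : exists lev : M -> M -> Prop, Dfr2 lev /\
  (forall b, b ∈ succ Omega -> exists u, lev b u) /\
  (forall b u x, lev b u -> (x ∈ u <-> exists c w, c ∈ b /\ lev c w /\ x ⊆ w)) /\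
  lev Omega V.
Proof.
  destruct hV as [a1 [f [E [[_ [H1 H2]] [H3 H4]]]]]. apply succ_iff in E. subst a1.
  exists (rel f). split; [intros n t u Ht Hu; df|]. split; auto.
Qed.

Lemma level_transitive (lev : M -> M -> Prop) : Dfr2 lev ->
  (forall b u x, lev b u -> (x ∈ u <-> exists c w, c ∈ b /\ lev c w /\ x ⊆ w)) ->
  forall b, is_ordinal b -> forall u, lev b u -> is_transitive u.
Proof.
  intros D H. refine (ord_ind (P := fun b : M => forall u, lev b u -> is_transitive u) _ _); [df|].
  intros b Ob IH u Hu x Hx y Hy.
  apply (H b u x Hu) in Hx. destruct Hx as [c [w [Hc [Hw Hx]]]].
  apply (H b u y Hu). exists c, w. split; auto. split; auto. apply (IH c Hc w Hw y). auto.
Qed.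

Lemma level_ordinals (lev : M -> M -> Prop) : Dfr2 lev ->
  (forall b u x, lev b u -> (x ∈ u <-> exists c w, c ∈ b /\ lev c w /\ x ⊆ w)) ->
  forall b, is_ordinal b -> forall u a, lev b u -> is_ordinal a -> a ∈ u -> a ∈ b.
Proof.
  intros D H.
  refine (ord_ind (P := fun b : M =>
    forall u a, lev b u -> is_ordinal a -> a ∈ u -> a ∈ b) _ _); [df|].
  intros b Ob IH u a Hu Oa Ha.
  apply (H b u a Hu) in Ha. destruct Ha as [c [w [Hc [Hw Ha]]]].
  assert (Hs : a ⊆ c).
  { intros x Hx. apply (IH c Hc w x Hw); auto. apply (ord_elem Oa Hx). }
  apply ord_sub in Hs; [|auto | apply (ord_elem Ob Hc)].
  destruct Hs as [-> | Hs]; auto. apply (ord_trans Ob Hc Hs).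
Qed.

Lemma V_transitive : is_transitive V.
Proof.
  destruct hierarchy as [lev [D [_ [H HV]]]]. apply (level_transitive D H hOmega HV).
Qed.

Lemma V_subset x y : x ∈ V -> y ⊆ x -> y ∈ V.
Proof.
  destruct hierarchy as [lev [D [_ [H HV]]]]. intros Hx Hy.
  apply (H Omega V x HV) in Hx. destruct Hx as [c [w [Hc [Hw Hx]]]].
  apply (H Omega V y HV). exists c, w. auto.
Qed.

Lemma V_container x : x ∈ V -> exists w, w ∈ V /\ is_transitive w /\ x ⊆ w.
Proof.
  destruct hierarchy as [lev [D [_ [H HV]]]]. intros Hx.
  apply (H Omega V x HV) in Hx. destruct Hx as [c [w [Hc [Hw Hx]]]].
  exists w. split; [|split; auto].
  - apply (H Omega V w HV). exists c, w. auto.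
  - apply (level_transitive D H (ord_elem hOmega Hc) Hw).
Qed.

Lemma sub_mem_iff (x : SV) z : z ∈ proj1_sig x <-> exists z' : SV, proj1_sig z' = z /\ z' ∈ x.
Proof.
  split.
  - intros Hz. exists (exist _ z (V_transitive (proj2_sig x) Hz)). auto.
  - intros [z' [<- H]]. exact H.
Qed.

(** Separation is carried out in [M]; the result stays in [V], which is closed under subsets. *)
#[local] Instance zermelo_sub : zermelo SV.
Proof.
  refine {| zd := sub_defsys ZM V |}; try apply hfin.
  - simpl. auto.
  - intros P [Q [HQ E]] a.
    assert (HQ' : @Df M zd 1 (fun g => Q (tt, snd g))).
    { revert HQ. apply Df_iff. intros [[] x]. simpl. tauto. }
    destruct (z_sep (P := fun x => Q (tt, x)) HQ' (proj1_sig a)) as [b Hb].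
    assert (HbV : b ∈ V).
    { apply (V_subset (proj2_sig a)). intros z Hz. apply Hb in Hz. tauto. }
    exists (exist _ b HbV). intros x. simpl. rewrite Hb. rewrite (E (tt, x)). simpl. tauto.
Defined.

Lemma sub_upair_val (x y : SV) : proj1_sig (upair x y) = upair (proj1_sig x) (proj1_sig y).
Proof. apply (sub_upair V_transitive). apply upair_iff. auto. Qed.

Lemma sub_succ_val (x : SV) : proj1_sig (succ x) = succ (proj1_sig x).
Proof.
  apply z_ext. intros z. rewrite sub_mem_iff, succE. split.
  - intros [z' [<- H]]. apply succE in H. destruct H as [H | ->]; auto.
  - intros [H | ->].
    + apply sub_mem_iff in H. destruct H as [z' [<- H]]. exists z'. rewrite succE. auto.
    + exists x. rewrite succE. auto.
Qed.

Lemma sub_emp_val : proj1_sig (emp : SV) = emp.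
Proof.
  apply emp_iff. intros z Hz. apply sub_mem_iff in Hz. destruct Hz as [z' [_ H]].
  apply (empE H).
Qed.

(** [V] itself has the closure properties, as its pairs and successors are computed as in [M]. *)
#[local] Instance hf_universe : hf M.
Proof.
  constructor. exists V. split; [|split].
  - intros x Hx. apply emp_iff in Hx. subst. rewrite <- sub_emp_val. apply proj2_sig.
  - intros x y z Hx Hy Hz. apply upair_iff in Hz. subst.
    pose proof (sub_upair_val (exist _ x Hx) (exist _ y Hy)) as E. simpl in E. rewrite <- E.
    apply proj2_sig.
  - intros x z Hx Hz. apply succ_iff in Hz. subst.
    pose proof (sub_succ_val (exist _ x Hx)) as E. simpl in E. rewrite <- E. apply proj2_sig.
Qed.

Lemma omega_in_V : omega ∈ V.
Proof.
  apply (V_subset (proj2_sig (omega : SV))). apply omega_sub. split.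
  - intros y Hy. apply emp_iff in Hy. subst. rewrite <- sub_emp_val. exact omega0.
  - intros y z Hy Hz. apply succ_iff in Hz. subst. apply sub_mem_iff in Hy.
    destruct Hy as [y' [<- Hy]]. rewrite <- sub_succ_val. exact (omegaS Hy).
Qed.

(** Here the closed set is $V_\omega$, the level at [omega], which exists below [Omega] because
    [omega] belongs to [V]. *)
#[local] Instance hf_sub : hf SV.
Proof.
  destruct hierarchy as [lev [D [T [H HV]]]].
  assert (Ho : omega ∈ Omega)
    by (apply (level_ordinals D H hOmega HV); auto using omega_in_V, omega_ord).
  assert (HoS : forall n, n ∈ succ omega -> n ∈ succ Omega).
  { intros n Hn. rewrite succE in *. left. destruct Hn as [Hn | ->]; auto.
    apply (ord_trans hOmega Ho Hn). }
  assert (Tn : forall n, n ∈ omega -> exists u, lev n u).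
  { intros n Hn. apply T, HoS, succE. auto. }
  destruct (T omega) as [W HW]. { apply HoS, succE; auto. }
  assert (HWV : W ∈ V) by (apply (H Omega V W HV); exists omega, W; auto).
  assert (W1 : forall n u x, n ∈ omega -> lev n u -> x ⊆ u -> x ∈ W).
  { intros n u x Hn Hu Hx. apply (H omega W x HW). eauto. }
  constructor. exists (exist _ W HWV). split; [|split].
  - intros x Hx. apply emp_iff in Hx. subst. simpl. rewrite sub_emp_val.
    destruct (Tn emp omega0) as [u Hu]. apply (W1 emp u emp omega0 Hu).
    intros z Hz. destruct (empE Hz).
  - intros x y z Hx Hy Hz. simpl in *. apply upair_iff in Hz. subst. rewrite sub_upair_val.
    apply (H omega W _ HW) in Hx, Hy.
    destruct Hx as [n [u [Hn [Hu Hx]]]], Hy as [m [v [Hm [Hv Hy]]]].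
    destruct (nat_max (omegaS Hn) (omegaS Hm)) as [k [Hk [K1 K2]]].
    destruct (Tn k Hk) as [w Hw]. apply (W1 k w _ Hk Hw).
    intros p Hp. apply upairE in Hp. apply (H k w p Hw). destruct Hp as [-> | ->].
    + exists n, u. split; [apply K1, succE|]; auto.
    + exists m, v. split; [apply K2, succE|]; auto.
  - intros x z Hx Hz. simpl in *. apply succ_iff in Hz. subst. rewrite sub_succ_val.
    apply (H omega W _ HW) in Hx. destruct Hx as [n [u [Hn [Hu Hx]]]].
    destruct (Tn (succ n) (omegaS Hn)) as [w Hw]. apply (W1 (succ n) w _ (omegaS Hn) Hw).
    intros p Hp. apply (H (succ n) w p Hw). exists n, u. split; [apply succE; auto|]. split; auto.
    apply succE in Hp. destruct Hp as [Hp | ->]; auto.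
    apply (level_transitive D H (nat_ord Hn) Hu). auto.
Qed.

Ltac df_more ::= progress unfold len, rank_fun.

(** The collection scheme of $V_\Omega$ concerns internal formulas, so [len] is certified in
    [int_defsys], with [Z] as the parameter. *)
Lemma sub_len_collection :
  (forall c s, is_formula false c -> is_assign V s ->
     collection_for (fun x y : SV => Sat2 V None c s (proj1_sig x) (proj1_sig y))) ->
  forall Z : SV, collection_for (fun r alpha => len Z r alpha).
Proof.
  intros HC Z.
  apply (int_collection (P := fun g : Ctx SV 3 => len (snd g) (snd (fst (fst g))) (snd (fst g)))
    (p := Z) HC).
  exact (ltac:(df) : @Df SV (int_defsys V) 3
    (fun g => len (snd g) (snd (fst (fst g))) (snd (fst g)))).
Qed.

Lemma no_HOD_rank (A : M) (X delta : SV) :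
  (forall c s, is_formula false c -> is_assign V s ->
     collection_for (fun x y : SV => Sat2 V None c s (proj1_sig x) (proj1_sig y))) ->
  is_Berkeley_cardinal delta ->
  ~ forall y : SV, OD (fun x : SV => proj1_sig x ∈ A) X y.
Proof.
  intros HC HBer. apply (no_Berkeley_HOD (ZS := zermelo_sub) (HS := hf_sub) (delta := delta)); auto.
  - intros n t Ht. destruct (Tm_cmap z_K Ht) as [t' [Ht' Et]].
    exists (fun g => t' g ∈ A). split; [apply Df_mem; auto; apply Tm_c, z_K|].
    intros g. rewrite Et. tauto.
  - intros x. destruct (V_container (proj2_sig x)) as [w [Hw [Tw Hx]]].
    set (w' := exist _ w Hw : SV).
    (* Adding [x] to a transitive set that includes it keeps the set transitive. *)
    exists (cup w' (upair x x)). split; [|apply cupE; right; apply upairE; auto].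
    intros y Hy z Hz. rewrite cupE in *. left. destruct Hy as [Hy | Hy].
    + exact (Tw _ Hy _ Hz).
    + apply upairE in Hy. assert (y = x) as -> by tauto. exact (Hx _ Hz).
  - apply theta_ex, sub_len_collection, HC.
Qed.
End Hierarchy.

Theorem theorem3p26 (M : eps_struct) (hM : models_ZF M)
    (Omega V : M) (hOmega : is_ordinal Omega) (hV : is_V Omega V)
    (hZF : set_models_ZF V None)
    (hB : exists delta : substruct V, is_Berkeley_cardinal delta) :
  ~ exists A : M,
      (A ⊆ V) /\
      set_models_ZF V (Some A) /\
      exists X : substruct V, forall y : substruct V,
        HOD (fun x : substruct V => proj1_sig x ∈ A) X y.
Proof.
  intros [A [_ [_ [X HX]]]]. destruct hB as [delta Hd].
  (* [Omega] merely supplies some element of [M] with which to fill assignments. *)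
  pose (ZM := zermelo_of_ZF hM Omega).
  apply (no_HOD_rank (ZM := ZM) hOmega hV (proj1 hZF) (A := A) (X := X) (delta := delta)); auto.
  - intros c s Hc Hs. apply (proj2 hZF c s Hc Hs).
  - intros y. destruct (HX y) as [p [t [Hp [[Ht _] HO]]]]. apply HO, Ht, Hp. auto.
Qed.
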